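(* Let $n\ge 1$, fix $a\in[0,\infty]$, $k_3\ge 0$ and a partition $\lambda\in P_+=\{\lambda\in\mathbb Z_+^n:\lambda_1\ge\dots\ge\lambda_n\}$, and put $\gamma_a=\frac{a+1}{a+2}$ (with $\gamma_\infty=1$). For $t\in\mathbb R^n$ let $x(t)\in\mathbb R_+^n$ be given by $x_i(t)=\gamma_a+\sinh^2\!\bigl(\tfrac{t_i}{2}\bigr)$. Let $k=(k_1,k_2,k_3)$ with $k_1,k_2\ge 0$. Then, as $k_1+k_2\to\infty$ and $k_1/k_2\to a$ (with $k_3$ fixed), $$\lim_{\substack{k_1+k_2\to\infty\\ k_1/k_2\to a}}P_\lambda^{BC}(k;t)=4^{|\lambda|}\,j_\lambda^{k_3}(x(t)),$$ and the convergence is locally uniform in $t\in\mathbb R^n$. In particular, if $a=\infty$, then $$\lim_{\substack{k_1+k_2\to\infty\\ k_1/k_2\to \infty}}P_\lambda^{BC}(k;t)=4^{|\lambda|}j_\lambda^{k_3}\bigl(\cosh^2\tfrac t2\bigr)=\Bigl(\prod_{i=1}^n4\cosh^2\tfrac{t_i}{2}\Bigr)^{|\lambda|/n}\cdot P^A_{\pi(\lambda)}\bigl(k_3;\pi\bigl(\log\cosh^2\tfrac t2\bigr)\bigr).$$ Here $\cosh^2\frac t2$ and $\log\cosh^2\frac t2$ are understood componentwise, as vectors in $\mathbb R^n$.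
   Context: General Jacobi polynomials. Let $\mathfrak a$ be a finite-dimensional Euclidean space, $R\subset\mathfrak a$ a crystallographic root system (not necessarily reduced) with Weyl group $W$, fixed positive subsystem $R_+$, $\alpha^\vee=2\alpha/\langle\alpha,\alpha\rangle$, and $k=(k_\alpha)_{\alpha\in R}$ a $W$-invariant multiplicity function with $k_\alpha\ge0$. Put $\rho(k)=\frac12\sum_{\alpha\in R_+}k_\alpha\alpha$, $P=\{\lambda\in\mathfrak a:\langle\lambda,\alpha^\vee\rangle\in\mathbb Z\ \forall\alpha\in R\}$, and let the dominant weights be those $\lambda\in P$ with $\langle\lambda,\alpha^\vee\rangle\ge0$ for all $\alpha\in R_+$. For dominant weights, $\mu<\lambda$ means $\mu\ne\lambda$ and $\lambda-\mu$ is a sum of positive roots. Let $M_\lambda(t)=\sum_{\mu\in W\lambda}e^{\langle\mu,t\rangle}$. The Jacobi polynomials $P_\lambda(k)=P_\lambda(k;\cdot)$, $\lambda$ dominant, are uniquely characterized by: (i) $P_\lambda(k)=M_\lambda+\sum_{\mu<\lambda}c_{\lambda\mu}(k)M_\mu$ with $c_{\lambda\mu}(k)\in\mathbb C$; (ii) $L_kP_\lambda(k)=\langle\lambda,\lambda+2\rho(k)\rangle P_\lambda(k)$, where $L_k=\Delta_{\mathfrak a}+\sum_{\alpha\in R_+}k_\alpha\coth\frac{\langle\alpha,t\rangle}{2}\,\partial_\alpha$ ($\Delta_{\mathfrak a}$ the Laplacian, $\partial_\alpha$ the derivative in direction $\alpha$). Type $BC_n$: $\mathfrak a=\mathbb R^n$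 with standard inner product, $R_+=\{e_i,2e_i:1\le i\le n\}\cup\{e_i\pm e_j:1\le i<j\le n\}$; $k=(k_1,k_2,k_3)$, where $k_1,k_2,k_3$ are the values on $\pm e_i$, $\pm2e_i$, $\pm e_i\pm e_j$ respectively. The dominant weights are $P_+$; the Jacobi polynomials are written $P_\lambda^{BC}(k;t)$. Type $A_{n-1}$: $\mathfrak a=\mathbb R^n_0=\{t\in\mathbb R^n:t_1+\dots+t_n=0\}$, $R_+=\{e_i-e_j:i<j\}$, with a single multiplicity $\kappa\ge0$. Let $\pi(t)=t-\frac1n\langle t,\omega_n\rangle\omega_n$, $\omega_n=e_1+\dots+e_n$, be the orthogonal projection onto $\mathbb R_0^n$. The dominant weights are $\pi(P_+)$; the Jacobi polynomials are written $P^A_{\pi(\lambda)}(\kappa;t)$, $t\in\mathbb R_0^n$. Monic Jack polynomials: for $\kappa\ge0$ and $\lambda\in P_+$, $j_\lambda^\kappa$ is the unique symmetric polynomial in $n$ variables, homogeneous of degree $|\lambda|=\lambda_1+\dots+\lambda_n$, of the form $j_\lambda^\kappa=m_\lambda+\sum_{\mu<\lambda}c_{\lambda\mu}(\kappa)m_\mu$ (dominance order on partitions; $m_\lambda(x)=\sum_{\mu\in S_n\lambda}x^\mu$), which is an eigenfunction of $D_\kappa=\sum_ix_i^2\frac{\partial^2}{\partial x_i^2}+2\kappa\sum_{i\ne j}\frac{x_i^2}{x_i-x_j}\frac{\partial}{\partial x_i}$; its eigenvalue is $d_\lambda(\kappa)=\sum_i\lambda_i(\lambda_i-1+2\kappa(n-i))$.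 Convention: $k_1/k_2=\infty$ if $k_2=0<k_1$. *)

(* Defs.v *)
From HB Require Import structures.
From mathcomp Require Import all_boot all_order all_algebra all_fingroup.
From mathcomp Require mpoly.
From mathcomp Require Import complex.

Set Implicit Arguments.
Unset Strict Implicit.
Unset Printing Implicit Defensive.

(* [mpoly] is imported only inside this module, since its notations clash with
   those of MathComp-Analysis. *)
Module Jack.
Import mpoly.
Import GRing.Theory.
Local Open Scope ring_scope.

Definition mpoly_over (F : fieldType) (n : nat) := {mpoly F[n]}.

Definition evaluate (F : fieldType) n (p : mpoly_over F n) (z : 'I_n -> F) : F :=
  p.@[z].

Definition partition_of_length n (lam : 'I_n -> nat) : Prop :=
  forall i j : 'I_n, (i <= j)%N -> (lam j <= lam i)%N.

Definition weight n (lam : 'I_n -> nat) : nat := (\sum_(i < n) lam i)%N.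

Definition dominance_le n (mu lam : 'I_n -> nat) : bool :=
  (weight mu == weight lam) &&
  [forall r : 'I_n.+1,
     (\sum_(i < n | (i < r)%N) mu i <= \sum_(i < n | (i < r)%N) lam i)%N].

Definition monomial_symmetric (F : fieldType) n (lam : 'I_n -> nat) :
    {mpoly F[n]} :=
  \sum_(m <- undup (codom (fun s : 'S_n => [multinom lam (s i) | i < n]))) 'X_[m].

(* A partition of the same weight as [lam] has all its parts in
   {0, ..., weight lam}, so that the partitions strictly below [lam] in the
   dominance order form a subset of the following finite type. *)
Definition bounded_parts n (lam : 'I_n -> nat) : finType :=
  {ffun 'I_n -> 'I_(weight lam).+1}.

Definition strictly_below n (lam : 'I_n -> nat) (mu : bounded_parts lam) : bool :=
  [&& [forall i : 'I_n, forall j : 'I_n, (i <= j)%N ==> (mu j <= mu i)%N],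
      dominance_le (fun i => mu i : nat) lam
    & [exists i, (mu i : nat) != lam i]].

(* The value at z of D_kappa p; meaningful when the z_i are distinct. *)
Definition jack_operator (F : fieldType) n (kappa : F) (p : {mpoly F[n]})
    (z : 'I_n -> F) : F :=
  \sum_(i < n) z i ^+ 2 * (p^`M(i)^`M(i)).@[z]
  + 2%:R * kappa * \sum_(i < n) \sum_(j < n | j != i)
      z i ^+ 2 / (z i - z j) * (p^`M(i)).@[z].

Definition jack_eigenvalue (F : fieldType) n (kappa : F) (lam : 'I_n -> nat) : F :=
  \sum_(i < n) (lam i)%:R * ((lam i)%:R - 1 + 2%:R * kappa * (n - i.+1)%:R).

Definition is_jack (F : fieldType) n (kappa : F) (lam : 'I_n -> nat)
    (p : {mpoly F[n]}) : Prop :=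
  [/\ p \is symmetric,
      p \is (weight lam).-homog,
      exists c : bounded_parts lam -> F,
        p = monomial_symmetric F lam
            + \sum_(mu : bounded_parts lam | strictly_below mu)
                c mu *: monomial_symmetric F (fun i => mu i : nat)
    & forall z : 'I_n -> F, injective z ->
        jack_operator kappa p z = jack_eigenvalue kappa lam * p.@[z]].

End Jack.

From mathcomp Require Import all_classical all_reals all_analysis.
Import Order.TTheory GRing.Theory Num.Theory.
Import numFieldNormedType.Exports.

Export Jack.

Local Open Scope classical_set_scope.
Local Open Scope ring_scope.
Local Open Scope complex_scope.

Section Hyperbolic.
Context {R : realType}.
Definition cosh (x : R) : R := (expR x + expR (- x)) / 2.
Definition sinh (x : R) : R := (expR x - expR (- x)) / 2.
Definition coth (x : R) : R := cosh x / sinh x.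
End Hyperbolic.

Section Jacobi.
Context {R : realType} {n : nat}.
Local Notation vec := 'rV[R]_n.

Definition dot (u v : vec) : R := \sum_(i < n) u 0 i * v 0 i.

(* A root system in a Euclidean space is given by a linear subspace [a] of R^n
   with the induced inner product, the duplicate-free list [Rp] of its positive
   roots, which lie in [a], and a multiplicity function [k]. *)
Implicit Types (a : set vec) (Rp : seq vec) (k : vec -> R).

Definition all_roots Rp : seq vec := Rp ++ [seq - alpha | alpha <- Rp].

Definition coroot (alpha : vec) : vec := (2 / dot alpha alpha) *: alpha.

Definition reflection (alpha v : vec) : vec := v - dot v (coroot alpha) *: alpha.

Definition weyl_orbit Rp (lam : vec) : set vec :=
  [set mu | exists2 s : seq vec, {subset s <= all_roots Rp} &
                                 mu = foldr reflection lam s].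

Definition rho Rp k : vec := 2^-1 *: \sum_(alpha <- Rp) k alpha *: alpha.

Definition dominant_weight a Rp : set vec :=
  [set lam | [/\ a lam,
    forall alpha, alpha \in all_roots Rp -> dot lam (coroot alpha) \is a Num.int
  & forall alpha, alpha \in Rp -> 0 <= dot lam (coroot alpha)]].

Definition weight_lt Rp (mu lam : vec) : Prop :=
  mu <> lam /\
  exists2 s : seq vec, {subset s <= Rp} & lam - mu = \sum_(alpha <- s) alpha.

Definition orbit_sum Rp (lam t : vec) : R :=
  \sum_(mu \in weyl_orbit Rp lam) expR (dot mu t).

(* R[i] has no structure of normed module over R, hence the derivative is taken
   on the real and imaginary parts. *)
Definition dir_deriv (v : vec) (f : vec -> R[i]) (t : vec) : R[i] :=
  'D_v (fun s => complex.Re (f s)) t +i* 'D_v (fun s => complex.Im (f s)) t.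

Definition orthonormal_basis a (b : seq vec) : Prop :=
  [/\ uniq b,
      forall v, v \in b -> a v,
      {in b &, forall u v, dot u v = (u == v)%:R}
    & forall u, a u -> u \in <<b>>%VS].

(* The operator L_k, [b] being an orthonormal basis of the Euclidean space. *)
Definition jacobi_operator (b : seq vec) Rp k (f : vec -> R[i]) (t : vec) : R[i] :=
  \sum_(v <- b) dir_deriv v (dir_deriv v f) t
  + \sum_(alpha <- Rp) (k alpha * coth (dot alpha t / 2))%:C * dir_deriv alpha f t.

(* Only the values of P on [a] matter.  L_k has its singularities on the root
   hyperplanes, so that the eigenvalue equation is required off them; by
   continuity this determines P. *)
Definition is_jacobi a Rp k (lam : vec) (P : vec -> R[i]) : Prop :=
  (exists c : vec -> R[i], forall t, a t ->
     P t = (orbit_sum Rp lam t)%:C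
           + \sum_(mu \in dominant_weight a Rp `&` [set mu | weight_lt Rp mu lam])
               c mu * (orbit_sum Rp mu t)%:C)
  /\
  (exists2 b, orthonormal_basis a b &
     forall t, a t -> (forall alpha, alpha \in Rp -> dot alpha t != 0) ->
       jacobi_operator b Rp k P t = (dot lam (lam + 2 *: rho Rp k))%:C * P t).

Definition basis_vec (i : 'I_n) : vec := delta_mx 0 i.

Definition bc_positive_roots : seq vec :=
  [seq basis_vec i | i <- enum 'I_n]
  ++ [seq 2 *: basis_vec i | i <- enum 'I_n]
  ++ [seq basis_vec ij.1 + basis_vec ij.2
        | ij <- enum [pred ij : 'I_n * 'I_n | (ij.1 < ij.2)%N]]
  ++ [seq basis_vec ij.1 - basis_vec ij.2
        | ij <- enum [pred ij : 'I_n * 'I_n | (ij.1 < ij.2)%N]].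

Definition bc_multiplicity (k1 k2 k3 : R) (alpha : vec) : R :=
  if [exists i, (alpha == basis_vec i) || (alpha == - basis_vec i)] then k1
  else if [exists i, (alpha == 2 *: basis_vec i) || (alpha == - (2 *: basis_vec i))]
  then k2 else k3.

Definition is_jacobi_BC (k1 k2 k3 : R) (lam : vec) (P : vec -> R[i]) : Prop :=
  is_jacobi [set: vec] bc_positive_roots (bc_multiplicity k1 k2 k3) lam P.

Definition a_positive_roots : seq vec :=
  [seq basis_vec ij.1 - basis_vec ij.2
     | ij <- enum [pred ij : 'I_n * 'I_n | (ij.1 < ij.2)%N]].

Definition sum_zero_space : set vec := [set t | \sum_(i < n) t 0 i = 0].

Definition omega : vec := const_mx 1.

Definition pi_proj (t : vec) : vec := t - (n%:R^-1 * dot t omega) *: omega.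

Definition is_jacobi_A (kappa : R) (lam : vec) (P : vec -> R[i]) : Prop :=
  is_jacobi sum_zero_space a_positive_roots (fun=> kappa) lam P.

Definition weight_vec (lam : 'I_n -> nat) : vec := \row_i (lam i)%:R.

End Jacobi.

Section Limit.
Context {R : realType}.

(* The value at k1 = k2 = 0 is irrelevant to [mult_limit] below. *)
Definition mult_ratio (k1 k2 : R) : \bar R :=
  if k2 == 0 then +oo%E else (k1 / k2)%:E.

(* The filter "k1 + k2 -> oo and k1 / k2 -> a" on the set k1, k2 >= 0. *)
Definition mult_limit (a : \bar R) : set_system (R * R) :=
  [set A | exists M : R, exists2 V : set (\bar R), nbhs a V &
     forall k1 k2 : R, 0 <= k1 -> 0 <= k2 -> M < k1 + k2 ->
       V (mult_ratio k1 k2) -> A (k1, k2)].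

Global Instance mult_limit_filter (a : \bar R) : Filter (mult_limit a).
Proof.
split.
- by exists 0; exists setT => //; exact: filterT.
- move=> A B [M [V aV AV]] [N [W aW BW]].
  exists (Num.max M N), (V `&` W); first exact: filterI.
  move=> k1 k2 k1_ge0 k2_ge0; rewrite gt_max => /andP[Mk Nk] [Vk Wk].
  by split; [exact: AV | exact: BW].
- move=> A B AB [M [V aV AV]]; exists M; exists V => // k1 k2 ? ? ? ?.
  by apply: AB; exact: AV.
Qed.

Lemma mult_limit_proper (a : \bar R) : (0%E <= a)%E -> ProperFilter (mult_limit a).
Proof.
move=> a_ge0; apply: Build_ProperFilter_ex => A [M [V aV AV]].
have M1 : M < `|M| + 1 by rewrite ltr_pwDr// ler_norm.
have N0 : 0 < `|M| + 1 by rewrite ltr_wpDl.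
case: a a_ge0 aV => [r| |] //.
- rewrite lee_fin => r_ge0 rV; exists (r * (`|M| + 1), `|M| + 1); apply: (AV _ _ _ (ltW N0)).
  + by rewrite mulr_ge0// ltW.
  + by rewrite (lt_le_trans M1)// lerDr mulr_ge0// ltW.
  + rewrite /mult_ratio gt_eqF// mulfK ?gt_eqF//; exact: nbhs_singleton.
- move=> _ oV; exists (`|M| + 1, 0); apply: AV => //.
  + by rewrite addr0.
  + rewrite /mult_ratio eqxx; exact: nbhs_singleton.
Qed.

Definition gamma_lim (a : \bar R) : R :=
  if a is r%:E then (r + 1) / (r + 2) else 1.

Definition locally_uniform_cvg {n : nat} {K : Type} (F : set_system K)
    (f : K -> 'rV[R]_n -> R[i]^o) (g : 'rV[R]_n -> R[i]^o) : Prop :=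
  forall t0 : 'rV[R]_n, exists2 U, nbhs t0 U & {uniform U, f @ F --> g}.

Definition jack_value {n} (p : mpoly_over (R[i]) n) (x : 'I_n -> R) : R[i] :=
  evaluate p (fun i => (x i)%:C).

End Limit.

(* Main.v *)
(* In the coordinates x_i = g + sinh^2 (t_i / 2), with K = k1 + 2 k2 and
   g = (k1 + k2) / K, the operator L_k becomes K times the Euler operator plus an
   operator that no longer involves K and whose homogeneous part of degree 0 is
   D_k3 plus the Euler operator.  Hence the part of degree |lam| of P_lam in x is,
   for every k, an eigenfunction of D_k3, that is 4^|lam| times the Jack
   polynomial, while the coefficients c_m of the monomials of lower degree satisfy
   K (|m| - |lam|) c_m = (a linear expression in c bounded independently of K),
   so that they are O(1 / K).  As g tends to gamma_a, only the Jack polynomial in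
   x(t) survives.  In type A, the substitution x = e^t turns L_k into D_k3 plus a
   constant on homogeneous polynomials of given degree, so a Jacobi polynomial is
   again a Jack polynomial.

   Only one uniqueness statement is needed: along x_i = S^(- B^(n-i)), S -> 0, the
   leading monomial x^mu of an eigenfunction of D_k3 dominates, so the eigenvalue is
   d_mu, and d_mu < d_lam when mu is strictly below lam in the dominance order.

   All functions are split into real and imaginary parts; u = 1 or u = 0 is the
   coefficient of the leading orbit sum. *)
Require Import Defs.
From HB Require Import structures.
From mathcomp Require Import all_boot all_order all_algebra all_fingroup.
From mathcomp Require mpoly.
From mathcomp Require Import ring lra zify.

Set Implicit Arguments.
Unset Strict Implicit.
Unset Printing Implicit Defensive.

(** * Exponents and the coefficient families of Jack polynomials *)

Module Exponents.
Import GRing.Theory.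
Local Open Scope ring_scope.

(** The centre g moves with k because only at g = (k1 + k2) / K is the unbounded part of L_k an
    exact multiple of the Euler operator: with gamma_a in its place, terms K (g - gamma_a) d/dx_i,
    possibly unbounded, would remain. So a enters only at the end, by continuity in g, and a = oo
    follows the same route.

    A Jack polynomial, the top part of a type BC polynomial and a type A polynomial are given in
    different forms. Each is replaced by its family of coefficients, indexed by exponents with
    entries at most |lam|, and they are compared through the common property [triangular];
    differences reduce uniqueness to leading coefficient 0.

    Every equation is imposed only at points with distinct coordinates greater than 1. There no
    denominator vanishes; since g <= 1, each such point is x(t) for a regular t; and this set is
    stable under x -> x / S with 0 < S < 1, as the limits require. The bound on the lower
    coefficients uses finitely many such points fixed in advance, so its constant depends neither on
    k1, k2 nor on g. *)

Definition multi (n D : nat) := {ffun 'I_n -> 'I_D.+1}.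

Definition swap n D (a b : 'I_n) (m : multi n D) : multi n D :=
  [ffun i => m (tperm a b i)].

Definition mono (F : fieldType) n (x : 'I_n -> F) (m : 'I_n -> nat) : F :=
  \prod_(i < n) x i ^+ m i.

(* [x^m] times the sum over [i] of these factors is [D_kappa x^m]. *)
Definition jack_factor (F : fieldType) n (kappa : F) (m : 'I_n -> nat)
    (x : 'I_n -> F) (i : 'I_n) : F :=
  (m i)%:R * ((m i)%:R - 1)
  + 2%:R * kappa * ((m i)%:R * \sum_(j < n | j != i) x i / (x i - x j)).

Definition jack_symbol (F : fieldType) n (kappa : F) (lam m : 'I_n -> nat)
    (x : 'I_n -> F) : F :=
  \sum_(i < n) jack_factor kappa m x i - jack_eigenvalue kappa lam.

(** Symmetry is recorded for transpositions only, which suffices to sort an exponent; dominance is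
    asked of partitions only, since symmetry determines the other coefficients. The conditions pass
    to differences, with [u] subtracted. *)
Definition triangular (V : zmodType) n (lam : 'I_n -> nat) (u : V)
    (r : multi n (weight lam) -> V) : Prop :=
  [/\ forall m : multi n _, r m != 0 -> weight (fun i => m i : nat) = weight lam,
      forall a b (m : multi n _), r (swap a b m) = r m,
      forall m : multi n _, r m != 0 -> partition_of_length (fun i => m i : nat) ->
        dominance_le (fun i => m i : nat) lam
    & forall m : multi n _, (forall i, (m i : nat) = lam i) -> r m = u].

Lemma le_weight n (lam : 'I_n -> nat) i : (lam i <= weight lam)%N.
Proof. by rewrite /weight (bigD1 i) //= leq_addr. Qed.

Lemma le_of_weight n (m : 'I_n -> nat) D : weight m = D -> forall i, (m i < D.+1)%N.
Proof. by move=> <- i; rewrite ltnS le_weight. Qed.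

(** A nonincreasing sequence is the sorted list of its values, so each permutation orbit contains at
    most one partition. *)
Lemma perm_partition_eq n (mu nu : 'I_n -> nat) (s : 'S_n) :
  partition_of_length mu -> partition_of_length nu ->
  (forall i, nu i = mu (s i)) -> nu =1 mu.
Proof.
move=> pmu pnu nuE.
have sortedE (f : 'I_n -> nat) : partition_of_length f -> sorted geq (codom f).
  move=> pf; apply: (@path.homo_sorted_in _ _ predT f (fun i j : 'I_n => (i <= j)%N) geq) => //.
  - by move=> i j _ _; exact: pf.
  - by apply/allP.
  - by rewrite -[sorted _ _](@sorted_map _ _ (val : 'I_n -> nat) leq) val_enum_ord iota_sorted.
have P : perm_eq (codom nu) (codom mu).
  have -> : codom nu = map mu (map s (enum 'I_n)).
    by rewrite -map_comp; apply: eq_map => i /=; rewrite nuE.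
  apply: perm_map; apply: uniq_perm; rewrite ?enum_uniq // ?(map_inj_uniq perm_inj) ?enum_uniq //.
  move=> i; rewrite mem_enum; apply/mapP; exists (s^-1 i)%g; rewrite ?mem_enum //.
  by rewrite permKV.
have E : codom nu = codom mu.
  apply: (sorted_eq (leT := geq)) => //; last 2 first; try exact: sortedE.
  - by move=> a b c /= H1 H2; exact: leq_trans H2 H1.
  - by move=> a b /=; rewrite andbC; exact: anti_leq.
move=> i; have /eq_in_map H : map nu (enum 'I_n) = map mu (enum 'I_n) by [].
by apply: H; rewrite mem_enum.
Qed.

Section JackCoef.
Import mpoly.
Variables (F : fieldType) (n : nat).

Definition multinom_of D (m : multi n D) : 'X_{1..n} := [multinom m i : nat | i < n].

Lemma multinom_of_inj D : injective (@multinom_of D).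
Proof.
move=> m1 m2 /mnmP E; apply/ffunP => i; apply/val_inj.
by have := E i; rewrite !mnmE.
Qed.

Lemma monomial_symmetric_coef (mu : 'I_n -> nat) (m : 'X_{1..n}) :
  (monomial_symmetric F mu)@_m
  = [exists s : 'S_n, m == [multinom mu (s i) | i < n]]%:R.
Proof.
rewrite /monomial_symmetric raddf_sum /=.
under eq_bigr do rewrite mcoeffX.
case: existsP => [[s /eqP ms]|N].
  have mem : m \in undup (codom (fun s : 'S_n => [multinom mu (s i) | i < n])).
    by rewrite mem_undup ms codom_f.
  rewrite (bigD1_seq m) ?undup_uniq //= eqxx big1 ?addr0 // => k /negPf km.
  by rewrite km.
rewrite big_seq big1 // => k; rewrite mem_undup => /codomP[s ks].
case: eqP => // km; case: N; exists s.
by rewrite -km ks.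
Qed.

Lemma mpoly_dhomogE D (p : {mpoly F[n]}) : p \is D.-homog ->
  p = \sum_(m : multi n D) p@_(multinom_of m) *: 'X_[multinom_of m].
Proof.
move=> hp; apply/mpolyP => k; rewrite raddf_sum /=.
under eq_bigr do rewrite mcoeffZ mcoeffX.
have [/eqP kD|kD] := boolP (mdeg k == D).
  have kb i : (k i < D.+1)%N.
    by rewrite ltnS -kD mdegE (bigD1 i) //= leq_addr.
  pose m : multi n D := [ffun i => Ordinal (kb i)].
  have mE : multinom_of m = k by apply/mnmP => i; rewrite mnmE ffunE.
  rewrite (bigD1 m) //= mE eqxx mulr1 big1 ?addr0 // => m' /negPf m'm.
  by rewrite -mE (inj_eq (@multinom_of_inj D)) m'm mulr0.
rewrite (dhomog_nemf_coeff hp kD) big1 // => m _.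
case: eqP => [E|]; last by rewrite mulr0.
by rewrite E (dhomog_nemf_coeff hp kD) mul0r.
Qed.

Lemma meval_multinom D (m : multi n D) (z : 'I_n -> F) :
  'X_[multinom_of m].@[z] = mono z (fun i => m i : nat).
Proof. by rewrite mevalX; apply: eq_bigr => i _; rewrite mnmE. Qed.

(** The operator z_i d/dz_i is diagonal on monomials. The factor z_i also repairs the truncated
    exponent k_i - 1, except at k_i = 0, where the scalar vanishes. *)
Lemma mul_mderivX (k : 'X_{1..n}) (z : 'I_n -> F) i :
  z i * ('X_[k]^`M(i)).@[z] = (k i)%:R * 'X_[k].@[z].
Proof.
rewrite mderivX mevalZ mulrCA; case: (posnP (k i)) => [->|ki]; first by rewrite !mul0r.
congr (_ * _); rewrite !mevalX [LHS]mulrC (bigD1 i) //= [RHS](bigD1 i) //=.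
rewrite !mnmE eqxx mulrAC -exprSr subn1 prednK //; congr (_ * _).
by apply: eq_bigr => j ji; rewrite !mnmE eq_sym (negPf ji) subn0.
Qed.

Lemma mul_mderivX2 (k : 'X_{1..n}) (z : 'I_n -> F) i :
  z i ^+ 2 * ('X_[k]^`M(i)^`M(i)).@[z] = (k i)%:R * ((k i)%:R - 1) * 'X_[k].@[z].
Proof.
have E1 := mul_mderivX k z i.
have E2 := mul_mderivX (k - U_(i))%MM z i.
rewrite mderivX mderivZ mevalZ; rewrite mderivX mevalZ in E1.
transitivity (z i * (k i)%:R * (z i * ('X_[k - U_(i)]^`M(i)).@[z])); first by ring.
rewrite E2 mnmBE mnm1E eqxx.
case: (posnP (k i)) => [->|ki]; first by rewrite !(mul0r, mulr0).
transitivity ((k i - 1)%:R * (z i * ((k i)%:R * 'X_[k - U_(i)].@[z]))); first by ring.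
by rewrite E1 natrB //; ring.
Qed.

(** Writing z_i^2 / (z_i - z_j) d/dz_i as z_i / (z_i - z_j) times z_i d/dz_i leaves every monomial
    in place, multiplied by a function of z that is homogeneous of degree 0. *)
Lemma jack_operator_sum D (kappa : F) (r : multi n D -> F) (z : 'I_n -> F) :
  jack_operator kappa (\sum_m r m *: 'X_[multinom_of m]) z
  = \sum_m r m * (mono z (fun i => m i : nat)
                  * \sum_i jack_factor kappa (fun i => m i : nat) z i).
Proof.
have jackD p q : jack_operator kappa (p + q) z = jack_operator kappa p z + jack_operator kappa q z.
  rewrite /jack_operator.
  under eq_bigr do rewrite !mderivD mevalD mulrDr.
  under [X in _ + _ * X]eq_bigr => i _.
    under eq_bigr do rewrite mderivD mevalD mulrDr.
    rewrite big_split /=; over.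
  rewrite !big_split /= mulrDr; ring.
have jack0 : jack_operator kappa 0 z = 0.
  rewrite /jack_operator.
  under eq_bigr do rewrite !mderiv0 meval0 mulr0.
  under [X in _ + _ * X]eq_bigr => i _.
    under eq_bigr do rewrite mderiv0 meval0 mulr0.
    rewrite big1 //; over.
  by rewrite !big1 // mulr0 addr0.
rewrite (big_morph (fun p => jack_operator kappa p z) jackD jack0).
apply: eq_bigr => m _; rewrite /jack_operator.
rewrite mulr_sumr mulr_sumr -big_split mulr_sumr /=; apply: eq_bigr => i _.
rewrite !mderivZ !mevalZ mulrCA mul_mderivX2 meval_multinom mnmE.
under eq_bigr => j _.
  have -> : z i ^+ 2 / (z i - z j) * (r m * 'X_[multinom_of m]^`M(i).@[z])
     = (z i / (z i - z j)) * (r m * (m i)%:R * mono z (fun i => m i : nat)).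
    rewrite -[_ * (m i)%:R * _]mulrA.
    have := mul_mderivX (multinom_of m) z i; rewrite meval_multinom mnmE => <-.
    by ring.
  over.
rewrite -mulr_suml /jack_factor; ring.
Qed.

(** The only contact with multivariate polynomials: from here on a Jack polynomial is a family of
    coefficients. A partition in the support lies in the orbit of [lam] or of some [mu] strictly
    below it, hence equals it. *)
Lemma jack_expansion (kappa : F) (lam : 'I_n -> nat) (p : mpoly_over F n) :
  partition_of_length lam -> is_jack kappa lam p ->
  exists2 r : multi n (weight lam) -> F, triangular 1 r &
    (forall z, evaluate p z = \sum_m r m * mono z (fun i => m i : nat)) /\
    (forall z : 'I_n -> F, injective z ->
       \sum_m r m * (mono z (fun i => m i : nat)
                     * jack_symbol kappa lam (fun i => m i : nat) z) = 0).
Proof.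
move=> plam [psym phom [c pE] peig].
pose r (m : multi n (weight lam)) := p@_(multinom_of m).
have rE : p = \sum_m r m *: 'X_[multinom_of m] := mpoly_dhomogE phom.
have evE z : evaluate p z = \sum_m r m * mono z (fun i => m i : nat).
  rewrite /evaluate {1}rE raddf_sum; apply: eq_bigr => m _.
  rewrite -meval_multinom; exact: mevalZ.
exists r; last first.
  split=> // z zinj; have := peig z zinj; rewrite {1}rE jack_operator_sum.
  rewrite -[p.@[z]]/(evaluate p z) evE mulr_sumr => /eqP; rewrite -subr_eq0 -sumrB => /eqP E.
  rewrite -[RHS]E; apply: eq_bigr => m _; rewrite /jack_symbol; ring.
have coefE (m : multi n (weight lam)) : r m = [exists s : 'S_n, multinom_of m == [multinom lam (s i) | i < n]]%:R
   + \sum_(mu : bounded_parts lam | strictly_below mu)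
      c mu * [exists s : 'S_n, multinom_of m == [multinom (mu (s i) : nat) | i < n]]%:R.
  rewrite /r pE mcoeffD monomial_symmetric_coef raddf_sum; congr (_ + _).
  apply: eq_bigr => mu _; rewrite -(monomial_symmetric_coef (fun i => mu i : nat)).
  exact: mcoeffZ.
have dlam : dominance_le lam lam.
  by rewrite /dominance_le eqxx; apply/forallP => ?.
have orb (mu : 'I_n -> nat) (m : multi n (weight lam)) :
   partition_of_length mu -> partition_of_length (fun i => m i : nat) ->
   [exists s : 'S_n, multinom_of m == [multinom mu (s i) | i < n]] ->
   (fun i => m i : nat) =1 mu.
  move=> pmu pm /existsP[s /eqP/mnmP E]; apply: (perm_partition_eq (s := s)) => // i.
  by have := E i; rewrite !mnmE.
split.
- move=> m rm; have [/eqP e|ne] := boolP (mdeg (multinom_of m) == weight lam).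
    transitivity (mdeg (multinom_of m)) => //.
    by rewrite mdegE; apply: eq_bigr => i _; rewrite mnmE.
  by move: rm; rewrite /r (dhomog_nemf_coeff phom ne) eqxx.
- move=> a b m; rewrite /r -(msym_coeff (multinom_of m) (tperm a b) psym).
  by congr (_@__); apply/mnmP => i; rewrite !mnmE ffunE.
- move=> m rm pm; move: rm; rewrite coefE.
  case: existsP => [/existsP/orb E _|_].
    rewrite (_ : dominance_le _ lam = dominance_le lam lam) //.
    have {}E := E plam pm.
    rewrite /dominance_le; congr (_ && _).
      by congr (_ == _); apply: eq_bigr.
    by apply: eq_forallb => k; congr (_ <= _)%N; apply: eq_bigr.
  rewrite add0r => /eqP H; apply: contra_notT H => N.
  rewrite big1 // => mu /and3P[/forallP pmu dmu _].
  have {}pmu : partition_of_length (fun i => mu i : nat).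
    by move=> i j ij; have /forallP/(_ j)/implyP := pmu i; apply.
  case: existsP => [/existsP/(orb _ _ pmu pm) E|_]; last by rewrite mulr0.
  case/negP: N; rewrite (_ : dominance_le _ lam = dominance_le (fun i => mu i : nat) lam) //.
  rewrite /dominance_le; congr (_ && _).
    by congr (_ == _); apply: eq_bigr.
  by apply: eq_forallb => k; congr (_ <= _)%N; apply: eq_bigr.
- move=> m mE; rewrite coefE.
  have pm : partition_of_length (fun i => m i : nat).
    by move=> i j ij; rewrite !mE plam.
  rewrite (_ : [exists s, _] = true); last first.
    apply/existsP; exists 1%g; apply/eqP/mnmP => i.
    by rewrite !mnmE perm1 mE.
  rewrite big1 ?addr0 // => mu /and3P[/forallP pmu dmu /existsP[k /negP nk]].
  have {}pmu : partition_of_length (fun i => mu i : nat).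
    by move=> i j ij; have /forallP/(_ j)/implyP := pmu i; apply.
  case: existsP => [/existsP/(orb _ _ pmu pm) E|_]; last by rewrite mulr0.
  by case: nk; rewrite -E mE.
Qed.

End JackCoef.
End Exponents.

From mathcomp Require Import complex.
From mathcomp Require Import all_classical all_reals all_analysis.
Import Order.TTheory GRing.Theory Num.Theory.
Import numFieldNormedType.Exports.
Import Exponents.
Local Open Scope classical_set_scope.
Local Open Scope ring_scope.

(** * Uniqueness of Jack polynomials *)

(** The number with base-B digits m_0, ..., m_(n-1), the first being the most significant. It is the
    exponent of 1 / S in x^m at x_i = S^(- B^(n-i-1)). *)
Definition kronecker n B (m : 'I_n -> nat) : nat := (\sum_(i < n) m i * B ^ (n - i.+1))%N.

Lemma kronecker_inj n B (m1 m2 : 'I_n -> nat) :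
  (forall i, m1 i < B)%N -> (forall i, m2 i < B)%N ->
  kronecker B m1 = kronecker B m2 -> m1 =1 m2.
Proof.
elim: n m1 m2 => [|n IH] m1 m2 h1 h2 E; first by case.
have kr (m : 'I_n.+1 -> nat) : kronecker B m =
    (kronecker B (fun i : 'I_n => m (widen_ord (leqnSn n) i)) * B + m ord_max)%N.
  rewrite /kronecker big_ord_recr /= subnn muln1 big_distrl /=; congr (_ + _)%N.
  by apply: eq_bigr => i _; rewrite -mulnA -expnSr subSn //; case: i => i /= /ltP; lia.
have B0 : (0 < B)%N by apply: leq_ltn_trans (h1 ord_max).
move: E; rewrite !kr => E.
have El : m1 ord_max = m2 ord_max.
  by have := congr1 (modn^~ B) E; rewrite !modnMDl !modn_small.
move: E; rewrite El => /addIn /eqP; rewrite eqn_pmul2r // => /eqP/IH H i.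
case: (unliftP ord_max i) => [j|] -> //.
have -> : lift ord_max j = widen_ord (leqnSn n) j by apply/val_inj; exact: lift_max.
by apply: H => k.
Qed.

(** Moving the larger digit to the more significant place increases the number. Hence a maximizer of
    [kronecker] over a set stable under permutations is a partition. *)
Lemma kronecker_swap n B (m : 'I_n -> nat) (a b : 'I_n) : (1 < B)%N ->
  (a < b)%N -> (m a < m b)%N ->
  (kronecker B m < kronecker B (fun i => m (tperm a b i)))%N.
Proof.
move=> B1 ab mab; rewrite /kronecker.
have ba : b != a by apply/eqP => E; rewrite E ltnn in ab.
rewrite (bigD1 a) //= (bigD1 b) //= [X in (_ < X)%N](bigD1 a) //= [X in (_ < _ + X)%N](bigD1 b) //=.
rewrite tpermL tpermR.
rewrite [X in (_ < _ + (_ + X))%N](eq_bigr (fun i => m i * B ^ (n - i.+1))%N); last first.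
  by move=> i /andP[ia ib]; rewrite tpermD // eq_sym.
have : (B ^ (n - b.+1) < B ^ (n - a.+1))%N.
  by rewrite ltn_exp2l //; case: b {ba mab} ab => b /= Hb; lia.
nia.
Qed.

Lemma sum_ltn_ord n (i : 'I_n) : (\sum_(j < n) (i < j) = n - i.+1)%N.
Proof.
rewrite -big_mkcond /= sum1_card.
transitivity (#|(fun j : 'I_n => (i < j)%N)|); first exact: eq_card.
have := cardC (fun j : 'I_n => (i < j)%N); rewrite card_ord.
have -> : #|[predC (fun j : 'I_n => (i < j)%N)]| = i.+1.
  transitivity #|[pred j : 'I_n | (j < i.+1)%N]|.
    by apply: eq_card => j; rewrite !inE -leqNgt.
  transitivity (\sum_(j < n | (j < i.+1)%N) 1)%N; first by rewrite -sum1_card.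
  by rewrite -(big_ord_widen n (fun=> 1%N)) // sum1_card card_ord.
by move=> /(congr1 (subn^~ i.+1)); rewrite /= addnK.
Qed.

Section Dominance.
Variable R : realType.

Lemma decreasing_initial n (p : pred 'I_n) :
  (forall i j : 'I_n, (i <= j)%N -> p j -> p i) ->
  exists r : 'I_n.+1, p =1 (fun i : 'I_n => (i < r)%N).
Proof.
move=> down.
have ex : exists r, (r <= n)%N && [forall i : 'I_n, (r <= i)%N ==> ~~ p i].
  by exists n; rewrite leqnn; apply/forallP => i; rewrite leqNgt ltn_ord.
case: (ex_minnP ex) => r /andP[rn /forallP hr] rmin.
have rn' : (r < n.+1)%N by rewrite ltnS.
exists (Ordinal rn') => i /=; case: ltnP => [ir|ri]; last first.
  by apply/negbTE; have /implyP := hr i; apply.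
apply: contraTT ir => npi; rewrite -leqNgt; apply: rmin.
rewrite ltnW ?ltn_ord //=; apply/forallP => j; apply/implyP => ij.
by apply: contra npi; exact: down.
Qed.

(** Abel summation in layers: w_i counts the l with l < w_i, and for a partition each layer is an
    initial segment of the indices, over which d has a nonnegative sum. *)
Lemma abel_ge0 n (w : 'I_n -> nat) (d : 'I_n -> R) : partition_of_length w ->
  (forall r : 'I_n.+1, 0 <= \sum_(i < n | (i < r)%N) d i) ->
  0 <= \sum_(i < n) (w i)%:R * d i.
Proof.
move=> pw dr.
have layer i : (w i)%:R * d i = \sum_(l < (weight w).+1) (if (l < w i)%N then d i else 0).
  rewrite -big_mkcond /= -(big_ord_widen _ (fun=> d i)) ?leqW ?le_weight //=.
  by rewrite sumr_const card_ord mulr_natl.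
under eq_bigr do rewrite layer.
rewrite exchange_big sumr_ge0 //= => l _; rewrite -big_mkcond /=.
have [r rE] : exists r : 'I_n.+1, (fun i : 'I_n => (l < w i)%N) =1 (fun i => (i < r)%N).
  by apply: decreasing_initial => i j ij; move=> /leq_trans; apply; exact: pw.
by rewrite (eq_bigl _ _ rE).
Qed.

(** With d = lam - m, the difference of the eigenvalues is sum d_i^2 + 2 sum m_i d_i - sum d_i + 2
    kappa sum (n-i-1) d_i. Here sum d_i = 0, the weights m_i and n-i-1 are nonincreasing, so Abel
    summation applies to both sums, and the squares give strictness. *)
Lemma jack_eigenvalue_lt n (kappa : R) (m lam : 'I_n -> nat) : 0 <= kappa ->
  partition_of_length m -> dominance_le m lam -> (exists i, m i != lam i) ->
  jack_eigenvalue kappa m < jack_eigenvalue kappa lam.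
Proof.
move=> k0 pm /andP[/eqP wE /forallP dom] [i0 ni0].
pose d i : R := (lam i)%:R - (m i)%:R.
have dr (r : 'I_n.+1) : 0 <= \sum_(i < n | (i < r)%N) d i.
  by rewrite sumrB subr_ge0 -!natr_sum ler_nat.
have d0 : \sum_i d i = 0.
  by rewrite sumrB -!natr_sum; rewrite /weight in wE; rewrite wE subrr.
have A1 := abel_ge0 pm dr.
have A2 : 0 <= \sum_(i < n) ((n - i.+1)%N%:R) * d i.
  by apply: abel_ge0 dr => i j ij; apply: leq_sub2l.
rewrite -subr_gt0 /jack_eigenvalue -sumrB.
have -> : \sum_(i < n) ((lam i)%:R * ((lam i)%:R - 1 + 2 * kappa * (n - i.+1)%:R)
    - (m i)%:R * ((m i)%:R - 1 + 2 * kappa * (n - i.+1)%:R))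
  = \sum_i d i ^+ 2 + 2 * (\sum_i (m i)%:R * d i) - \sum_i d i
    + 2 * kappa * \sum_(i < n) ((n - i.+1)%N%:R) * d i.
  rewrite !mulr_sumr -big_split -sumrB -big_split /=; apply: eq_bigr => i _; rewrite /d; ring.
rewrite d0 subr0 -addrA ltr_wpDr //.
  by rewrite addr_ge0 // mulr_ge0 // mulr_ge0.
rewrite lt_neqAle sumr_ge0 => [|i _]; last exact: sqr_ge0.
rewrite andbT eq_sym psumr_neq0 => [|i _]; last exact: sqr_ge0.
apply/hasP; exists i0; rewrite ?mem_index_enum //= exprn_even_gt0 //=.
by rewrite /d subr_eq0 eqr_nat eq_sym.
Qed.

End Dominance.

Section Uniqueness.
Variable R : realType.

Lemma cvg_bigsum (T : Type) (F : set_system T) {FF : Filter F} (I : Type) (s : seq I)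
    (P : pred I) (f : I -> T -> R) (l : I -> R) :
  (forall i, P i -> f i x @[x --> F] --> l i) ->
  \sum_(i <- s | P i) f i x @[x --> F] --> \sum_(i <- s | P i) l i.
Proof.
move=> h; elim: s => [|i s IH].
  under eq_fun do rewrite big_nil; rewrite big_nil; exact: cvg_cst.
under eq_fun do rewrite big_cons; rewrite big_cons.
by case: ifP => // Pi; apply: cvgD => //; exact: h.
Qed.

Lemma cvg0_eq0 (f : R -> R) (l : R) : (forall S, 0 < S -> S < 1 -> f S = 0) ->
  f S @[S --> (0 : R)] --> l -> l = 0.
Proof.
move=> f0 /cvg_at_right_filter fl.
have f0' : f S @[S --> (0 : R)^'+] --> (0 : R).
  apply: (@cvg_trans _ ((fun=> 0 : R) @ (0 : R)^'+)); last exact: cvg_cst.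
  apply: near_eq_cvg; near=> S.
  have S0 : 0 < S by near: S; exact: nbhs_right_gt.
  have S1 : S < 1 by near: S; exact: nbhs_right_lt.
  by rewrite f0.
exact: (cvg_unique _ fl f0').
Unshelve. all: by end_near. Qed.

Lemma cvg_exp0 (k : nat) : S ^+ k @[S --> (0 : R)] --> ((k == 0%N)%:R : R).
Proof.
have -> : (k == 0%N)%:R = (0 : R) ^+ k :> R by rewrite expr0n.
exact: exprn_continuous.
Qed.

Lemma triangular_eq0 n (kappa : R) (lam : 'I_n -> nat) (r : multi n (weight lam) -> R) :
  0 <= kappa -> triangular 0 r ->
  (forall x : 'I_n -> R, (forall i, 1 < x i) -> injective x ->
     \sum_m r m * (mono x (fun i => m i : nat)
                   * jack_symbol kappa lam (fun i => m i : nat) x) = 0) ->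
  forall m, r m = 0.
Proof.
move=> k0 [rw rswap rdom rlam] req m0; apply/eqP; apply: contraT => rm0.
(* One more than is needed to bound the digits, so that B > 1 even when [lam] has weight 0. *)
pose B := (weight lam).+2.
pose phi (m : multi n (weight lam)) := kronecker B (fun i => m i : nat).
case: (@arg_maxnP _ m0 (fun m => r m != 0) phi) => // mu rmu maxmu0.
have maxmu m : r m != 0 -> (phi m <= phi mu)%N by exact: maxmu0.
have phi_inj : injective phi.
  move=> m1 m2 E; apply/ffunP => i; apply/val_inj; apply: (kronecker_inj _ _ E) => j /=;
  by rewrite ltnS ltnW.
have pmu : partition_of_length (fun i => mu i : nat).
  move=> a b; rewrite leq_eqVlt => /predU1P[/val_inj -> //|ab]; rewrite leqNgt; apply/negP => lt.
  have := maxmu (swap a b mu); rewrite rswap => /(_ rmu).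
  rewrite leqNgt => /negP; apply.
  have -> : phi (swap a b mu) = kronecker B (fun i => mu (tperm a b i) : nat).
    by apply: eq_bigr => i _; rewrite ffunE.
  by apply: (kronecker_swap (m := fun i => mu i : nat)).
have nmu : exists i, (mu i : nat) != lam i.
  apply/existsP; apply: contraT; rewrite negb_exists => /forallP H.
  by case/eqP: rmu; apply: rlam => i; apply/eqP; have := H i; rewrite negbK.
have dlt := jack_eigenvalue_lt k0 pmu (rdom _ rmu pmu) nmu.
pose w (i : 'I_n) := (B ^ (n - i.+1))%N.
have w_lt (i j : 'I_n) : (i < j)%N -> (w j < w i)%N.
  by move=> ij; rewrite ltn_exp2l //; case: j ij => j /= Hj; lia.
have w_gt0 i : (0 < w i)%N by rewrite expn_gt0.
(* The closed form of x_i / (x_i - x_j) at x_i = S^(- w_i), free of negative powers. One of the two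
   truncated differences is 0, so their sum is |w_i - w_j|; the limit at S = 0 is 1 for i < j and 0
   for i > j. *)
pose q (i j : 'I_n) (S : R) := (if (i < j)%N then 1 else - S ^+ (w j - w i))
   / (1 - S ^+ ((w j - w i) + (w i - w j))).
pose fac (m : multi n (weight lam)) S i := (m i)%:R * ((m i)%:R - 1)
  + 2%:R * kappa * ((m i)%:R * \sum_(j < n | j != i) q i j S).
(* The equation multiplied by S^(phi mu). The truncated subtraction is harmless, as phi m <= phi mu
   on the support of [r]; in the limit [l] only m = mu remains, because [phi] is injective. *)
pose f S := \sum_m r m * (S ^+ (phi mu - phi m) * (\sum_i fac m S i - jack_eigenvalue kappa lam)).
pose l := \sum_m r m * ((phi mu - phi m == 0)%N%:R * (\sum_i ((m i)%:R * ((m i)%:R - 1)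
  + 2%:R * kappa * ((m i)%:R * \sum_(j < n | j != i) (i < j)%N%:R)) - jack_eigenvalue kappa lam)).
have wd (i j : 'I_n) : j != i -> ((w j - w i) + (w i - w j) == 0)%N = false.
  rewrite -(inj_eq val_inj) /= neq_ltn => /orP[] /w_lt; lia.
have lE : l = r mu * (jack_eigenvalue kappa (fun i => mu i : nat) - jack_eigenvalue kappa lam).
  rewrite /l (bigD1 mu) //= subnn eqxx mul1r [X in _ + X]big1 ?addr0; last first.
    move=> m mmu; have [->|rm] := eqVneq (r m) 0; first by rewrite mul0r.
    rewrite subn_eq0 leqNgt ltn_neqAle (inj_eq phi_inj) mmu /=.
    by have := maxmu _ rm; rewrite /= => ->; rewrite mul0r mulr0.
  congr (_ * (_ - _)); apply: eq_bigr => i _; rewrite /= [RHS]mulrDr; congr (_ + _).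
  rewrite [RHS]mulrCA; congr (_ * (_ * _)); rewrite -natr_sum; congr (_%:R).
  rewrite -(sum_ltn_ord i) [RHS](bigD1 i) //= ltnn add0n //.
have q_cvg i j : j != i -> q i j S @[S --> (0 : R)] --> ((i < j)%N%:R : R).
  move=> ji; have -> : (i < j)%N%:R = (if (i < j)%N then 1 else - 0) / (1 - 0) :> R.
    by rewrite subr0 divr1 oppr0; case: ifP.
  apply: cvgM.
    case: ifP => ij; first exact: cvg_cst.
    apply: cvgN; have := @cvg_exp0 (w j - w i).
    rewrite subn_eq0 leqNgt w_lt //; rewrite ltn_neqAle leqNgt ij andbT.
    by rewrite (inj_eq val_inj).
  apply: cvgV; first by rewrite subr0 oner_eq0.
  apply: cvgB; first exact: cvg_cst.
  by have := @cvg_exp0 ((w j - w i) + (w i - w j)); rewrite wd.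
have f_cvg : f S @[S --> (0 : R)] --> l.
  apply: cvg_bigsum => m _; apply: cvgM; first exact: cvg_cst.
  apply: cvgM; first exact: cvg_exp0.
  apply: cvgB; last exact: cvg_cst.
  apply: cvg_bigsum => i _; apply: cvgD; first exact: cvg_cst.
  apply: cvgM; first exact: cvg_cst.
  apply: cvgM; first exact: cvg_cst.
  by apply: cvg_bigsum => j; exact: q_cvg.
suff /cvg0_eq0/(_ f_cvg) : forall S, 0 < S -> S < 1 -> f S = 0.
  rewrite lE => /eqP; rewrite mulf_eq0 (negPf rmu) subr_eq0 /=.
  by rewrite lt_eqF.
move=> S S0 S1.
pose x i := S ^- w i.
have x1 i : 1 < x i by rewrite invf_gt1 ?exprn_gt0 // exprn_ilt1 // -?lt0n // ltW.
have x_inj : injective x.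
  move=> i j /invr_inj /(ieexprIn S0 (negbT (lt_eqF S1))) wij.
  by apply/val_inj; case: (ssrnat.ltngtP i j) => // /w_lt; rewrite wij ltnn.
have := req x x1 x_inj => /(congr1 ( *%R (S ^+ phi mu))); rewrite mulr0 => <-.
rewrite mulr_sumr; apply: eq_bigr => m _.
have [->|rm] := eqVneq (r m) 0; first by rewrite !mul0r mulr0.
rewrite [RHS]mulrCA; congr (_ * _); rewrite [RHS]mulrA; congr (_ * (_ - _)).
  have -> : mono x (fun i => m i : nat) = S ^- phi m.
    rewrite /mono /phi /kronecker; under eq_bigr do rewrite /x exprVn -exprM mulnC.
    by rewrite prodfV; congr (_^-1); rewrite expr_sum.
  by rewrite expfB_cond // ?gt_eqF //; exact: maxmu.
have Sn k : S ^+ k != 0 by rewrite expf_neq0 // gt_eqF.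
have S1n k : (0 < k)%N -> 1 - S ^+ k != 0.
  by move=> k0'; rewrite subr_eq0 gt_eqF // exprn_ilt1 -?lt0n // ltW.
apply: eq_bigr => i _; rewrite /fac /jack_factor; congr (_ + _ * (_ * _)).
apply: eq_bigr => j ji; rewrite /q /x.
have [ij|ij|/val_inj ij] := ssrnat.ltngtP i j; last by rewrite ij eqxx in ji.
- have wij := w_lt _ _ ij.
  have -> : (w j - w i + (w i - w j) = w i - w j)%N by lia.
  have E : S ^+ w i = S ^+ (w i - w j) * S ^+ w j by rewrite -exprD subnK // ltnW.
  have D := S1n (w i - w j)%N; rewrite subn_gt0 in D; have {}D := D wij.
  rewrite E; field; rewrite !Sn /=.
  by apply/eqP => H; move/eqP: D; apply; lra.
- have wij := w_lt _ _ ij.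
  have -> : (w j - w i + (w i - w j) = w j - w i)%N by lia.
  have E : S ^+ w j = S ^+ (w j - w i) * S ^+ w i by rewrite -exprD subnK // ltnW.
  have D := S1n (w j - w i)%N; rewrite subn_gt0 in D; have {}D := D wij.
  rewrite E; field; rewrite !Sn /=.
  by apply/andP; split; apply/eqP => H; move/eqP: D; apply; lra.
Qed.
End Uniqueness.

(** * Bound on the lower coefficients *)

Section Estimate.
Variable R : realType.

(** For x = g + sinh^2(t/2) one has (x')^2 = (x - g)(x - g + 1) and x'' = x + 1/2 - g. The two
    coefficients are (x')^2 / x^2 and x'' / x, so this is the action on x^m of the part of L_k free
    of K, minus the part of the eigenvalue free of K. *)
Definition jacobi_symbol n (kappa : R) (lam : 'I_n -> nat) (g : R) (m : 'I_n -> nat)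
    (x : 'I_n -> R) : R :=
  \sum_(i < n) ((1 + (1 - 2 * g) / x i - g * (1 - g) / x i ^+ 2) * jack_factor kappa m x i
                + (m i)%:R * (1 + (2^-1 - g) / x i))
  - ((weight lam)%:R + jack_eigenvalue kappa lam).

(* Kronecker substitution: at x_i = 2 ^ (B ^ (n - i - 1) (r + 1)) the monomials take
   the values y ^ (r + 1) with distinct y, which form an invertible Vandermonde matrix. *)
Lemma interpolation n D : exists N (z : 'I_N -> 'I_n -> R) (C : R),
  [/\ forall r i, 1 < z r i, forall r, injective (z r), 0 <= C
    & forall (a : multi n D -> R) m,
        `|a m| <= C * \sum_r `|\sum_m' a m' * mono (z r) (fun i => m' i : nat)|].
Proof.
pose B := D.+2; pose N := #|{: multi n D}|.
pose w (i : 'I_n) := (B ^ (n - i.+1))%N.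
pose node (m : multi n D) : R := 2 ^+ kronecker B (fun i => m i : nat).
have node_inj : injective node.
  have two : (2 : R) != 1 by apply/eqP; lra.
  have two0 : 0 < (2 : R) by lra.
  move=> m1 m2 /(ieexprIn two0 two) E; apply/ffunP => i; apply/val_inj.
  by apply: (kronecker_inj _ _ E) => j /=; rewrite ltnS ltnW.
have node_ge1 m : 1 <= node m by apply: exprn_ege1; lra.
pose a := \row_(j < N) node (enum_val j).
pose V := Vandermonde N a.
have Vunit : V \in unitmx.
  rewrite unitmxE det_Vandermonde unitfE; apply/prodf_neq0 => i _; apply/prodf_neq0 => j ij.
  rewrite !mxE subr_eq0 (inj_eq node_inj) (inj_eq enum_val_inj).
  by apply: contraTneq ij => ->; rewrite ltnn.
exists N, (fun r i => 2 ^+ (w i * r.+1)), (\sum_i \sum_j `|invmx V i j|); split.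
- by move=> r i; rewrite exprn_egt1 ?muln_eq0 ?expn_eq0 //; lra.
- move=> r i j; have two : (2 : R) != 1 by apply/eqP; lra.
  have two0 : 0 < (2 : R) by lra.
  move=> /(ieexprIn two0 two)/eqP; rewrite eqn_pmul2r // eqn_exp2l // => /eqP E.
  by apply/val_inj; have := ltn_ord i; have := ltn_ord j; move: E => /=; lia.
- by rewrite sumr_ge0 // => i _; rewrite sumr_ge0.
move=> c m.
have monoE (r : 'I_N) (m' : multi n D) :
    mono (fun i => 2 ^+ (w i * r.+1) : R) (fun i => m' i : nat) = node m' ^+ r.+1.
  rewrite /mono /node -exprM /kronecker big_distrl /= expr_sum; apply: eq_bigr => i _.
  by rewrite -exprM; congr (_ ^+ _); rewrite /w; lia.
pose v := \col_(r < N) \sum_m' c m' * mono (fun i => 2 ^+ (w i * r.+1) : R) (fun i => m' i : nat).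
have vE : v = V *m \col_(j < N) (c (enum_val j) * node (enum_val j)).
  apply/colP => r; rewrite !mxE (reindex (@enum_val _ predT)) /=; last first.
    by apply: onW_bij; exact: enum_val_bij.
  by apply: eq_bigr => j _; rewrite monoE !mxE exprS; ring.
have cE : c m * node m = \sum_r invmx V (enum_rank m) r * v r 0.
  transitivity ((invmx V *m v) (enum_rank m) 0); last by rewrite mxE.
  by rewrite vE mulKmx // mxE enum_rankK.
apply: (@le_trans _ _ `|c m * node m|).
  by rewrite normrM ler_peMr // ger0_norm // (le_trans ler01).
rewrite cE (le_trans (ler_norm_sum _ _ _)) // mulr_sumr ler_sum // => r _.
rewrite normrM [v r 0]mxE ler_wpM2r //.
rewrite (bigD1 (enum_rank m)) //= (bigD1 r) //= -addrA lerDl addr_ge0 //.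
  by rewrite sumr_ge0.
by rewrite sumr_ge0 // => i _; rewrite sumr_ge0.
Qed.

(** What matters is uniformity in g at a fixed point: as 1 / x_i < 1 and 0 <= g <= 1, the three
    terms of the first coefficient are at most 1 in absolute value, which gives 3, and the two of
    the second give 2. *)
Lemma jacobi_symbol_bound n (kappa : R) (lam m : 'I_n -> nat) (x : 'I_n -> R) :
  (forall i, 1 < x i) ->
  exists2 C, 0 <= C & forall g, 0 <= g -> g <= 1 -> `|jacobi_symbol kappa lam g m x| <= C.
Proof.
move=> x1.
exists (\sum_(i < n) (3 * `|jack_factor kappa m x i| + (m i)%:R * 2)
        + `|(weight lam)%:R + jack_eigenvalue kappa lam|).
  by rewrite addr_ge0 // sumr_ge0 // => i _; rewrite addr_ge0 // mulr_ge0.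
move=> g g0 g1; rewrite /jacobi_symbol (le_trans (ler_normB _ _)) // lerD2r.
rewrite (le_trans (ler_norm_sum _ _ _)) // ler_sum // => i _.
have xi : 0 < (x i)^-1 < 1 by rewrite invr_gt0 invf_lt1 ?x1 ?(lt_trans ltr01) ?x1.
rewrite -exprVn; move: (x i)^-1 xi => y /andP[y0 y1].
rewrite (le_trans (ler_normD _ _)) // !normrM lerD // ?ler_wpM2r // ?normr_nat ?ler_wpM2l //.
  have h1 : -1 <= (1 - 2 * g) * y <= 1 by apply/andP; split; nra.
  have h2 : 0 <= g * (1 - g) <= 1 by apply/andP; split; nra.
  have h3 : 0 <= y ^+ 2 <= 1 by apply/andP; split; nra.
  have h4 : 0 <= g * (1 - g) * y ^+ 2 <= 1.
    by move: h2 h3 => /andP[? ?] /andP[? ?]; rewrite mulr_ge0 // mulr_ile1.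
  by move: h1 h4 => /andP[? ?] /andP[? ?]; rewrite ler_norml; apply/andP; split; lra.
rewrite ler_norml; apply/andP; split; nra.
Qed.

(** Interpolation is applied to the numbers K (D - |m|) c_m, whose generating sum at each node
    equals, by the equation, a sum bounded by the |c_m|. Let L and T be the sums of |c_m| over lower
    and top weight, and M the number of exponents. Then K L <= C2 M (L + T), and for K >= 2 C2 M the
    L on the right is absorbed. *)
Lemma lower_coef_bound n (kappa : R) (lam : 'I_n -> nat) : exists2 C : R, 0 <= C &
  forall (K g : R) (c : multi n (weight lam) -> R), 0 < K -> C <= K -> 0 <= g -> g <= 1 ->
  (forall m : multi n _, (weight lam < weight (fun i => m i : nat))%N -> c m = 0) ->
  (forall x : 'I_n -> R, (forall i, 1 < x i) -> injective x ->
     \sum_m c m * (mono x (fun i => m i : nat)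
       * (K * ((weight (fun i => m i : nat))%:R - (weight lam)%:R)
          + jacobi_symbol kappa lam g (fun i => m i : nat) x)) = 0) ->
  forall m : multi n _, (weight (fun i => m i : nat) < weight lam)%N ->
    K * `|c m| <= C * \sum_(m : multi n _ | weight (fun i => m i : nat) == weight lam) `|c m|.
Proof.
set D := weight lam; pose wt (m : multi n D) := weight (fun i => m i : nat).
have [N [z [C0 [z1 zinj C00 interp]]]] := interpolation n D.
pose bnd r (m : multi n D) := sval (cid2 (@jacobi_symbol_bound _ kappa lam (fun i => m i : nat) (z r) (z1 r))).
have bnd0 r (m : multi n D) : 0 <= bnd r m by rewrite /bnd; case: cid2.
have bndP r (m : multi n D) g : 0 <= g -> g <= 1 -> `|jacobi_symbol kappa lam g (fun i => m i : nat) (z r)| <= bnd r m.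
  by rewrite /bnd; case: cid2 => /= b _; apply.
have mono0 r (m : multi n D) : 0 <= mono (z r) (fun i => m i : nat).
  by apply: prodr_ge0 => i _; rewrite exprn_ge0 // ltW // (lt_trans ltr01).
pose C1 := \sum_r \sum_(m : multi n D) mono (z r) (fun i => m i : nat) * bnd r m.
pose M := #|{: multi n D}|.
have C10 : 0 <= C1 by apply: sumr_ge0 => r _; apply: sumr_ge0 => m _; rewrite mulr_ge0.
pose C2 := C0 * C1.
have C20 : 0 <= C2 by rewrite mulr_ge0.
(* The factor 2 serves twice: as the threshold on K it permits the absorption of L, and it is the
   factor lost by doing so. *)
exists (2 * (C2 *+ M)); first by rewrite mulr_ge0 // mulrn_wge0.
move=> K g c K0 KC g0 g1 cbig ceq.
pose L := \sum_(m | (wt m < D)%N) `|c m|.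
pose T := \sum_(m | wt m == D) `|c m|.
have ST : \sum_m `|c m| = L + T.
  rewrite (bigID (fun m => (wt m < D)%N)) /=; congr (_ + _).
  rewrite (bigID (fun m => wt m == D)) /= [X in _ + X]big1 ?addr0.
    by apply: eq_bigl => m; rewrite -leqNgt; case: ssrnat.ltngtP.
  move=> m; rewrite -leqNgt => /andP[h1 h2]; rewrite cbig ?normr0 //.
  by rewrite ltn_neqAle eq_sym h2.
have est (m : multi n D) : (wt m < D)%N -> K * `|c m| <= C2 * (L + T).
  move=> mD; have := interp (fun m => K * (D%:R - (wt m)%:R) * c m) m.
  have w1 : 1 <= D%:R - (wt m)%:R :> R by rewrite -natrB ?ler1n ?subn_gt0 // ltnW.
  move=> H; apply: le_trans (le_trans H _).
    rewrite !normrM (gtr0_norm K0) mulrAC -[leLHS]mulr1 ler_wpM2l //; first by rewrite mulr_ge0 // ltW.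
    by rewrite (le_trans w1) // ler_norm.
  rewrite /C2 -mulrA ler_wpM2l // /C1 mulr_suml ler_sum // => r _; rewrite -ST.
  have -> : \sum_m' K * (D%:R - (wt m')%:R) * c m' * mono (z r) (fun i => m' i : nat)
     = \sum_m' c m' * (mono (z r) (fun i => m' i : nat)
         * jacobi_symbol kappa lam g (fun i => m' i : nat) (z r)).
    apply/eqP; rewrite eq_sym -subr_eq0 -sumrB; apply/eqP.
    rewrite -[RHS](ceq (z r)) //; apply: eq_bigr => m' _; rewrite /wt; ring.
  rewrite (le_trans (ler_norm_sum _ _ _)) // mulr_suml ler_sum // => m' _.
  rewrite !normrM (ger0_norm (mono0 _ _)) mulrC ler_pM ?mulr_ge0 ?ler_wpM2l ?bndP //.
  by rewrite (bigD1 m') //= lerDl sumr_ge0.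
have KL : K * L <= (C2 *+ M) * (L + T).
  rewrite /L mulr_sumr -mulr_natl -mulrA mulr_natl -sumr_const.
  rewrite [leRHS](bigID (fun m => (wt m < D)%N)) /= -[leLHS]addr0 lerD ?ler_sum //.
  apply: sumr_ge0 => m _; rewrite mulr_ge0 // addr_ge0 //; exact: sumr_ge0.
move=> m mD.
have L0 : 0 <= L by exact: sumr_ge0.
have cL : `|c m| <= L by rewrite /L (bigD1 m) //= lerDl sumr_ge0.
have : K * `|c m| <= K * L by rewrite ler_pM2l.
rewrite -/T; nra.
Qed.

End Estimate.

(** * The operator L_k on monomials *)

Section Derivatives.
Variable R : realType.

Definition real_jacobi_operator n (b Rp : seq 'rV[R]_n) (k : 'rV[R]_n -> R)
    (f : 'rV[R]_n -> R) (t : 'rV[R]_n) : R :=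
  \sum_(v <- b) 'D_v (fun s => 'D_v f s) t
  + \sum_(alpha <- Rp) k alpha * coth (dot alpha t / 2) * 'D_alpha f t.

Lemma ReD (z w : R[i]) : complex.Re (z + w) = complex.Re z + complex.Re w.
Proof. by case: z w => [? ?] [? ?]. Qed.

Lemma Re_sum (I : Type) (s : seq I) (P : pred I) (F : I -> R[i]) :
  complex.Re (\sum_(i <- s | P i) F i) = \sum_(i <- s | P i) complex.Re (F i).
Proof. exact: (big_morph _ ReD). Qed.

Lemma ImD (z w : R[i]) : complex.Im (z + w) = complex.Im z + complex.Im w.
Proof. by case: z w => [? ?] [? ?]. Qed.

Lemma Im_sum (I : Type) (s : seq I) (P : pred I) (F : I -> R[i]) :
  complex.Im (\sum_(i <- s | P i) F i) = \sum_(i <- s | P i) complex.Im (F i).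
Proof. exact: (big_morph _ ImD). Qed.

Lemma Re_realM (x : R) (z : R[i]) : complex.Re (x%:C * z)%C = x * complex.Re z.
Proof. by case: z => a b /=; rewrite mul0r subr0. Qed.

Lemma Im_realM (x : R) (z : R[i]) : complex.Im (x%:C * z)%C = x * complex.Im z.
Proof. by case: z => a b /=; rewrite mul0r addr0. Qed.

Lemma Re_jacobi_operator n (b Rp : seq 'rV[R]_n) k (f : 'rV[R]_n -> R[i]) t :
  complex.Re (jacobi_operator b Rp k f t)
  = real_jacobi_operator b Rp k (fun s => complex.Re (f s)) t.
Proof.
rewrite /jacobi_operator /real_jacobi_operator.
rewrite ReD !Re_sum.
by congr (_ + _); apply: eq_bigr => v _; rewrite Re_realM.
Qed.

Lemma Im_jacobi_operator n (b Rp : seq 'rV[R]_n) k (f : 'rV[R]_n -> R[i]) t :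
  complex.Im (jacobi_operator b Rp k f t)
  = real_jacobi_operator b Rp k (fun s => complex.Im (f s)) t.
Proof.
rewrite /jacobi_operator /real_jacobi_operator.
rewrite ImD !Im_sum.
by congr (_ + _); apply: eq_bigr => v _; rewrite Im_realM.
Qed.

(** A directional derivative sees only one line. This matters in type A, where functions are
    controlled only on the hyperplane of sum zero and all derivatives are taken along it. *)
Lemma derive_line n (f g : 'rV[R]_n -> R) (v t : 'rV[R]_n) :
  (forall tau : R, f (tau *: v + t) = g (tau *: v + t)) -> 'D_v f t = 'D_v g t.
Proof.
move=> fg; have ft : f t = g t by have := fg 0; rewrite scale0r add0r.
rewrite /derive (_ : (fun h => h^-1 *: ((f \o shift t) (h *: v) - f t))
  = (fun h => h^-1 *: ((g \o shift t) (h *: v) - g t))) //.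
by apply/funext => h /=; rewrite fg ft.
Qed.

Lemma is_derive_line n (f : 'rV[R]_n -> R) (v t : 'rV[R]_n) (d : R) :
  is_derive (0 : R) 1 (fun tau : R => f (tau *: v + t)) d -> is_derive t v f d.
Proof.
case=> [df Df].
have E : (fun h => h^-1 *: (((fun tau : R => f (tau *: v + t)) \o shift (0 : R)) (h *: (1 : R))
            - f (0 *: v + t)))
       = (fun h => h^-1 *: ((f \o shift t) (h *: v) - f t)).
  apply/funext => h /=; rewrite addr0 scale0r add0r; congr (_ *: (f (_ *: _ + _) - _)).
  exact: mulr1.
by split; [rewrite /derivable -E | rewrite -Df /derive -E].
Qed.

(** Derivatives are kept in the logarithmic form f l, so that differentiating a monomial returns the
    same monomial times a sum. *)
Lemma is_derive_prod (I : Type) (s : seq I) (f : I -> R -> R) (l : I -> R) (x : R) :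
  (forall i, is_derive x 1 (f i) (f i x * l i)) ->
  is_derive x 1 (fun y => \prod_(i <- s) f i y)
    (\prod_(i <- s) f i x * \sum_(i <- s) l i).
Proof.
move=> df; elim: s => [|i s IH].
  under eq_fun do rewrite big_nil; rewrite !big_nil mulr0; exact: is_derive_cst.
under eq_fun do rewrite big_cons; rewrite !big_cons.
refine (is_derive_eq (is_deriveM (df i) IH) _); rewrite /GRing.scale /=; ring.
Qed.

Lemma is_derive_power (f : R -> R) (l x : R) (k : nat) :
  is_derive x 1 f (f x * l) -> is_derive x 1 (fun y => f y ^+ k) (f x ^+ k * (k%:R * l)).
Proof.
move=> df; have H := @is_derive_prod nat (nseq k 0%N) (fun=> f) (fun=> l) x (fun=> df).
rewrite !big_nseq iter_mulr_1 iter_addr_0 in H.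
rewrite mulr_natl (_ : (fun y => f y ^+ k) = fun y => \prod_(i <- nseq k 0%N) f y) //.
by apply/funext => y; rewrite big_nseq iter_mulr_1.
Qed.

Lemma is_derive_bigsum (I : Type) (s : seq I) (f : I -> R -> R) (d : I -> R) (x : R) :
  (forall i, is_derive x 1 (f i) (d i)) ->
  is_derive x 1 (fun y => \sum_(i <- s) f i y) (\sum_(i <- s) d i).
Proof.
move=> df; elim: s => [|i s IH].
  under eq_fun do rewrite big_nil; rewrite !big_nil; exact: is_derive_cst.
by under eq_fun do rewrite big_cons; rewrite !big_cons; exact: is_deriveD.
Qed.

Lemma is_derive_scaler (c : R) (f : R -> R) (d x : R) :
  is_derive x 1 f d -> is_derive x 1 (fun y => c * f y) (c * d).
Proof. by move=> df; have := @is_deriveZ _ _ _ f c x 1 d df. Qed.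

Lemma is_derive_affine (h : R -> R) (v t d : R) : is_derive t 1 h d ->
  is_derive (0 : R) 1 (fun tau => h (tau * v + t)) (v * d).
Proof.
move=> dh.
have da : is_derive (0 : R) 1 (fun tau : R => tau * v + t) v.
  under eq_fun do rewrite [_ * v]mulrC.
  by refine (is_derive_eq (is_deriveD (is_derive_scaler v (is_derive_id (0 : R) 1))
    (is_derive_cst t (0 : R) 1)) _); rewrite mulr1 addr0.
have dh' : is_derive (0 * v + t) 1 h d by rewrite mul0r add0r.
by refine (is_derive_eq (@is_derive1_comp _ h (fun tau => tau * v + t) 0 _ _ dh' da) _); rewrite mulrC.
Qed.

Section Expansion.
Variables (n D : nat) (h l l' : R -> R).
Hypothesis dh : forall u : R, is_derive u (1 : R) h (h u * l u).
Hypothesis dl : forall u : R, is_derive u (1 : R) l (l' u).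

(** Used with h = [bc_coord g] in type BC and h = [expR] in type A; l is the logarithmic derivative
    of h. *)
Definition expansion (c : multi n D -> R) (t : 'rV[R]_n) : R :=
  \sum_m c m * mono (fun i => h (t 0 i)) (fun i => m i : nat).

Definition log_derivative (m : 'I_n -> nat) (v t : 'rV[R]_n) : R :=
  \sum_i (m i)%:R * (v 0 i * l (t 0 i)).

Lemma is_derive_mono (m : 'I_n -> nat) (v t : 'rV[R]_n) :
  is_derive (0 : R) 1 (fun tau => mono (fun i => h ((tau *: v + t) 0 i)) m)
    (mono (fun i => h (t 0 i)) m * log_derivative m v t).
Proof.
have di i : is_derive (0 : R) 1 (fun tau => h ((tau *: v + t) 0 i) ^+ m i)
    (h ((0 *: v + t) 0 i) ^+ m i * ((m i)%:R * (v 0 i * l (t 0 i)))).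
  apply: (@is_derive_power (fun tau => h ((tau *: v + t) 0 i))).
  under eq_fun do rewrite !mxE.
  by refine (is_derive_eq (is_derive_affine (v 0 i) (dh (t 0 i))) _); rewrite scale0r add0r mulrCA.
refine (is_derive_eq (is_derive_prod (index_enum _) di) _).
by rewrite scale0r add0r.
Qed.

Lemma is_derive_expansion c v t : is_derive t v (expansion c)
  (\sum_m c m * (mono (fun i => h (t 0 i)) (fun i => m i : nat)
                 * log_derivative (fun i => m i : nat) v t)).
Proof.
apply: is_derive_line; apply: is_derive_bigsum => m; apply: is_derive_scaler.
exact: is_derive_mono.
Qed.

Lemma is_derive2_expansion (c : multi n D -> R) (v t : 'rV[R]_n) : is_derive t v
  (fun s : 'rV[R]_n => \sum_(m : multi n D) c m * (mono (fun i => h (s 0 i)) (fun i => m i : nat)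
                          * log_derivative (fun i => m i : nat) v s))
  (\sum_(m : multi n D) c m * (mono (fun i => h (t 0 i)) (fun i => m i : nat)
     * (log_derivative (fun i => m i : nat) v t ^+ 2
        + \sum_i (m i)%:R * (v 0 i ^+ 2 * l' (t 0 i))))).
Proof.
apply: is_derive_line; apply: is_derive_bigsum => m; apply: is_derive_scaler.
have dlog : is_derive (0 : R) 1 (fun tau => log_derivative (fun i => m i : nat) v (tau *: v + t))
    (\sum_i (m i)%:R * (v 0 i ^+ 2 * l' (t 0 i))).
  apply: is_derive_bigsum => i; apply: is_derive_scaler; rewrite expr2 -mulrA.
  apply: is_derive_scaler; under eq_fun do rewrite !mxE.
  exact: is_derive_affine.
refine (is_derive_eq (is_deriveM (is_derive_mono (fun i => m i : nat) v t) dlog) _).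
cbv beta; rewrite scale0r add0r /GRing.scale /=; ring.
Qed.

Lemma real_jacobi_operator_expansion (a : set 'rV[R]_n) (b Rp : seq 'rV[R]_n) k f c t :
  (forall v s tau, a v -> a s -> a (tau *: v + s)) ->
  (forall v, v \in b -> a v) -> (forall v, v \in Rp -> a v) ->
  (forall s, a s -> f s = expansion c s) -> a t ->
  real_jacobi_operator b Rp k f t
  = \sum_m c m * (mono (fun i => h (t 0 i)) (fun i => m i : nat)
     * (\sum_(v <- b) (log_derivative (fun i => m i : nat) v t ^+ 2
           + \sum_i (m i)%:R * (v 0 i ^+ 2 * l' (t 0 i)))
        + \sum_(v <- Rp) k v * coth (dot v t / 2) * log_derivative (fun i => m i : nat) v t)).
Proof.
move=> aD ba Ra fE ta.
have Df (v s : 'rV[R]_n) : a v -> a s -> 'D_v f s = \sum_(m : multi n D) c m * (mono (fun i => h (s 0 i)) (fun i => m i : nat)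
                 * log_derivative (fun i => m i : nat) v s).
  move=> av as_; rewrite (@derive_line _ f (expansion c)); last by move=> tau; rewrite fE //; exact: aD.
  by have [_ ->] := is_derive_expansion c v s.
rewrite /real_jacobi_operator big_seq.
under eq_bigr => v vb.
  rewrite (@derive_line _ _ (fun s : 'rV[R]_n => \sum_(m : multi n D) c m * (mono (fun i => h (s 0 i)) (fun i => m i : nat)
                          * log_derivative (fun i => m i : nat) v s))); last first.
    by move=> tau; rewrite Df; [|exact: ba|apply: aD => //; exact: ba].
  have [_ ->] := is_derive2_expansion c v t; over.
rewrite -big_seq [X in _ + X]big_seq.
under [X in _ + X]eq_bigr => v vR do rewrite (Df _ _ (Ra _ vR) ta) mulr_sumr.
rewrite -big_seq exchange_big [X in _ + X]exchange_big -big_split /=.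
apply: eq_bigr => m _; rewrite !mulrDr !mulr_sumr; congr (_ + _).
by apply: eq_bigr => v _; ring.
Qed.

End Expansion.

Lemma dotDl n (x y z : 'rV[R]_n) : dot (x + y) z = dot x z + dot y z.
Proof. by rewrite /dot -big_split; apply: eq_bigr => i _; rewrite mxE mulrDl. Qed.

Lemma dotZl n c (x z : 'rV[R]_n) : dot (c *: x) z = c * dot x z.
Proof. by rewrite /dot mulr_sumr; apply: eq_bigr => i _; rewrite mxE mulrA. Qed.

Lemma dotNl n (x z : 'rV[R]_n) : dot (- x) z = - dot x z.
Proof. by rewrite -scaleN1r dotZl mulN1r. Qed.

Lemma dot0l n (z : 'rV[R]_n) : dot 0 z = 0.
Proof. by rewrite /dot big1 // => i _; rewrite mxE mul0r. Qed.

Lemma dotC n (x y : 'rV[R]_n) : dot x y = dot y x.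
Proof. by apply: eq_bigr => i _; rewrite mulrC. Qed.

Lemma dotDr n (x y z : 'rV[R]_n) : dot x (y + z) = dot x y + dot x z.
Proof. by rewrite dotC dotDl !(dotC x). Qed.

Lemma dotZr n c (x z : 'rV[R]_n) : dot x (c *: z) = c * dot x z.
Proof. by rewrite dotC dotZl dotC. Qed.

Lemma dotNr n (x z : 'rV[R]_n) : dot x (- z) = - dot x z.
Proof. by rewrite dotC dotNl dotC. Qed.

Lemma dot_suml n (I : Type) (s : seq I) (P : pred I) (F : I -> 'rV[R]_n) z :
  dot (\sum_(i <- s | P i) F i) z = \sum_(i <- s | P i) dot (F i) z.
Proof. by apply: (big_morph (fun x => dot x z)) => [x y|]; rewrite ?dotDl ?dot0l. Qed.

Lemma dot_basis n i (t : 'rV[R]_n) : dot (basis_vec i) t = t 0 i.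
Proof.
rewrite /dot (bigD1 i) //= big1 ?addr0 ?mxE ?eqxx ?mul1r // => j /negPf ji.
by rewrite mxE ji andbF mul0r.
Qed.

(** The eigenvalue equation comes with an arbitrary orthonormal basis; this identity eliminates it
    from the Laplacian of a monomial. *)
Lemma parseval n (a : set 'rV[R]_n) (b : seq 'rV[R]_n) (u : 'rV[R]_n) :
  orthonormal_basis a b -> a u -> \sum_(v <- b) dot u v ^+ 2 = dot u u.
Proof.
move=> [ub ba bo bs] au.
have uE : u = \sum_(v <- b) dot u v *: v.
  have := coord_span (X := in_tuple b) (bs u au) => uc.
  have dc (i : 'I_(size b)) : dot u b`_i = coord (in_tuple b) i u.
    rewrite {1}uc dot_suml (bigD1 i) //= dotZl bo ?mem_nth // eqxx mulr1 big1 ?addr0 //.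
    move=> j ji; rewrite dotZl bo ?mem_nth // nth_uniq //.
    by rewrite (_ : (j : nat) == i = false) ?mulr0 //; exact: negbTE ji.
  rewrite {1}uc (big_nth 0) big_mkord; apply: eq_bigr => i _; by rewrite dc.
transitivity (dot (\sum_(v <- b) dot u v *: v) u); last by rewrite -uE.
rewrite dot_suml; apply: eq_bigr => v _.
by rewrite dotZl (dotC v) expr2.
Qed.

End Derivatives.

(** * The symbol of L_k in type BC *)

Section BCSymbol.
Variable R : realType.
Implicit Types (u g : R).

Lemma cosh_double u : cosh u = 1 + 2 * sinh (u / 2) ^+ 2.
Proof.
rewrite /cosh /sinh {1}(splitr u) [in - u](splitr u) opprD !expRD.
have := expRxMexpNx_1 (u / 2); move: (expR _) (expR _) => p q pq.
nra.
Qed.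

Lemma sinh_sqr u : sinh u ^+ 2 = 4 * (sinh (u / 2) ^+ 2 * (1 + sinh (u / 2) ^+ 2)).
Proof.
have -> : sinh u ^+ 2 = cosh u ^+ 2 - 1.
  by rewrite /cosh /sinh; have := expRxMexpNx_1 u; move: (expR _) (expR _) => p q pq; nra.
by rewrite cosh_double; ring.
Qed.

Lemma sinh_double u : sinh u = 2 * (sinh (u / 2) * cosh (u / 2)).
Proof.
rewrite /cosh /sinh {1}(splitr u) [in - u](splitr u) opprD !expRD.
by move: (expR _) (expR _) => p q; lra.
Qed.

Lemma cosh_sqr u : cosh u ^+ 2 = 1 + sinh u ^+ 2.
Proof. by rewrite /cosh /sinh; have := expRxMexpNx_1 u; move: (expR _) (expR _) => p q pq; nra. Qed.

Lemma cosh_gt0 u : 0 < cosh u.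
Proof. by rewrite /cosh; have := expR_gt0 u; have := expR_gt0 (- u); lra. Qed.

Lemma sinh_gt0 u : 0 < u -> 0 < sinh u.
Proof.
move=> u0; have : expR (- u) < expR u by rewrite ltr_expR; lra.
by rewrite /sinh; lra.
Qed.

Lemma is_derive_expN u : is_derive u (1 : R) (fun x => expR (- x)) (- expR (- u)).
Proof.
refine (is_derive_eq (@is_derive1_comp _ expR -%R u _ _ _ _) _).
by rewrite mulrN1.
Qed.

Lemma is_derive_cosh u : is_derive u (1 : R) cosh (sinh u).
Proof.
have := is_derive_scaler 2^-1 (is_deriveD (is_derive_expR u) (is_derive_expN u)).
rewrite (_ : (fun y => _) = cosh) => [H|]; last by apply/funext => y /=; rewrite mulrC.
by refine (is_derive_eq H _); rewrite mulrC.
Qed.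

Lemma is_derive_sinh u : is_derive u (1 : R) sinh (cosh u).
Proof.
have := is_derive_scaler 2^-1 (is_deriveB (is_derive_expR u) (is_derive_expN u)).
rewrite (_ : (fun y => _) = sinh) => [H|]; last by apply/funext => y /=; rewrite mulrC.
by refine (is_derive_eq H _); rewrite mulrC opprK.
Qed.

Definition bc_coord g u : R := g + sinh (u / 2) ^+ 2.
Definition bc_log g u : R := sinh u / (2 * bc_coord g u).
Definition bc_log' g u : R := cosh u / (2 * bc_coord g u) - bc_log g u ^+ 2.

Lemma bc_coord_gt0 g u : 0 < g -> 0 < bc_coord g u.
Proof. by move=> g0; rewrite ltr_pwDl // sqr_ge0. Qed.

Lemma is_derive_bc_coord g u : 0 < g ->
  is_derive u (1 : R) (bc_coord g) (bc_coord g u * bc_log g u).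
Proof.
move=> g0; have h0 := lt0r_neq0 (bc_coord_gt0 u g0).
have := is_deriveD (is_derive_cst (g - 2^-1) u 1) (is_derive_scaler 2^-1 (is_derive_cosh u)).
rewrite (_ : cst _ + _ = bc_coord g) => [H|]; last first.
  apply/funext => y; change (g - 2^-1 + 2^-1 * cosh y = bc_coord g y).
  by rewrite /bc_coord cosh_double; field.
by refine (is_derive_eq H _); rewrite /bc_log; field.
Qed.

Lemma is_derive_bc_log g u : 0 < g -> is_derive u (1 : R) (bc_log g) (bc_log' g u).
Proof.
move=> g0; have h0 := lt0r_neq0 (bc_coord_gt0 u g0).
have h20 : 2 * bc_coord g u != 0 by rewrite mulf_neq0.
have dV := @is_deriveV _ (fun y => 2 * bc_coord g y) u _ 1 h20 (is_derive_scaler 2 (is_derive_bc_coord u g0)).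
refine (is_derive_eq (is_deriveM (is_derive_sinh u) dV) _).
by rewrite /bc_log' /bc_log /GRing.scale /=; field.
Qed.

(** Addition formulas: coth A + coth B = sinh(A + B) / (sinh A sinh B), and sinh((p+q)/2)
    sinh((p-q)/2) = sinh^2(p/2) - sinh^2(q/2). The last difference is x_i - x_j for every g, so the
    roots e_i + e_j and e_i - e_j together produce the Jack kernel. *)
Lemma coth_pair (p q : R) : 0 < p -> 0 < q -> p != q ->
  coth ((p + q) / 2) + coth ((p - q) / 2)
  = sinh p / (sinh (p / 2) ^+ 2 - sinh (q / 2) ^+ 2) /\
  coth ((p + q) / 2) - coth ((p - q) / 2)
  = sinh q / (sinh (q / 2) ^+ 2 - sinh (p / 2) ^+ 2).
Proof.
move=> p0 q0 pq.
have -> : sinh p = (expR (p / 2) ^+ 2 - expR (- (p / 2)) ^+ 2) / 2.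
  by rewrite -!expRM_natl /sinh; congr ((expR _ - expR _) / 2); field.
have -> : sinh q = (expR (q / 2) ^+ 2 - expR (- (q / 2)) ^+ 2) / 2.
  by rewrite -!expRM_natl /sinh; congr ((expR _ - expR _) / 2); field.
rewrite (mulrDl p q) (mulrBl _ p q) /coth /sinh /cosh !opprD !opprK !expRD !expRN.
have P0 := expR_gt0 (p / 2); have Q0 := expR_gt0 (q / 2).
have P1 : 1 < expR (p / 2) by rewrite expR_gt1; lra.
have Q1 : 1 < expR (q / 2) by rewrite expR_gt1; lra.
have PQ : expR (p / 2) != expR (q / 2).
  by apply: contra_neq pq => /expR_inj; apply: mulIf; rewrite invr_eq0 pnatr_eq0.
move: (expR (p / 2)) (expR (q / 2)) P0 Q0 P1 Q1 PQ => x y x0 y0 x1 y1 xy.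
have nx : x != 0 by rewrite gt_eqF. have ny : y != 0 by rewrite gt_eqF.
have m1 : x * x + - y * y != 0.
  have -> : x * x + - y * y = (x - y) * (x + y) by ring.
  by rewrite mulf_neq0 ?subr_eq0 // gt_eqF // addr_gt0.
have m2 : x * y * (x * y) - 1 != 0.
  have xy1 : 1 < x * y by nra.
  by rewrite gt_eqF // subr_gt0; nra.
have E : ((x - x^-1) / 2) ^+ 2 - ((y - y^-1) / 2) ^+ 2
    = (x * y - x^-1 / y) * (x / y - x^-1 * y) / 4.
  by field; rewrite nx ny.
rewrite -[((y - y^-1) / 2) ^+ 2 - _]opprB E.
by split; field; rewrite nx ny m1 m2.
Qed.

Lemma sinh_sqr_surj (y : R) : 0 < y -> exists2 u, 0 < u & sinh (u / 2) ^+ 2 = y.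
Proof.
(* The equation is cosh u = 1 + 2 y = c, hence exp u = c + sqrt(c^2 - 1), with inverse c - sqrt(c^2
   - 1). *)
move=> y0; pose c := 1 + 2 * y; pose e := c + Num.sqrt (c ^+ 2 - 1).
have c1 : 1 < c by rewrite /c; lra.
have s0 : 0 <= Num.sqrt (c ^+ 2 - 1) by exact: sqrtr_ge0.
have s2 : Num.sqrt (c ^+ 2 - 1) ^+ 2 = c ^+ 2 - 1 by rewrite sqr_sqrtr //; nra.
have e1 : 1 < e by rewrite /e; lra.
have e0 : 0 < e by lra.
exists (ln e); first by rewrite ln_gt0.
have := cosh_double (ln e); rewrite /cosh expRN lnK ?posrE //.
have -> : e^-1 = c - Num.sqrt (c ^+ 2 - 1).
  apply: (mulfI (lt0r_neq0 e0)).
  rewrite divff ?gt_eqF // /e; move: s2; set s := Num.sqrt _ => s2.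
  by transitivity (c ^+ 2 - s ^+ 2); [rewrite s2; ring | ring].
by rewrite /e /c; move: (sinh _ ^+ 2) => z; lra.
Qed.

Lemma sum_pairs n (F : 'I_n -> 'I_n -> R) :
  \sum_(ij <- enum [pred ij : 'I_n * 'I_n | (ij.1 < ij.2)%N]) (F ij.1 ij.2 + F ij.2 ij.1)
  = \sum_(i < n) \sum_(j < n | j != i) F i j.
Proof.
rewrite big_enum /= big_split /=.
rewrite -(pair_big_dep xpredT (fun i j : 'I_n => (i < j)%N) F) /=.
rewrite -(pair_big_dep xpredT (fun i j : 'I_n => (i < j)%N) (fun i j => F j i)) /=.
rewrite [X in _ + X](exchange_big_dep xpredT) //= -big_split /=.
apply: eq_bigr => i _; rewrite [RHS](bigID (fun j : 'I_n => (i < j)%N)) /=; congr (_ + _).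
  by apply: eq_bigl => j; rewrite andbC; case: (ltnP i j) => // ij; rewrite -(inj_eq val_inj) gtn_eqF.
apply: eq_bigl => j; rewrite -leqNgt ltn_neqAle; congr (_ && _).
Qed.

End BCSymbol.

Section BCRoots.
Variables (R : realType) (n : nat).
Implicit Types (v t : 'rV[R]_n) (i j : 'I_n) (m : 'I_n -> nat).

Lemma basis_vecE i j : (basis_vec i : 'rV[R]_n) 0 j = (j == i)%:R.
Proof. by rewrite mxE eqxx. Qed.

Lemma dot_basis2 i j : dot (basis_vec i : 'rV[R]_n) (basis_vec j) = (i == j)%:R.
Proof. by rewrite dot_basis basis_vecE. Qed.

Lemma bc_multiplicity_short (k1 k2 k3 : R) i :
  bc_multiplicity k1 k2 k3 (basis_vec i : 'rV[R]_n) = k1.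
Proof.
by rewrite /bc_multiplicity; case: existsP => // -[]; exists i; rewrite eqxx.
Qed.

(** The squared lengths 1, 4 and 2 tell the three orbits of roots apart. *)
Lemma bc_multiplicity_other (k1 k2 k3 : R) v : dot v v != 1 -> dot v v != 4 ->
  bc_multiplicity k1 k2 k3 v = k3.
Proof.
move=> /eqP v1 /eqP v4; rewrite /bc_multiplicity.
case: existsP => [[i /orP[] /eqP vE]|_].
- by case: v1; rewrite vE dot_basis2 eqxx.
- by case: v1; rewrite vE dotNl dotNr opprK dot_basis2 eqxx.
case: existsP => [[i /orP[] /eqP vE]|//].
- by case: v4; rewrite vE dotZl dotZr dot_basis2 eqxx mulr1n; ring.
- by case: v4; rewrite vE dotNl dotNr opprK dotZl dotZr dot_basis2 eqxx mulr1n; ring.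
Qed.

Lemma bc_multiplicity_long (k1 k2 k3 : R) i :
  bc_multiplicity k1 k2 k3 (2 *: basis_vec i : 'rV[R]_n) = k2.
Proof.
have v4 : dot (2 *: basis_vec i : 'rV[R]_n) (2 *: basis_vec i) = 4.
  by rewrite dotZl dotZr dot_basis2 eqxx mulr1n; ring.
rewrite /bc_multiplicity; case: existsP => [[j /orP[] /eqP vE]|_].
- by move: v4; rewrite vE dot_basis2 eqxx mulr1n; lra.
- by move: v4; rewrite vE dotNl dotNr opprK dot_basis2 eqxx mulr1n; lra.
by case: existsP => // -[]; exists i; rewrite eqxx.
Qed.

Lemma bc_multiplicity_middle (k1 k2 k3 : R) i j : (i < j)%N ->
  bc_multiplicity k1 k2 k3 (basis_vec i + basis_vec j : 'rV[R]_n) = k3 /\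
  bc_multiplicity k1 k2 k3 (basis_vec i - basis_vec j : 'rV[R]_n) = k3.
Proof.
move=> ij; have nij : (i == j) = false by apply/eqP => E; rewrite E ltnn in ij.
have nji : (j == i) = false by rewrite eq_sym.
have d1 : dot (basis_vec i + basis_vec j : 'rV[R]_n) (basis_vec i + basis_vec j) = 2.
  by rewrite !(dotDl, dotDr, dot_basis2) !eqxx nij nji ?mulr1n ?mulr0n; ring.
have d2 : dot (basis_vec i - basis_vec j : 'rV[R]_n) (basis_vec i - basis_vec j) = 2.
  by rewrite !(dotDl, dotDr, dotNl, dotNr, dot_basis2) !eqxx nij nji ?mulr1n ?mulr0n; ring.
by split; rewrite bc_multiplicity_other ?d1 ?d2 //; apply/eqP; lra.
Qed.

Lemma log_derivativeD l m v v' t :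
  log_derivative l m (v + v') t = log_derivative l m v t + log_derivative l m v' t.
Proof. by rewrite -big_split; apply: eq_bigr => i _; rewrite mxE /=; ring. Qed.

Lemma log_derivativeZ l m c v t : log_derivative l m (c *: v) t = c * log_derivative l m v t.
Proof. by rewrite mulr_sumr; apply: eq_bigr => i _; rewrite mxE /=; ring. Qed.

Lemma log_derivativeB l m v v' t :
  log_derivative l m (v - v') t = log_derivative l m v t - log_derivative l m v' t.
Proof. by rewrite log_derivativeD -scaleN1r log_derivativeZ mulN1r. Qed.

Lemma log_derivative_basis l m i t : log_derivative l m (basis_vec i) t = (m i)%:R * l (t 0 i).
Proof.
rewrite /log_derivative (bigD1 i) //= basis_vecE eqxx mul1r big1 ?addr0 // => j /negPf ji.
by rewrite basis_vecE ji mul0r mulr0.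
Qed.

Lemma laplacian_symbol (b : seq 'rV[R]_n) l l' m t : orthonormal_basis setT b ->
  \sum_(v <- b) (log_derivative l m v t ^+ 2 + \sum_i (m i)%:R * (v 0 i ^+ 2 * l' (t 0 i)))
  = \sum_i (((m i)%:R * l (t 0 i)) ^+ 2 + (m i)%:R * l' (t 0 i)).
Proof.
move=> bo; rewrite !big_split /=; congr (_ + _).
  transitivity (\sum_(v <- b) dot (\row_i ((m i)%:R * l (t 0 i))) v ^+ 2).
    apply: eq_bigr => v _; congr (_ ^+ 2); apply: eq_bigr => i _; rewrite mxE; ring.
  rewrite (parseval bo) //; apply: eq_bigr => i _; rewrite mxE; ring.
rewrite exchange_big; apply: eq_bigr => i _ /=.
have E : \sum_(v <- b) dot (basis_vec i) v ^+ 2 = 1.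
  by rewrite (parseval bo) // dot_basis2 eqxx.
rewrite -[RHS]mulr1 -E mulr_sumr; apply: eq_bigr => v _; rewrite dot_basis; ring.
Qed.

Lemma bc_root_symbol (k1 k2 k3 : R) l m t :
  \sum_(v <- bc_positive_roots) bc_multiplicity k1 k2 k3 v * coth (dot v t / 2)
     * log_derivative l m v t
  = \sum_i (k1 * coth (t 0 i / 2) + 2 * k2 * coth (t 0 i)) * ((m i)%:R * l (t 0 i))
    + k3 * \sum_(ij <- enum [pred ij : 'I_n * 'I_n | (ij.1 < ij.2)%N])
       ((coth ((t 0 ij.1 + t 0 ij.2) / 2) + coth ((t 0 ij.1 - t 0 ij.2) / 2)) * ((m ij.1)%:R * l (t 0 ij.1))
       + (coth ((t 0 ij.1 + t 0 ij.2) / 2) - coth ((t 0 ij.1 - t 0 ij.2) / 2)) * ((m ij.2)%:R * l (t 0 ij.2))).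
Proof.
rewrite /bc_positive_roots !big_cat !big_map !big_enum /= addrA -big_split /= -big_split /=.
congr (_ + _).
  apply: eq_bigr => i _; rewrite bc_multiplicity_short bc_multiplicity_long.
  rewrite log_derivativeZ log_derivative_basis dotZl dot_basis.
  have -> : 2 * t 0 i / 2 = t 0 i by field.
  ring.
rewrite mulr_sumr; apply: eq_bigr => -[i j] /= ij.
have [-> ->] := bc_multiplicity_middle k1 k2 k3 ij.
rewrite log_derivativeD log_derivativeB !log_derivative_basis !(dotDl, dotNl) !dot_basis; ring.
Qed.

(** After the pairing of e_i + e_j with e_i - e_j both sides are sums over i of expressions in x_i,
    sinh t_i and a kernel sum W, so it remains to compare them for one i. *)
Lemma bc_symbol (k1 k2 k3 g : R) (b : seq 'rV[R]_n) m t :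
  orthonormal_basis setT b -> 0 < g -> g * (k1 + 2 * k2) = k1 + k2 ->
  (forall i, 0 < t 0 i) -> injective (t 0) ->
  \sum_(v <- b) (log_derivative (bc_log g) m v t ^+ 2
                 + \sum_i (m i)%:R * (v 0 i ^+ 2 * bc_log' g (t 0 i)))
  + \sum_(v <- bc_positive_roots) bc_multiplicity k1 k2 k3 v * coth (dot v t / 2)
      * log_derivative (bc_log g) m v t
  = \sum_i ((k1 + 2 * k2) * (m i)%:R
     + ((1 + (1 - 2 * g) / bc_coord g (t 0 i) - g * (1 - g) / bc_coord g (t 0 i) ^+ 2)
          * jack_factor k3 m (fun j => bc_coord g (t 0 j)) i
        + (m i)%:R * (1 + (2^-1 - g) / bc_coord g (t 0 i)))).
Proof.
move=> bo g0 gK t0 tinj; rewrite laplacian_symbol // bc_root_symbol.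
pose A i := (m i)%:R * bc_log g (t 0 i).
pose s i := sinh (t 0 i / 2) ^+ 2.
rewrite (eq_big_seq (fun ij => A ij.1 * sinh (t 0 ij.1) / (s ij.1 - s ij.2)
   + A ij.2 * sinh (t 0 ij.2) / (s ij.2 - s ij.1))); last first.
  move=> [i j]; rewrite mem_enum inE /= => ij.
  have tij : t 0 i != t 0 j by apply: contraTneq ij => /tinj ->; rewrite ltnn.
  by have [-> ->] := coth_pair (t0 i) (t0 j) tij; rewrite /A /s; ring.
rewrite (sum_pairs (fun i j => A i * sinh (t 0 i) / (s i - s j))).
rewrite mulr_sumr -!big_split /=; apply: eq_bigr => i _.
rewrite /jack_factor.
have E j : bc_coord g (t 0 i) - bc_coord g (t 0 j) = s i - s j by rewrite /bc_coord /s; ring.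
under [X in _ = _ + (_ * (_ + _ * (_ * X)) + _)]eq_bigr do rewrite E.
rewrite -mulr_sumr -[X in _ = _ + (_ * (_ + _ * (_ * X)) + _)]mulr_sumr.
move: (\sum_(_ < n | _) _) => W.
have x0 := bc_coord_gt0 (t 0 i) g0.
have sh := sinh_gt0 (t0 i).
have sh2 : 0 < sinh (t 0 i / 2) by apply: sinh_gt0; have := t0 i; lra.
rewrite /A /bc_log' /bc_log.
have S2 := sinh_sqr (t 0 i); rewrite -/(s i) in S2.
have -> : coth (t 0 i / 2) = 2 * (1 + s i) / sinh (t 0 i).
  rewrite sinh_double /coth -[1 + s i]cosh_sqr; have := cosh_gt0 (t 0 i / 2) => c0.
  by field; rewrite !gt_eqF.
have -> : coth (t 0 i) = (1 + 2 * s i) / sinh (t 0 i) by rewrite /coth cosh_double.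
rewrite cosh_double -/(s i).
have sE : s i = bc_coord g (t 0 i) - g by rewrite /bc_coord /s; ring.
move: S2; rewrite sE; move: (bc_coord g _) x0 (sinh (t 0 i)) sh => x x0 S S0 S2.
have nS := lt0r_neq0 S0; have nx := lt0r_neq0 x0.
(* The choice of g enters here: with s = x - g, the first-order coefficient k1 (1 + s) + k2 (1 + 2
   s) is exactly K x. *)
have kE : k1 * (1 + (x - g)) + k2 * (1 + 2 * (x - g)) = (k1 + 2 * k2) * x.
  transitivity ((k1 + 2 * k2) * x + ((k1 + k2) - g * (k1 + 2 * k2))); first by ring.
  by rewrite gK subrr addr0.
set M := (m i)%:R.
(* An intermediate form in which sinh t occurs only through its square, a polynomial in x. *)
transitivity (M * (M - 1) * S ^+ 2 / (4 * x ^+ 2) + M * (1 + 2 * (x - g)) / (2 * x)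
  + (k1 * (1 + (x - g)) + k2 * (1 + 2 * (x - g))) * M / x + k3 * M * S ^+ 2 * W / (2 * x)).
  by field; rewrite nx nS.
by rewrite kE S2; field.
Qed.

End BCRoots.

(** * Reflections and Weyl orbits *)

(** Orbits and sets of dominant weights consist of real vectors; a parametrization by exponents
    turns sums over them into finite sums that can be exchanged and regrouped. *)
Lemma fsum_finType (V : nmodType) (T : choiceType) (Z : finType) (phi : Z -> T) (P : pred Z)
    (A : set T) (F : T -> V) :
  {in P &, injective phi} -> (forall x, A x -> exists2 z, P z & phi z = x) ->
  \sum_(x \in A) F x = \sum_(z | P z && `[<A (phi z)>]) F (phi z).
Proof.
move=> inj surj; pose r := map phi [seq z <- enum Z | P z && `[<A (phi z)>]].
rewrite (fsbigE r).
- rewrite big_map big_filter_cond big_enum_cond /=; apply: eq_bigl => z.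
  by rewrite -andbA; congr (_ && _); rewrite andb_idr // => /asboolP h; rewrite inE.
- rewrite map_inj_in_uniq => [|z1 z2]; first by rewrite filter_uniq // enum_uniq.
  by rewrite !mem_filter => /andP[/andP[? _] _] /andP[/andP[? _] _]; exact: inj.
- by move=> x /= /mapP[z]; rewrite mem_filter => /andP[/andP[_ /asboolP ?] _] ->.
- move=> x Ax; case/negP; have [z Pz zx] := surj x Ax; rewrite -zx map_f // mem_filter Pz mem_enum /=.
  by rewrite andbT; apply/asboolP; rewrite zx.
Qed.

Section Reflections.
Variables (R : realType) (n : nat).
Implicit Types (v w t mu alpha : 'rV[R]_n) (i j : 'I_n).

Lemma bc_rootP alpha : alpha \in bc_positive_roots ->
  [\/ exists i, alpha = basis_vec i, exists i, alpha = 2 *: basis_vec i,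
      exists i j, (i < j)%N /\ alpha = basis_vec i + basis_vec j
    | exists i j, (i < j)%N /\ alpha = basis_vec i - basis_vec j].
Proof.
rewrite !mem_cat => /or4P[] /mapP[].
- by move=> i _ ->; constructor 1; exists i.
- by move=> i _ ->; constructor 2; exists i.
- by move=> [i j]; rewrite mem_enum => ij ->; constructor 3; exists i, j.
- by move=> [i j]; rewrite mem_enum => ij ->; constructor 4; exists i, j.
Qed.

Lemma a_rootP alpha : alpha \in a_positive_roots ->
  exists i j, (i < j)%N /\ alpha = basis_vec i - basis_vec j.
Proof. by move=> /mapP[[i j]]; rewrite mem_enum => ij ->; exists i, j. Qed.

Lemma a_root_mem i j : (i < j)%N -> (basis_vec i - basis_vec j : 'rV[R]_n) \in a_positive_roots.
Proof. by move=> ij; apply/mapP; exists (i, j); rewrite // mem_enum. Qed.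

Lemma bc_root_mem_diff i j : (i < j)%N -> (basis_vec i - basis_vec j : 'rV[R]_n) \in bc_positive_roots.
Proof. by move=> /a_root_mem; rewrite /bc_positive_roots !mem_cat => ->; rewrite !orbT. Qed.

Lemma bc_root_mem_short i : (basis_vec i : 'rV[R]_n) \in bc_positive_roots.
Proof. by rewrite !mem_cat map_f ?mem_enum. Qed.

Lemma bc_root_mem_long i : (2 *: basis_vec i : 'rV[R]_n) \in bc_positive_roots.
Proof.
rewrite !mem_cat; apply/orP; right; apply/orP; left.
by apply/mapP; exists i; rewrite // mem_enum.
Qed.

Lemma reflectionE alpha v i :
  reflection alpha v 0 i = v 0 i - 2 / dot alpha alpha * dot alpha v * alpha 0 i.
Proof. by rewrite /reflection /coroot !mxE dotZr (dotC v). Qed.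

Lemma reflectionN alpha v : reflection (- alpha) v = reflection alpha v.
Proof. by apply/rowP => i; rewrite !reflectionE !(dotNl, dotNr) mxE opprK; ring. Qed.

Lemma reflection_short i v : reflection (basis_vec i) v = \row_j (if j == i then - v 0 j else v 0 j).
Proof.
apply/rowP => j; rewrite reflectionE dot_basis2 dot_basis basis_vecE eqxx mxE.
by case: eqP => [->|_]; rewrite ?mulr1n ?mulr0n; field.
Qed.

Lemma reflection_long i v : reflection (2 *: basis_vec i) v = reflection (basis_vec i) v.
Proof.
apply/rowP => j; rewrite !reflectionE !(dotZl, dotZr) dot_basis2 dot_basis !mxE !eqxx.
by rewrite mulr1n; field.
Qed.

Lemma reflection_diff i j v : i != j ->
  reflection (basis_vec i - basis_vec j) v = \row_l v 0 (tperm i j l).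
Proof.
move=> ij; apply/rowP => l; rewrite reflectionE !(dotDl, dotDr, dotNl, dotNr, dot_basis2, dot_basis).
rewrite !eqxx (negPf ij) eq_sym (negPf ij) !mxE eqxx /=.
case: tpermP => [->|->|/eqP/negPf li /eqP/negPf lj].
- by rewrite eqxx (negPf ij) mulr1n mulr0n; field.
- by rewrite eqxx eq_sym (negPf ij) mulr1n mulr0n; field.
- by rewrite li lj mulr0n; field.
Qed.

Lemma reflection_sum i j v : i != j ->
  reflection (basis_vec i + basis_vec j) v
  = \row_l (if (l == i) || (l == j) then - v 0 (tperm i j l) else v 0 l).
Proof.
move=> ij; apply/rowP => l; rewrite reflectionE !(dotDl, dotDr, dotNl, dotNr, dot_basis2, dot_basis).
rewrite !eqxx (negPf ij) eq_sym (negPf ij) !mxE eqxx /=.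
case: tpermP => [->|->|/eqP/negPf li /eqP/negPf lj].
- by rewrite eqxx (negPf ij) mulr1n mulr0n; field.
- by rewrite eqxx eq_sym (negPf ij) mulr1n mulr0n; field.
- by rewrite li lj mulr0n; field.
Qed.

Lemma weyl_orbit_refl Rp v : weyl_orbit Rp v v.
Proof. by exists [::]. Qed.

Lemma weyl_orbit_reflection Rp alpha mu v : alpha \in Rp ->
  weyl_orbit Rp mu v -> weyl_orbit Rp mu (reflection alpha v).
Proof.
move=> aR [s sR ->]; exists (alpha :: s) => // b; rewrite inE => /predU1P[->|/sR //].
by rewrite mem_cat aR.
Qed.

Lemma weyl_orbit_ind Rp mu (Q : 'rV[R]_n -> Prop) : Q mu ->
  (forall alpha v, alpha \in Rp -> Q v -> Q (reflection alpha v)) ->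
  forall v, weyl_orbit Rp mu v -> Q v.
Proof.
move=> Qmu Qr v [s sR ->]; elim: s sR => //= b s IH sR.
have {IH} Qs : Q (foldr reflection mu s) by apply: IH => x xs; apply: sR; rewrite inE xs orbT.
have := sR b; rewrite inE eqxx mem_cat => /(_ isT)/orP[bR|/mapP[c cR ->]].
  exact: Qr.
by rewrite reflectionN; exact: Qr.
Qed.

(** The Weyl group is that of signed permutations. It is used only through this inclusion and the
    stability of its orbits under transpositions and sign changes. *)
Lemma bc_orbit_perm mu v : weyl_orbit bc_positive_roots mu v ->
  exists s : 'S_n, forall i, `|v 0 i| = `|mu 0 (s i)|.
Proof.
move: v; apply: weyl_orbit_ind => [|alpha v aR [s sE]].
  by exists 1%g => i; rewrite perm1.
have [[i ->]|[i ->]|[i [j [ij ->]]]|[i [j [ij ->]]]] := bc_rootP aR.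
- by exists s => l; rewrite reflection_short mxE; case: eqP => _; rewrite ?normrN sE.
- by exists s => l; rewrite reflection_long reflection_short mxE; case: eqP => _; rewrite ?normrN sE.
- have nij : i != j by apply: contraTneq ij => ->; rewrite ltnn.
  exists (tperm i j * s)%g => l; rewrite permM -sE reflection_sum // mxE.
  case: tpermP => [->|->|/eqP/negPf -> /eqP/negPf ->] //; rewrite ?eqxx ?orbT normrN ?tpermL ?tpermR //.
- have nij : i != j by apply: contraTneq ij => ->; rewrite ltnn.
  by exists (tperm i j * s)%g => l; rewrite permM -sE reflection_diff // mxE.
Qed.

Lemma a_orbit_perm mu v : weyl_orbit a_positive_roots mu v ->
  exists s : 'S_n, forall i, v 0 i = mu 0 (s i).
Proof.
move: v; apply: weyl_orbit_ind => [|alpha v /a_rootP[i [j [ij ->]]] [s sE]].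
  by exists 1%g => i; rewrite perm1.
have nij : i != j by apply: contraTneq ij => ->; rewrite ltnn.
by exists (tperm i j * s)%g => l; rewrite permM -sE reflection_diff // mxE.
Qed.

Lemma weyl_orbit_tperm Rp mu v i j :
  (forall i j, (i < j)%N -> (basis_vec i - basis_vec j) \in Rp) ->
  weyl_orbit Rp mu v -> weyl_orbit Rp mu (\row_l v 0 (tperm i j l)).
Proof.
move=> HR Hv; case: (ssrnat.ltngtP i j) => [ij|ij|/val_inj ->].
- by rewrite -reflection_diff; [exact: weyl_orbit_reflection (HR _ _ ij) Hv|
    apply: contraTneq ij => ->; rewrite ltnn].
- by rewrite tpermC -reflection_diff; [exact: weyl_orbit_reflection (HR _ _ ij) Hv|
    apply: contraTneq ij => ->; rewrite ltnn].
- by rewrite (_ : \row_l _ = v) //; apply/rowP => l; rewrite mxE tperm1 perm1.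
Qed.

Lemma bc_orbit_flip mu v (s : seq 'I_n) : uniq s ->
  weyl_orbit bc_positive_roots mu v ->
  weyl_orbit bc_positive_roots mu (\row_i (if i \in s then - v 0 i else v 0 i)).
Proof.
elim: s => [_ H|i s IH /andP[ns us] /(IH us) H].
  by rewrite (_ : \row_i _ = v) //; apply/rowP => i; rewrite mxE.
have := weyl_orbit_reflection (bc_root_mem_short i) H; rewrite reflection_short.
congr (weyl_orbit _ _ _); apply/rowP => j; rewrite !mxE inE.
by case: eqP => [->|]; rewrite ?(negPf ns).
Qed.

Lemma bc_orbit_abs mu v w : (forall i, `|w 0 i| = `|v 0 i|) ->
  weyl_orbit bc_positive_roots mu v -> weyl_orbit bc_positive_roots mu w.
Proof.
move=> vw H; have := @bc_orbit_flip mu v [seq i <- enum 'I_n | w 0 i != v 0 i].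
rewrite filter_uniq ?(enum_uniq 'I_n) // => /(_ isT H).
congr (weyl_orbit _ _ _); apply/rowP => i; rewrite mxE mem_filter mem_enum andbT.
case: eqP => //= /eqP wv; have /eqP := vw i; rewrite eqr_norm2 (negPf wv) /= => /eqP ->.
by [].
Qed.

(** This makes the order on weights imply the inequalities of the dominance order; equality of total
    weights is not implied, because of the roots other than e_i - e_j. *)
Lemma bc_root_partial_sum alpha (r : nat) : alpha \in bc_positive_roots ->
  0 <= \sum_(i < n | (i < r)%N) alpha 0 i.
Proof.
have sb i : \sum_(l < n | (l < r)%N) (basis_vec i : 'rV[R]_n) 0 l = (i < r)%N%:R.
  under eq_bigr do rewrite basis_vecE.
  rewrite big_mkcond (bigD1 i) //= eqxx big1 ?addr0; first by case: ifP.
  by move=> l /negPf ->; case: ifP.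
move=> /bc_rootP[[i ->]|[i ->]|[i [j [ij ->]]]|[i [j [ij ->]]]].
- by rewrite sb.
- by under eq_bigr do rewrite mxE; rewrite -mulr_sumr sb mulr_ge0.
- by under eq_bigr do rewrite mxE; rewrite big_split /= !sb addr_ge0.
- under eq_bigr do rewrite mxE [X in _ + X]mxE; rewrite sumrB !sb subr_ge0 ler_nat.
  by case: (ltnP j r) => // jr; rewrite (ltn_trans ij jr).
Qed.

Lemma a_root_bc_root alpha : alpha \in a_positive_roots -> alpha \in bc_positive_roots.
Proof. by move=> /a_rootP[i [j [ij ->]]]; exact: bc_root_mem_diff. Qed.

Lemma coroot_diff i j v : i != j -> dot v (coroot (basis_vec i - basis_vec j)) = v 0 i - v 0 j.
Proof.
move=> ij; rewrite /coroot dotZr (dotC v) !(dotDl, dotDr, dotNl, dotNr, dot_basis2, dot_basis).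
by rewrite !eqxx (negPf ij) eq_sym (negPf ij) mulr1n mulr0n; field.
Qed.

Lemma coroot_long i v : dot v (coroot (2 *: basis_vec i)) = v 0 i.
Proof.
rewrite /coroot dotZr (dotC v) !(dotZl, dotZr, dot_basis2, dot_basis) eqxx mulr1n.
by field.
Qed.

Lemma weight_lt_partial_sum (mu lam : 'rV[R]_n) Rp (r : nat) :
  (forall alpha, alpha \in Rp -> alpha \in bc_positive_roots) -> weight_lt Rp mu lam ->
  \sum_(i < n | (i < r)%N) mu 0 i <= \sum_(i < n | (i < r)%N) lam 0 i.
Proof.
move=> RB [_ [s sR E]]; rewrite -subr_ge0 -sumrB.
have -> : \sum_(i < n | (i < r)%N) (lam 0 i - mu 0 i)
    = \sum_(alpha <- s) \sum_(i < n | (i < r)%N) alpha 0 i.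
  rewrite exchange_big; apply: eq_bigr => i _.
  by have := congr1 (fun v : 'rV[R]_n => v 0 i) E; rewrite !mxE summxE.
by rewrite big_seq sumr_ge0 // => alpha /sR/RB; exact: bc_root_partial_sum.
Qed.

End Reflections.

(** * Expansion of Jacobi polynomials in monomials *)

Section RealJacobi.
Variables (R : realType) (n : nat).
Implicit Types (v w t mu : 'rV[R]_n) (i j : 'I_n).

Definition real_jacobi (a : set 'rV[R]_n) (Rp : seq 'rV[R]_n) (k : 'rV[R]_n -> R)
    (lam : 'rV[R]_n) (u : R) (f : 'rV[R]_n -> R) : Prop :=
  (exists c : 'rV[R]_n -> R, forall t, a t ->
     f t = u * orbit_sum Rp lam t
           + \sum_(mu \in dominant_weight a Rp `&` [set mu | weight_lt Rp mu lam])
               c mu * orbit_sum Rp mu t)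
  /\
  (exists2 b, orthonormal_basis a b &
     forall t, a t -> (forall alpha, alpha \in Rp -> dot alpha t != 0) ->
       real_jacobi_operator b Rp k f t = dot lam (lam + 2 *: rho Rp k) * f t).

(** Finiteness is required because a sum over a set defaults to 0 on an infinite support, so that
    taking real parts termwise could change its value. *)
Lemma is_jacobi_parts a Rp k lam (P : 'rV[R]_n -> R[i]) :
  finite_set (dominant_weight a Rp `&` [set mu | weight_lt Rp mu lam]) ->
  is_jacobi a Rp k lam P ->
  real_jacobi a Rp k lam 1 (fun t => complex.Re (P t)) /\
  real_jacobi a Rp k lam 0 (fun t => complex.Im (P t)).
Proof.
move=> fin [[c Pc] [b bo Pb]]; split; split.
- exists (fun mu => complex.Re (c mu)) => t at_; rewrite Pc // ReD mul1r; congr (_ + _).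
  rewrite !fsbig_finite // Re_sum; apply: eq_bigr => mu _.
  by rewrite mulrC Re_realM mulrC.
- by exists b => // t at_ reg; rewrite -Re_jacobi_operator Pb // Re_realM.
- exists (fun mu => complex.Im (c mu)) => t at_; rewrite Pc // ImD mul0r; congr (_ + _).
  rewrite !fsbig_finite // Im_sum; apply: eq_bigr => mu _.
  by rewrite mulrC Im_realM mulrC.
- by exists b => // t at_ reg; rewrite -Im_jacobi_operator Pb // Im_realM.
Qed.

Definition partial_sums_le (m lam : 'I_n -> nat) : Prop :=
  forall r : nat, (\sum_(i < n | (i < r)%N) m i <= \sum_(i < n | (i < r)%N) lam i)%N.

Lemma partial_sums_le_weight (m lam : 'I_n -> nat) :
  partial_sums_le m lam -> (weight m <= weight lam)%N.
Proof.
move=> /(_ n); rewrite (eq_bigl xpredT) => [|i]; last exact: ltn_ord.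
by rewrite [X in (_ <= X)%N](eq_bigl xpredT) => [//|i]; exact: ltn_ord.
Qed.

Definition top_multi (lam : 'I_n -> nat) : multi n (weight lam) :=
  [ffun i => inord (lam i)].

Lemma top_multiE lam i : (top_multi lam i : nat) = lam i.
Proof. by rewrite ffunE inordK // ltnS le_weight. Qed.

Lemma weight_vecE (m : 'I_n -> nat) i : (weight_vec m : 'rV[R]_n) 0 i = (m i)%:R.
Proof. by rewrite mxE. Qed.

Lemma weight_vec_inj D : injective (fun m : multi n D => weight_vec (fun i => m i : nat) : 'rV[R]_n).
Proof.
move=> m1 m2 /rowP E; apply/ffunP => i; apply/val_inj/eqP.
by have := E i; rewrite !weight_vecE => /eqP; rewrite eqr_nat.
Qed.

Lemma weight_vec_top lam : weight_vec (fun i => top_multi lam i : nat) = weight_vec lam :> 'rV[R]_n.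
Proof. by apply/rowP => i; rewrite !weight_vecE top_multiE. Qed.

(* A finite parametrization [phi] of the dominant weights below [lam]. *)
Lemma real_jacobi_sum a Rp k (lam : 'I_n -> nat) (Lam : 'rV[R]_n) u f
    (phi : multi n (weight lam) -> 'rV[R]_n) (P : pred (multi n (weight lam))) :
  {in P &, injective phi} -> P (top_multi lam) -> phi (top_multi lam) = Lam ->
  partition_of_length lam ->
  (forall mu, (dominant_weight a Rp `&` [set mu | weight_lt Rp mu Lam]) mu ->
     exists2 m : multi n (weight lam), P m /\ phi m = mu &
       partition_of_length (fun i => m i : nat) /\ partial_sums_le (fun i => m i : nat) lam) ->
  real_jacobi a Rp k Lam u f ->
  exists e : multi n (weight lam) -> R,
    [/\ forall t, a t -> f t = \sum_m e m * orbit_sum Rp (phi m) t,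
        forall m, e m != 0 -> [/\ P m, partition_of_length (fun i => m i : nat)
                                & partial_sums_le (fun i => m i : nat) lam]
      & e (top_multi lam) = u].
Proof.
move=> phi_inj Ptop phitop plam surj [[c fc] _].
set S := dominant_weight _ _ `&` _ in surj fc.
have nS : ~ S Lam by case=> _ [].
exists (fun m => if m == top_multi lam then u else if P m && `[<S (phi m)>] then c (phi m) else 0).
split; last by rewrite eqxx.
- move=> t at_; rewrite fc // (fsum_finType _ phi_inj) => [|mu /surj[m [Pm mE] _]]; last by exists m.
  rewrite [RHS](bigD1 (top_multi lam)) //= eqxx phitop; congr (_ + _).
  rewrite big_mkcond (bigD1 (top_multi lam)) //= phitop.
  rewrite (_ : `[<S Lam>] = false) ?andbF ?add0r; last exact/asboolP.
  apply: eq_bigr => m /negPf ->; case: ifP => // _; by rewrite mul0r.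
- move=> m; case: (m =P top_multi lam) => [-> _|_].
    split=> //; first by move=> i j ij; rewrite !top_multiE plam.
    by move=> r; rewrite (eq_bigr _ (fun i _ => top_multiE lam i)).
  case: ifP => [/andP[Pm /asboolP/surj[m' [Pm' E] [pm' bm']] _]|]; last by rewrite eqxx.
  by have <- : m' = m by apply: phi_inj.
Qed.

Lemma bc_dominant_below (lam : 'I_n -> nat) mu :
  (dominant_weight [set: 'rV[R]_n] bc_positive_roots
    `&` [set mu | weight_lt bc_positive_roots mu (weight_vec lam)]) mu ->
  exists2 m : multi n (weight lam), xpredT m /\ weight_vec (fun i => m i : nat) = mu &
    partition_of_length (fun i => m i : nat) /\ partial_sums_le (fun i => m i : nat) lam.
Proof.
move=> [[_ mint mpos] /= mlt].
have nat_mu i : exists k : nat, mu 0 i = k%:R.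
  (* The coroot of 2 e_i is e_i, so integrality and dominance against the long roots make each
     coordinate a natural number. *)
  apply/natrP; rewrite natrEint -(coroot_long i) mpos ?bc_root_mem_long // andbT.
  by apply: mint; rewrite mem_cat bc_root_mem_long.
have [k kE] := choice nat_mu.
have below : partial_sums_le k lam.
  move=> r; rewrite -(ler_nat R) !natr_sum.
  have := weight_lt_partial_sum r (fun _ h => h) mlt.
  rewrite (eq_bigr _ (fun i _ => kE i)).
  by rewrite [X in _ <= X](eq_bigr _ (fun i _ => weight_vecE lam i)).
have kD i : (k i < (weight lam).+1)%N.
  by rewrite ltnS (leq_trans (le_weight k i)) // partial_sums_le_weight.
have mE : (fun i => [ffun i => Ordinal (kD i)] i : nat) = k.
  by apply/funext => i; rewrite ffunE.
exists [ffun i => Ordinal (kD i)]; rewrite mE; split=> //.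
  by apply/rowP => i; rewrite weight_vecE kE.
move=> i j; rewrite leq_eqVlt => /predU1P[/val_inj -> //|ij].
have nij : i != j by apply: contraTneq ij => ->; rewrite ltnn.
have := mpos _ (bc_root_mem_diff R ij); rewrite coroot_diff // !kE subr_ge0 ler_nat.
by [].
Qed.

End RealJacobi.

(** * Orbit sums of type BC as polynomials in the coordinates x *)

Section BCExpansion.
Variables (R : realType) (n D : nat).

(** The value z in {0, ..., 2 D} encodes the integer z - D, so the vectors with integer entries in
    [-D, D] are indexed by a finite type. *)
Definition signed_vec (z : {ffun 'I_n -> 'I_(2 * D).+1}) : 'rV[R]_n :=
  \row_i ((z i)%:R - D%:R).

Lemma signed_vec_inj : injective signed_vec.
Proof.
move=> z1 z2 /rowP E; apply/ffunP => i; apply/val_inj/eqP.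
by have := E i; rewrite !mxE => /addIr/eqP; rewrite eqr_nat.
Qed.

(** The orbit sum in rank one: 1 for k = 0 and 2 cosh(k u) for 0 < k <= D. As a filtered sum it
    gives the right count for the entry 0, which has only one sign, and its products distribute over
    signed vectors. *)
Definition cosh_sum (k : nat) (u : R) : R :=
  \sum_(j < (2 * D).+1 | `|(j%:R - D%:R : R)| == k%:R) expR ((j%:R - D%:R) * u).

Lemma cosh_sumE k u : (k <= D)%N ->
  cosh_sum k u = if k == 0%N then 1 else expR u ^+ k + expR (- u) ^+ k.
Proof.
move=> kD; rewrite /cosh_sum.
have hp : (D + k < (2 * D).+1)%N by lia.
have hm : (D - k < (2 * D).+1)%N by lia.
have pE : (Ordinal hp)%:R - D%:R = k%:R :> R by rewrite /= natrD; ring.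
have mE : (Ordinal hm)%:R - D%:R = - k%:R :> R by rewrite /= natrB //; ring.
have other (j : 'I_(2 * D).+1) : (`|(j%:R - D%:R : R)| == k%:R) = (j == Ordinal hp) || (j == Ordinal hm).
  rewrite -[k%:R in LHS]ger0_norm // eqr_norm2; congr (_ || _).
    by rewrite -pE (inj_eq (addIr _)) eqr_nat.
  by rewrite -mE (inj_eq (addIr _)) eqr_nat.
rewrite (eq_bigl _ _ other) (bigD1 (Ordinal hp)) ?eqxx //= pE.
case: eqP => [k0|/eqP k0].
  rewrite big1 ?addr0 ?k0 ?mul0r ?expR0 // => j /andP[/orP[/eqP -> | /eqP ->]]; rewrite ?eqxx //.
  by rewrite -(inj_eq val_inj) /= k0 subn0 addn0 eqxx.
rewrite (bigD1 (Ordinal hm)) /=; last first.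
  by rewrite eqxx orbT -(inj_eq val_inj) /=; lia.
rewrite mE big1 ?addr0; last first.
  by move=> j /andP[/andP[/orP[]/eqP-> h1 h2]]; rewrite ?eqxx in h1 h2.
by rewrite -!expRM_natl mulNr mulrN.
Qed.

(** Orbits are stable under sign changes, so their elements are grouped by the vector k of absolute
    values; over each group the sum of exponentials factors into coordinates. *)
Lemma bc_orbit_sum (m : multi n D) t :
  orbit_sum bc_positive_roots (weight_vec (fun i => m i : nat)) t
  = \sum_(k : multi n D) `[<weyl_orbit bc_positive_roots (weight_vec (fun i => m i : nat))
                            (weight_vec (fun i => k i : nat) : 'rV[R]_n)>]%:R
       * \prod_i cosh_sum (k i) (t 0 i).
Proof.
set O := weyl_orbit _ _; rewrite /orbit_sum.
rewrite (@fsum_finType _ _ _ signed_vec predT) => [|z1 z2 _ _|v]; first last.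
- move=> /bc_orbit_perm[s sE].
  have zi i : exists2 z : 'I_(2 * D).+1, true & z%:R - D%:R = v 0 i.
    have := sE i; rewrite weight_vecE normr_nat => /eqP.
    have := ltn_ord (m (s i)); rewrite ltnS => mD.
    have hp : (D + m (s i) < (2 * D).+1)%N by lia.
    have hm : (D - m (s i) < (2 * D).+1)%N by lia.
    rewrite eqr_norml ler0n andbT => /orP[] /eqP ->.
      by exists (Ordinal hp) => //=; rewrite natrD; ring.
    by exists (Ordinal hm) => //=; rewrite natrB //; ring.
  have [z zE] := choice (fun i => let: ex_intro2 z _ h := zi i in ex_intro _ z h).
  by exists [ffun i => z i] => //; apply/rowP => i; rewrite mxE ffunE.
- exact: signed_vec_inj.
pose ab (z : {ffun 'I_n -> 'I_(2 * D).+1}) : multi n D :=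
  [ffun i => inord (absz ((z i : nat)%:Z - D%:Z))].
have abE z i : ((ab z i)%:R : R) = `|(z i)%:R - D%:R|.
  rewrite ffunE inordK; last by have := ltn_ord (z i); lia.
  by rewrite -[RHS]/`|(z i)%:Z%:~R - D%:Z%:~R| -intrB -intr_norm -abszE.
have OE z : `[<O (signed_vec z)>] = `[<O (weight_vec (fun i => ab z i : nat))>].
  apply/asboolP/asboolP; apply: bc_orbit_abs => i; rewrite !mxE abE.
    by rewrite normr_id.
  by rewrite normr_id.
rewrite big_mkcond /= (partition_big ab predT) //=; apply: eq_bigr => k _.
rewrite (eq_bigr (fun z => `[<O (weight_vec (fun i => k i : nat))>]%:R * expR (dot (signed_vec z) t))).
  rewrite -mulr_sumr; congr (_ * _).
  rewrite /cosh_sum [RHS](bigA_distr_big_dep (fun (i : 'I_n) (j : 'I_(2 * D).+1) => `|(j%:R - D%:R : R)| == (k i)%:R)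
    (fun (i : 'I_n) (j : 'I_(2 * D).+1) => expR ((j%:R - D%:R) * t 0 i))) /=.
  apply: eq_big => z.
    apply/eqP/familyP => [<- i|H]; first by rewrite unfold_in abE.
    apply/ffunP => i; apply/val_inj/eqP; rewrite -(eqr_nat R) abE.
    exact: H.
  move=> _; rewrite /dot -expR_sum; congr (expR _).
  by apply: eq_bigr => i _; rewrite mxE.
move=> z /eqP <-; rewrite -OE; case: ifP; by rewrite ?mul1r ?mul0r.
Qed.

(** Chebyshev polynomials: 2 cosh u = 4 x + 2 - 4 g, and 2 cosh((k+2) u) = 2 cosh u 2 cosh((k+1) u)
    - 2 cosh(k u). The leading coefficients 4^k are the origin of the factor 4^|lam|. *)
Lemma cosh_sum_poly (g : R) : exists Q : nat -> {poly R}, forall k, (k <= D)%N ->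
  [/\ (size (Q k) <= k.+1)%N, (Q k)`_k = 4 ^+ k
    & forall u, cosh_sum k u = (Q k).[bc_coord g u]].
Proof.
pose T1 : {poly R} := 4%:P * 'X + (2 - 4 * g)%:P.
have T1E u : T1.[bc_coord g u] = expR u + expR (- u).
  rewrite /T1 hornerD hornerM !hornerC hornerX /bc_coord.
  by have := cosh_double u; rewrite /cosh => H; lra.
have sT1 : (size T1 <= 2)%N.
  rewrite (leq_trans (size_polyD _ _)) // geq_max (leq_trans (size_polyC_leq1 _)) // andbT.
  by rewrite mul_polyC (leq_trans (size_scale_leq _ _)) // size_polyX.
have T11 : T1`_1 = 4 by rewrite !coefE /=; ring.
(* The recurrence has order two, so consecutive indices are carried along. It starts from the
   constant 2 at k = 0, whose leading coefficient is not 4^0, hence the guard; [Q] replaces it by 1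
   there. *)
have TT : forall k,
   (exists p : {poly R}, [/\ (size p <= k.+1)%N, (0 < k)%N -> p`_k = 4 ^+ k
    & forall u, p.[bc_coord g u] = expR u ^+ k + expR (- u) ^+ k]) /\
   (exists p : {poly R}, [/\ (size p <= k.+2)%N, p`_k.+1 = 4 ^+ k.+1
    & forall u, p.[bc_coord g u] = expR u ^+ k.+1 + expR (- u) ^+ k.+1]).
  elim=> [|k [[p [sp pk pE]] [q [sq qk qE]]]].
    split; first by exists 2%:P; split=> // [|u]; rewrite ?size_polyC_leq1 // hornerC !expr0.
    by exists T1; split=> // [|u]; rewrite ?T11 ?expr1 // T1E.
  split; first by exists q; split.
  exists (T1 * q - p); split.
  - rewrite (leq_trans (size_polyD _ _)) // geq_max size_polyN (leq_trans sp) ?andbT; last by lia.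
    by rewrite (leq_trans (size_polyMleq _ _)) //; lia.
  - rewrite coefB [p`__]nth_default ?subr0; last by rewrite (leq_trans sp).
    have -> : T1 * q = (4 *: q) * 'X + (2 - 4 * g) *: q.
      by rewrite /T1 -!mul_polyC mulrDl mulrAC.
    by rewrite coefD coefMX !coefZ /= qk [q`__]nth_default // mulr0 addr0 [in RHS]exprS.
  - move=> u; rewrite hornerD hornerN hornerM pE qE T1E.
    have := expRxMexpNx_1 u; move: (expR _) (expR _) => x y xy.
    rewrite -[X in _ - (X + _)]mul1r -[X in _ - (_ + X)]mul1r -xy !exprS; ring.
have T k : exists p : {poly R}, [/\ (size p <= k.+1)%N, (0 < k)%N -> p`_k = 4 ^+ k
    & forall u, p.[bc_coord g u] = expR u ^+ k + expR (- u) ^+ k] by have [] := TT k.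
have [Q QE] := choice T.
exists (fun k => if k == 0%N then 1 else Q k) => k kD.
have [sQ Qk Qe] := QE k; case: eqP => [->|/eqP k0].
  by split=> [||u]; rewrite ?size_poly1 ?coef1 ?expr0 // cosh_sumE // hornerC.
by split=> // [|u]; rewrite ?Qk ?lt0n // cosh_sumE // (negPf k0) Qe.
Qed.

End BCExpansion.

Section Expansions.
Variables (R : realType) (n : nat).
Implicit Types (lam : 'I_n -> nat) (v w t : 'rV[R]_n).

Lemma weight_perm (k m : 'I_n -> nat) (s : 'S_n) : (forall i, k i = m (s i)) -> weight k = weight m.
Proof.
move=> km; rewrite /weight [RHS](reindex_inj (@perm_inj _ s)).
by apply: eq_bigr => i _; rewrite km.
Qed.

Lemma swapK D (a b : 'I_n) : involutive (@swap n D a b).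
Proof. by move=> m; apply/ffunP => i; rewrite !ffunE tpermK. Qed.

Lemma dominance_le_partial_sums (m lam : 'I_n -> nat) :
  weight m = weight lam -> partial_sums_le m lam -> dominance_le m lam.
Proof. by move=> wE ml; rewrite /dominance_le wE eqxx; apply/forallP => r; exact: ml. Qed.

(** Here [O m k] stands for k lying in the orbit of m, in type BC or, after projection, in type A.
    An orbit contains one partition, so for a partition k the only term of [B k] that can be nonzero
    is m = k, and the support conditions pass from [e] to [B]. *)
Lemma orbit_triangular lam (u : R) (e : multi n (weight lam) -> R)
    (O : multi n (weight lam) -> multi n (weight lam) -> Prop) :
  partition_of_length lam ->
  (forall m, e m != 0 -> partition_of_length (fun i => m i : nat) /\
                         partial_sums_le (fun i => m i : nat) lam) ->
  e (top_multi lam) = u ->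
  (forall m k, e m != 0 -> O m k -> exists s : 'S_n, forall i, (k i : nat) = m (s i)) ->
  (forall m k a b, e m != 0 -> O m k -> O m (swap a b k)) ->
  O (top_multi lam) (top_multi lam) ->
  let B k := \sum_m e m * `[<O m k>]%:R in
  (forall k, B k != 0 -> (weight (fun i => k i : nat) <= weight lam)%N) /\
  triangular u (fun k : multi n (weight lam) => if weight (fun i => k i : nat) == weight lam then B k else 0).
Proof.
move=> plam ebelow etop Operm Oswap Otop B.
have Bsupp k : B k != 0 -> exists2 m, e m != 0 & O m k.
  move=> Bk; apply: contrapT => no; case/eqP: Bk; rewrite /B big1 // => m _.
  have [->|em] := eqVneq (e m) 0; first by rewrite mul0r.
  by case: asboolP => [Omk|]; [case: no; exists m | rewrite mulr0].
have Bw k : B k != 0 -> (weight (fun i => k i : nat) <= weight lam)%N.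
  move=> /Bsupp[m em Omk]; have [s sE] := Operm _ _ em Omk.
  rewrite (@weight_perm (fun i => k i : nat) (fun i => m i : nat) s) //.
  by apply: partial_sums_le_weight; case: (ebelow _ em).
have same (m k : multi n (weight lam)) : e m != 0 -> O m k ->
    partition_of_length (fun i => k i : nat) -> m = k.
  move=> em Omk pk; have [s sE] := Operm _ _ em Omk; have [pm _] := ebelow _ em.
  by apply/ffunP => i; apply/val_inj; rewrite /= -(perm_partition_eq pm pk sE).
split=> //; split.
- by move=> k; case: ifP => [/eqP //|_]; rewrite eqxx.
- move=> a b k; rewrite (@weight_perm (fun i => swap a b k i : nat) (fun i => k i : nat) (tperm a b)); last first.
    by move=> i; rewrite ffunE.
  case: ifP => // _; apply: eq_bigr => m _.
  have [->|em] := eqVneq (e m) 0; first by rewrite !mul0r.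
  congr (_ * _%:R); congr nat_of_bool; apply/asboolP/asboolP; last exact: Oswap.
  by rewrite -{2}(swapK a b k); exact: Oswap.
- move=> k; case: ifP => [/eqP wk /Bsupp[m em Omk] pk|_]; last by rewrite eqxx.
  apply: dominance_le_partial_sums => //.
  by have <- := same _ _ em Omk pk; case: (ebelow _ em).
- move=> k kE; have -> : k = top_multi lam.
    by apply/ffunP => i; apply/val_inj; rewrite /= kE top_multiE.
  rewrite (_ : weight (fun i => top_multi lam i : nat) = weight lam) ?eqxx; last first.
    by apply: eq_bigr => i _; rewrite top_multiE.
  rewrite /B (bigD1 (top_multi lam)) //= etop; case: asboolP => // _; rewrite mulr1.
  rewrite big1 ?addr0 // => m mtop; have [->|em] := eqVneq (e m) 0; first by rewrite mul0r.
  case: asboolP => [Om|]; last by rewrite mulr0.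
  case/eqP: mtop; apply: same => //.
  by move=> i j ij; rewrite !top_multiE plam.
Qed.

Lemma weight_vec_swap D (a b : 'I_n) (k : multi n D) :
  weight_vec (fun i => swap a b k i : nat) = \row_l weight_vec (fun i => k i : nat) 0 (tperm a b l) :> 'rV[R]_n.
Proof. by apply/rowP => l; rewrite !mxE ffunE. Qed.

(** Replacing each factor by its polynomial in x_i only lowers exponents, componentwise. An exponent
    m of top weight therefore arises from k = m alone, through the product of leading coefficients,
    which is 4^|lam|. *)
Lemma bc_expansion lam (u g : R) k f : partition_of_length lam ->
  real_jacobi [set: 'rV[R]_n] bc_positive_roots k (weight_vec lam) u f ->
  exists c : multi n (weight lam) -> R,
    [/\ forall t, f t = expansion (bc_coord g) c t,
        forall m : multi n _, (weight lam < weight (fun i => m i : nat))%N -> c m = 0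
      & triangular u (fun m : multi n (weight lam) =>
          if weight (fun i => m i : nat) == weight lam then c m / 4 ^+ weight lam else 0)].
Proof.
move=> plam fJ; set D := weight lam.
have inj : {in predT &, injective (fun m : multi n D => weight_vec (fun i => m i : nat) : 'rV[R]_n)}.
  by move=> m1 m2 _ _; exact: weight_vec_inj.
have [e [fE esupp etop]] := real_jacobi_sum inj isT (weight_vec_top R lam) plam
  (@bc_dominant_below R n lam) fJ.
pose O (m k : multi n D) := weyl_orbit bc_positive_roots (weight_vec (fun i => m i : nat))
   (weight_vec (fun i => k i : nat) : 'rV[R]_n).
have [||||Bw Btri] := @orbit_triangular lam u e O plam _ etop.
- by move=> m /esupp[].
- move=> m k' em /bc_orbit_perm[s sE]; exists s => i.
  by have := sE i; rewrite !weight_vecE !normr_nat => /eqP; rewrite eqr_nat => /eqP.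
- move=> m k' a b _ Ok; rewrite /O weight_vec_swap.
  exact: weyl_orbit_tperm (@bc_root_mem_diff R n) Ok.
- exact: weyl_orbit_refl.
pose B (k' : multi n D) := \sum_m e m * `[<O m k'>]%:R.
rewrite -/B in Bw Btri.
have [Q QE] := cosh_sum_poly D g.
have kD (k' : multi n D) i : (k' i <= D)%N by rewrite -ltnS.
pose c (m : multi n D) := \sum_k' B k' * \prod_i (Q (k' i))`_(m i).
have Qm (k' m : multi n D) : \prod_i (Q (k' i))`_(m i) != 0 -> forall i, (m i <= k' i)%N.
  move=> /prodf_neq0 H i; have := H i isT; apply: contraNT; rewrite -ltnNge => km.
  have [sQ _ _] := QE _ (kD k' i); rewrite nth_default //; exact: leq_trans sQ km.
have le_w (k' m : multi n D) : (forall i, (m i <= k' i)%N) ->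
    (weight (fun i => m i : nat) <= weight (fun i => k' i : nat))%N.
  by move=> H; apply: leq_sum.
exists c; split.
- move=> t; rewrite fE //.
  under eq_bigr do rewrite bc_orbit_sum mulr_sumr.
  rewrite exchange_big /= /expansion /c.
  under [RHS]eq_bigr do rewrite mulr_suml.
  rewrite [RHS]exchange_big; apply: eq_bigr => k' _ /=.
  under eq_bigr do rewrite mulrA.
  rewrite -mulr_suml; under [RHS]eq_bigr do rewrite -mulrA.
  rewrite -mulr_sumr; congr (_ * _).
  transitivity (\prod_i \sum_(j < D.+1) (Q (k' i))`_j * bc_coord g (t 0 i) ^+ j).
    apply: eq_bigr => i _; have [sQ _ ->] := QE _ (kD k' i).
    by rewrite (@horner_coef_wide _ D.+1) // (leq_trans sQ).
  rewrite bigA_distr_bigA; apply: eq_bigr => m _.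
  by rewrite /mono -big_split.
- move=> m mD; rewrite /c big1 // => k' _; apply/eqP; rewrite mulf_eq0.
  apply: contraTT mD => /norP[/Bw Bk /Qm/le_w mk]; rewrite -leqNgt.
  exact: leq_trans mk Bk.
have -> : (fun m : multi n D => if weight (fun i => m i : nat) == D then c m / 4 ^+ D else 0)
    = (fun m : multi n D => if weight (fun i => m i : nat) == D then B m else 0); last exact: Btri.
apply/funext => m; case: eqP => // wm.
rewrite /c (bigD1 m) //= [X in _ + X]big1 ?addr0.
  have -> : \prod_i (Q (m i))`_(m i) = 4 ^+ D.
    transitivity (4 ^+ weight (fun i => m i : nat) : R); last by rewrite wm.
    rewrite /weight expr_sum; apply: eq_bigr => i _.
    by have [_ -> _] := QE _ (kD m i).
  by rewrite mulfK // expf_neq0 // pnatr_eq0.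
move=> k' k'm; apply/eqP; rewrite mulf_eq0; apply: contraNT k'm => /norP[/Bw Bk /Qm mk].
have wE : weight (fun i => k' i : nat) = weight (fun i => m i : nat).
  by apply/eqP; rewrite eqn_leq; apply/andP; split; [rewrite wm | exact: le_w].
apply/eqP/ffunP => i; apply/val_inj/eqP; rewrite /= eqn_leq mk andbT leqNgt.
apply/negP => lt; move: wE; rewrite /weight (bigD1 i) //= [RHS](bigD1 i) //= => E.
have le : (\sum_(j < n | j != i) m j <= \sum_(j < n | j != i) k' j)%N by apply: leq_sum => j _; exact: mk.
by have := leq_add lt le; rewrite E addSn ltnn.
Qed.

End Expansions.

(** * The eigenvalue equation in type BC *)

Section JackUniqueness.
Variables (R : realType) (n : nat).
Implicit Types (lam : 'I_n -> nat).

Lemma triangularB lam (u : R) r s : triangular u r -> triangular u s ->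
  triangular 0 (fun m : multi n (weight lam) => r m - s m).
Proof.
move=> [rw rs rd rt] [sw ss sd st].
have either m : r m - s m != 0 -> r m != 0 \/ s m != 0.
  by have [->|] := eqVneq (r m) 0; [rewrite sub0r oppr_eq0; right | left].
split.
- by move=> m /either[/rw|/sw].
- by move=> a b m; rewrite rs ss.
- by move=> m /either[/rd|/sd].
- by move=> m mE; rewrite rt // st // subrr.
Qed.

Definition jack_equation (kappa : R) lam (r : multi n (weight lam) -> R) : Prop :=
  forall x : 'I_n -> R, (forall i, 1 < x i) -> injective x ->
    \sum_m r m * (mono x (fun i => m i : nat)
                  * jack_symbol kappa lam (fun i => m i : nat) x) = 0.

Lemma triangular_unique kappa lam (u : R) (r s : multi n (weight lam) -> R) :
  0 <= kappa -> triangular u r -> triangular u s ->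
  jack_equation kappa r -> jack_equation kappa s -> r = s.
Proof.
move=> k0 tr ts er es; apply/funext => m; apply/eqP; rewrite -subr_eq0; apply/eqP.
apply: (triangular_eq0 k0 (triangularB tr ts)) => x x1 xi.
under eq_bigr do rewrite mulrBl.
by rewrite sumrB er // es // subrr.
Qed.

Lemma jack_factor_scale (kappa S : R) (m : 'I_n -> nat) (x : 'I_n -> R) i : S != 0 ->
  jack_factor kappa m (fun j => x j * S) i = jack_factor kappa m x i.
Proof.
move=> S0; rewrite /jack_factor; congr (_ + _ * (_ * _)); apply: eq_bigr => j _.
by rewrite -mulrBl invfM mulrACA divff // mulr1.
Qed.

Lemma mono_scale (S : R) (m : 'I_n -> nat) (x : 'I_n -> R) :
  mono (fun j => x j * S) m = mono x m * S ^+ weight m.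
Proof.
by rewrite /mono /weight expr_sum -big_split; apply: eq_bigr => i _; rewrite exprMn.
Qed.

Definition jacobi_equation (kappa : R) lam (K g : R) (c : multi n (weight lam) -> R) : Prop :=
  forall x : 'I_n -> R, (forall i, 1 < x i) -> injective x ->
    \sum_m c m * (mono x (fun i => m i : nat)
       * (K * ((weight (fun i => m i : nat))%:R - (weight lam)%:R)
          + jacobi_symbol kappa lam g (fun i => m i : nat) x)) = 0.

(* Evaluate at x / S, multiply by S ^ D and let S -> 0. *)
Lemma jacobi_equation_top kappa lam (K g : R) (c : multi n (weight lam) -> R) :
  (forall m : multi n _, (weight lam < weight (fun i => m i : nat))%N -> c m = 0) ->
  jacobi_equation kappa K g c ->
  jack_equation kappa (fun m : multi n (weight lam) =>
    if weight (fun i => m i : nat) == weight lam then c m else 0).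
Proof.
set D := weight lam => cbig ceq x x1 xinj.
pose wt (m : multi n D) := weight (fun i => m i : nat).
(* The symbol at x / S: [jack_factor] is homogeneous of degree 0, so only the negative powers of x_i
   acquire factors S. *)
pose sym (m : multi n D) (S : R) :=
  \sum_i ((1 + (1 - 2 * g) / x i * S - g * (1 - g) / x i ^+ 2 * S ^+ 2)
            * jack_factor kappa (fun i => m i : nat) x i
          + (m i)%:R * (1 + (2^-1 - g) / x i * S)) - (D%:R + jack_eigenvalue kappa lam).
pose F S := \sum_m c m * (S ^+ (D - wt m) * (mono x (fun i => m i : nat)
   * (K * ((wt m)%:R - D%:R) + sym m S))).
have Sn : S @[S --> (0 : R)] --> (0 : R) by exact: cvg_id.
have S2 : S ^+ 2 @[S --> (0 : R)] --> (0 : R) by exact: (@cvg_exp0 R 2).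
pose sym0 (m : multi n D) := \sum_i ((1 + (1 - 2 * g) / x i * 0 - g * (1 - g) / x i ^+ 2 * 0)
            * jack_factor kappa (fun i => m i : nat) x i
          + (m i)%:R * (1 + (2^-1 - g) / x i * 0)) - (D%:R + jack_eigenvalue kappa lam).
have symc m : sym m S @[S --> (0 : R)] --> sym0 m.
  apply: cvgB; last exact: cvg_cst.
  apply: cvg_bigsum => i _; apply: cvgD.
    apply: cvgM; last exact: cvg_cst.
    apply: cvgB; last by apply: cvgM; [exact: cvg_cst|].
    by apply: cvgD; [exact: cvg_cst|apply: cvgM => //; exact: cvg_cst].
  apply: cvgM; first exact: cvg_cst.
  by apply: cvgD; [exact: cvg_cst|apply: cvgM => //; exact: cvg_cst].
have Fc : F S @[S --> (0 : R)] --> \sum_m c m * ((D - wt m == 0)%N%:R * (mono x (fun i => m i : nat)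
   * (K * ((wt m)%:R - D%:R) + sym0 m))).
  apply: cvg_bigsum => m _; apply: cvgM; first exact: cvg_cst.
  apply: cvgM; first exact: cvg_exp0.
  apply: cvgM; first exact: cvg_cst.
  by apply: cvgD; [exact: cvg_cst|].
have F0 S : 0 < S -> S < 1 -> F S = 0.
  move=> S0 S1; have Sn0 : S != 0 by rewrite gt_eqF.
  pose y i := x i * S^-1.
  have y1 i : 1 < y i.
    by rewrite /y ltr_pdivlMr // mul1r (lt_trans S1).
  have yinj : injective y by move=> i j /(mulIf (invr_neq0 Sn0))/xinj.
  have := ceq y y1 yinj => /(congr1 ( *%R (S ^+ D))); rewrite mulr0 => <-.
  rewrite mulr_sumr; apply: eq_bigr => m _.
  case: (ltnP D (wt m)) => [/cbig ->|mD]; first by rewrite !mul0r mulr0.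
  rewrite [RHS]mulrCA; congr (_ * _).
  have Sd : S ^+ (D - wt m) = S ^+ D * S^-1 ^+ wt m.
    by rewrite exprVn expfB_cond // (negPf Sn0).
  have jE : jacobi_symbol kappa lam g (fun i => m i : nat) y = sym m S; last first.
    by rewrite mono_scale jE Sd /wt; ring.
  rewrite /sym /jacobi_symbol; congr (_ - _); apply: eq_bigr => i _.
  have xn : x i != 0 by rewrite gt_eqF // (lt_trans ltr01).
  rewrite jack_factor_scale ?invr_eq0 //; congr (_ * _ + _ * _); rewrite /y; field; by rewrite xn Sn0.
have := cvg0_eq0 F0 Fc => E; rewrite -[RHS]E; apply: eq_bigr => m _.
rewrite /wt subn_eq0; case: ifP => [/eqP wm|/negbT wm].
  (* At top weight K is multiplied by |m| - D = 0, and the Euler terms m_i sum to D, cancelling that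
     part of the eigenvalue. *)
  rewrite wm leqnn mul1r subrr mulr0 add0r; congr (_ * (_ * _)).
  have DE : D%:R = \sum_i (m i)%:R :> R.
    by transitivity ((wt m)%:R : R); [rewrite /wt wm | exact: natr_sum].
  rewrite /sym0 /jack_symbol DE opprD addrA; congr (_ - _); rewrite -sumrB.
  apply: eq_bigr => i _; ring.
case: (leqP D (weight (fun i => m i : nat))) => [h|_]; last by rewrite !mul0r mulr0.
by rewrite cbig ?mul0r // ltn_neqAle eq_sym wm.
Qed.

End JackUniqueness.

Section BCEquation.
Variables (R : realType) (n : nat).
Implicit Types (lam : 'I_n -> nat) (t : 'rV[R]_n).

Lemma bc_eigenvalue (k1 k2 k3 : R) lam :
  dot (weight_vec lam) (weight_vec lam + 2 *: rho bc_positive_roots (bc_multiplicity k1 k2 k3)) 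
  = (k1 + 2 * k2) * (weight lam)%:R + ((weight lam)%:R + jack_eigenvalue k3 lam).
Proof.
set t := weight_vec lam.
rewrite /rho scalerA divff ?pnatr_eq0 // scale1r dotDr dotC dot_suml.
under [X in _ + X]eq_bigr do rewrite dotZl.
rewrite /bc_positive_roots !big_cat !big_map !big_enum /= -!big_enum /=.
(* In each pair e_i + e_j, e_i - e_j the terms in t_j cancel, leaving 2 k3 t_i for the smaller
   index. The indicators put this into the symmetric form expected by [sum_pairs]; index i is then
   counted n-i-1 times. *)
have -> : \sum_(ij <- enum [pred ij : 'I_n * 'I_n | (ij.1 < ij.2)%N])
     bc_multiplicity k1 k2 k3 (basis_vec ij.1 + basis_vec ij.2) * dot (basis_vec ij.1 + basis_vec ij.2) t
   + \sum_(ij <- enum [pred ij : 'I_n * 'I_n | (ij.1 < ij.2)%N])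
     bc_multiplicity k1 k2 k3 (basis_vec ij.1 - basis_vec ij.2) * dot (basis_vec ij.1 - basis_vec ij.2) t
   = \sum_(ij <- enum [pred ij : 'I_n * 'I_n | (ij.1 < ij.2)%N])
      ((ij.1 < ij.2)%N%:R * (2 * k3 * t 0 ij.1) + (ij.2 < ij.1)%N%:R * (2 * k3 * t 0 ij.2)).
  rewrite -big_split /=; apply: eq_big_seq => -[i j]; rewrite mem_enum inE /= => ij.
  have [-> ->] := bc_multiplicity_middle k1 k2 k3 ij.
  rewrite ij [(j < i)%N]ltnNge (ltnW ij) /= mulr1n mulr0n !(dotDl, dotNl) !dot_basis; ring.
rewrite (sum_pairs (fun i j => (i < j)%N%:R * (2 * k3 * t 0 i))) /dot !big_enum /=.
rewrite /weight natr_sum mulr_sumr -!big_split /=; apply: eq_bigr => i _.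
rewrite bc_multiplicity_short bc_multiplicity_long -mulr_suml.
have -> : \sum_(j < n | j != i) (i < j)%N%:R = (n - i.+1)%N%:R :> R.
  by rewrite -(sum_ltn_ord i) natr_sum [RHS](bigD1 i) //= ltnn add0r.
rewrite -!/(dot _ _) !dotZl !dot_basis !weight_vecE; ring.
Qed.

(** Since g <= 1 < x_i, the equations sinh^2(t_i/2) = x_i - g have positive solutions. Distinct x_i
    give distinct t_i, so t lies off all root hyperplanes. *)
Lemma bc_jacobi_equation (k1 k2 k3 g u : R) lam f (c : multi n (weight lam) -> R) :
  0 < g -> g <= 1 -> g * (k1 + 2 * k2) = k1 + k2 ->
  real_jacobi [set: 'rV[R]_n] bc_positive_roots (bc_multiplicity k1 k2 k3) (weight_vec lam) u f ->
  (forall t, f t = expansion (bc_coord g) c t) ->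
  jacobi_equation k3 (k1 + 2 * k2) g c.
Proof.
move=> g0 g1 gK [_ [b bo beq]] fE x x1 xinj.
have ex i : exists v : R, 0 < v /\ sinh (v / 2) ^+ 2 = x i - g.
  have [|v v0 vE] := @sinh_sqr_surj R (x i - g); last by exists v.
  by have := x1 i; lra.
have [v vP] := choice ex.
pose t : 'rV[R]_n := \row_i v i.
have tx i : bc_coord g (t 0 i) = x i.
  by rewrite mxE /bc_coord; have [_ ->] := vP i; ring.
have t0 i : 0 < t 0 i by rewrite mxE; have [] := vP i.
have tinj : injective (t 0) by move=> i j E; apply: xinj; rewrite -!tx E.
have reg alpha : alpha \in bc_positive_roots -> dot alpha t != 0.
  move=> /bc_rootP[[i ->]|[i ->]|[i [j [ij ->]]]|[i [j [ij ->]]]].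
  - by rewrite dot_basis gt_eqF.
  - by rewrite dotZl dot_basis mulf_neq0 // gt_eqF.
  - by rewrite dotDl !dot_basis gt_eqF // addr_gt0.
  - by rewrite dotDl dotNl !dot_basis subr_eq0; apply: contraTneq ij => /tinj ->; rewrite ltnn.
have := beq t I reg.
rewrite (@real_jacobi_operator_expansion R n _ _ _ _ (fun v => is_derive_bc_coord v g0)
  (fun v => is_derive_bc_log v g0) setT b _ _ f c t) //.
rewrite bc_eigenvalue fE /expansion => /eqP; rewrite -subr_eq0 mulr_sumr -sumrB => /eqP E.
rewrite -[RHS]E; apply: eq_bigr => m _; rewrite bc_symbol //.
have -> : (fun i => bc_coord g (t 0 i)) = x by apply/funext => i; rewrite tx.
rewrite big_split /= -mulr_sumr -natr_sum -/(weight (fun i => m i : nat)) /jacobi_symbol.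
under [X in _ = _ * (_ * (_ + X)) - _]eq_bigr do rewrite tx.
rewrite mulrCA; set M := mono x _; move: (\sum_(i < n) _) => Z.
ring.
Qed.

End BCEquation.

(** * Asymptotics of the coefficients for large multiplicities *)

Section BCLimit.
Variables (R : realType) (n : nat).
Implicit Types (lam : 'I_n -> nat) (t : 'rV[R]_n).

Lemma triangular_weight lam (u : R) (s : multi n (weight lam) -> R) (m : multi n (weight lam)) :
  triangular u s -> weight (fun i => m i : nat) != weight lam -> s m = 0.
Proof. by move=> [sw _ _ _]; apply: contra_neq_eq => /sw ->. Qed.

(** By uniqueness the coefficients of top weight are 4^|lam| s for every admissible k. The
    right-hand side of [lower_coef_bound] is thus a fixed number, and C can be chosen before k1, k2
    and f. *)
Lemma bc_asymptotic (k3 u : R) lam (s : multi n (weight lam) -> R) :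
  0 <= k3 -> partition_of_length lam -> triangular u s -> jack_equation k3 s ->
  exists2 C : R, 0 <= C & forall k1 k2 f, 0 <= k1 -> 0 <= k2 -> C < k1 + k2 ->
    real_jacobi [set: 'rV[R]_n] bc_positive_roots (bc_multiplicity k1 k2 k3) (weight_vec lam) u f ->
    exists2 c : multi n (weight lam) -> R, forall m, `|c m| <= C / (k1 + k2) &
      forall t, f t = expansion (bc_coord ((k1 + k2) / (k1 + 2 * k2)))
                        (fun m => 4 ^+ weight lam * s m + c m) t.
Proof.
move=> k30 plam ts es.
have [C0 C00 bound] := @lower_coef_bound R n k3 lam.
pose C1 := C0 * \sum_m `|4 ^+ weight lam * s m|.
have C10 : 0 <= C1 by rewrite mulr_ge0 // sumr_ge0.
(* C0 is the threshold above which the bound applies, C1 the value of that bound; K >= k1 + k2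
   allows both to be read in terms of k1 + k2. *)
exists (C0 + C1); first exact: addr_ge0.
move=> k1 k2 f k10 k20 kC fJ; set g := (k1 + k2) / (k1 + 2 * k2); pose K := k1 + 2 * k2.
have kK : k1 + k2 <= K by rewrite /K; lra.
have k0 : 0 < k1 + k2 by apply: le_lt_trans kC; exact: addr_ge0.
have K0 : 0 < K by exact: lt_le_trans kK.
have g0 : 0 < g by rewrite divr_gt0.
have g1 : g <= 1 by rewrite ler_pdivrMr // mul1r.
have gK : g * (k1 + 2 * k2) = k1 + k2 by rewrite mulfVK // gt_eqF.
have [c [fE cbig ctri]] := bc_expansion g plam fJ.
have ceq := bc_jacobi_equation g0 g1 gK fJ fE.
have etop := jacobi_equation_top cbig ceq.
have sE : (fun m : multi n (weight lam) =>
    if weight (fun i => m i : nat) == weight lam then c m / 4 ^+ weight lam else 0) = s.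
  apply: triangular_unique k30 ctri ts _ es => x x1 xinj.
  have := congr1 ( *%R (4 ^+ weight lam)^-1) (etop x x1 xinj); rewrite mulr0 => E.
  rewrite -[RHS]E mulr_sumr; apply: eq_bigr => m _; case: ifP => _; last by rewrite !mul0r mulr0.
  by ring.
have four : 4 ^+ weight lam != 0 :> R by rewrite expf_neq0 // pnatr_eq0.
have cs (m : multi n (weight lam)) : weight (fun i => m i : nat) = weight lam -> c m = 4 ^+ weight lam * s m.
  by move=> wm; rewrite -sE wm eqxx mulrC divfK.
have s0 (m : multi n (weight lam)) : weight (fun i => m i : nat) != weight lam -> s m = 0.
  exact: triangular_weight ts.
exists (fun m => c m - 4 ^+ weight lam * s m) => [m|t]; last first.
  by rewrite fE; apply: eq_bigr => m _; rewrite addrCA subrr addr0.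
have Cge : 0 <= (C0 + C1) / (k1 + k2) by rewrite divr_ge0 ?addr_ge0 // ltW.
case: (ssrnat.ltngtP (weight (fun i => m i : nat)) (weight lam)) => wm.
- rewrite s0 ?mulr0 ?subr0; last by rewrite neq_ltn wm.
  rewrite ler_pdivlMr // mulrC.
  apply: (@le_trans _ _ (K * `|c m|)); first exact: ler_wpM2r.
  have KC0 : C0 <= K by apply: le_trans kK; rewrite (le_trans _ (ltW kC)) // lerDl.
  apply: (le_trans (bound K g c K0 KC0 (ltW g0) g1 cbig ceq m wm)).
  apply: (@le_trans _ _ C1); last by rewrite lerDr.
  rewrite ler_wpM2l // big_mkcond ler_sum // => k _; case: ifP => [/eqP wk|_] //.
  by rewrite cs.
- by rewrite cbig // s0 ?mulr0 ?subr0 ?normr0 // neq_ltn wm orbT.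
- by rewrite cs // subrr normr0.
Qed.

(** Telescoping, one factor at a time; M >= 1 lets all partial products be bounded by the same power
    of M. *)
Lemma prod_lipschitz (I : Type) (s : seq I) (f g : I -> R) (M d : R) :
  1 <= M -> 0 <= d -> (forall i, `|f i| <= M) -> (forall i, `|g i| <= M) ->
  (forall i, `|f i - g i| <= d) ->
  `|\prod_(i <- s) g i| <= M ^+ size s /\
  `|\prod_(i <- s) f i - \prod_(i <- s) g i| <= (size s)%:R * M ^+ size s * d.
Proof.
move=> M1 d0 fM gM fg; have M0 : 0 <= M by rewrite (le_trans ler01).
elim: s => [|i s [IH1 IH2]]; first by rewrite !big_nil /= subrr normr0 normr1 expr0 !mul0r.
rewrite !big_cons /=; split; first by rewrite normrM exprS ler_pM.
move: IH1 IH2; set Q := \prod_(_ <- s) _; set P := \prod_(_ <- s) f _ => IH1 IH2.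
have -> : f i * P - g i * Q = f i * (P - Q) + (f i - g i) * Q by ring.
rewrite (le_trans (ler_normD _ _)) // !normrM.
have h1 : `|f i| * `|P - Q| <= M * ((size s)%:R * M ^+ size s * d) by exact: ler_pM.
have h2 : `|f i - g i| * `|Q| <= d * M ^+ size s by exact: ler_pM.
have h3 : d * M ^+ size s <= d * M ^+ (size s).+1.
  by rewrite ler_wpM2l // exprS ler_peMl // exprn_ge0.
apply: le_trans (lerD h1 (le_trans h2 h3)) _.
by rewrite exprS -[(size s).+1]addn1 natrD le_eqVlt; apply/orP; left; apply/eqP; ring.
Qed.

End BCLimit.

(** * Convergence *)

Section Convergence.
Variables (R : realType) (n : nat).
Implicit Types (lam : 'I_n -> nat) (t : 'rV[R]_n).

Lemma locally_uniform_cvg_parts (K : Type) (F : set_system K) {FF : Filter F}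
    (f : K -> 'rV[R]_n -> R[i]) (g : 'rV[R]_n -> R[i]) :
  (forall t0 : 'rV[R]_n, exists2 U, nbhs t0 U & forall eps : R, 0 < eps ->
     F [set k | forall t, U t -> `|complex.Re (f k t) - complex.Re (g t)| <= eps /\
                                 `|complex.Im (f k t) - complex.Im (g t)| <= eps]) ->
  locally_uniform_cvg F f g.
Proof.
move=> H t0; have [U Ut0 HU] := H t0; exists U => //.
rewrite restricted_cvgE => P /uniform_nbhs[E [entE subP]].
move: entE; rewrite -entourage_ballE => -[/= e e0 eE].
(* The radius of a ball in R[i] is itself a complex number; being positive forces it to be real. *)
have [er ei] : e = (complex.Re e)%:C%C /\ 0 < complex.Re e.
  by move: e0; case: e {eE} => x y; rewrite ltcE /= => /andP[/eqP yE x0]; rewrite yE.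
(* A quarter of the radius is ample: the squared modulus is then at most e^2 / 8, which also turns
   the weak inequalities into a strict one. *)
have /HU : 0 < complex.Re e / 2 / 2 by rewrite !divr_gt0.
rewrite /nbhs /=; apply: filterS => k hk; apply: subP => t /hk[h1 h2].
apply: eE => /=; rewrite /ball /= er normc_def ltcR.
rewrite -[ltRHS]gtr0_norm // -sqrtr_sqr ltr_sqrt ?exprn_gt0 //.
have -> : complex.Re (g t - f k t) = - (complex.Re (f k t) - complex.Re (g t)).
  by case: (g t) (f k t) => ? ? [? ?] /=; ring.
have -> : complex.Im (g t - f k t) = - (complex.Im (f k t) - complex.Im (g t)).
  by case: (g t) (f k t) => ? ? [? ?] /=; ring.
move: h1 h2 ei; rewrite !sqrrN !ler_norml.
move: (complex.Re e) (complex.Re _ - _) (complex.Im _ - _) => r p q.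
by move=> /andP[p1 p2] /andP[q1 q2] r0; nra.
Qed.

(** With y = k1 / k2 the ratio is 1 - 1 / (y + 2), which is Lipschitz with constant at most 1 on y
    >= 0 and within 1 / (y + 2) of its limit at infinity; for k2 = 0 it is exactly 1. *)
Lemma mult_limit_gamma (a : \bar R) (C eps : R) : (0%E <= a)%E -> 0 <= C -> 0 < eps ->
  mult_limit a [set k : R * R | [/\ 0 <= k.1, 0 <= k.2, C < k.1 + k.2
    & `|(k.1 + k.2) / (k.1 + 2 * k.2) - gamma_lim a| <= eps]].
Proof.
move=> a0 C0 e0; exists C.
have ratio (k1 k2 : R) : 0 < k2 -> 0 <= k1 ->
    (k1 + k2) / (k1 + 2 * k2) = 1 - (k1 / k2 + 2)^-1.
  move=> k20 k10; have h1 : k1 + 2 * k2 != 0 by rewrite gt_eqF //; lra.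
  by field; rewrite h1 gt_eqF.
case: a a0 => [r| |] // r0.
- rewrite lee_fin in r0.
  exists [set y : \bar R | exists2 x, y = x%:E & `|r - x| < eps].
    rewrite /nbhs /= /ereal_nbhs /=; exists eps => //= x /= rx.
    by exists x.
  move=> k1 k2 k10 k20 kC; rewrite /mult_ratio; case: eqP => [_ [] //|/eqP k2n] [x [<-] rx].
  split=> //=; have k2p : 0 < k2 by rewrite lt_neqAle eq_sym k2n.
  rewrite ratio // /gamma_lim.
  have y0 : 0 <= k1 / k2 by rewrite divr_ge0.
  move: (k1 / k2) y0 rx => y y0 rx.
  have h1 : r + 2 != 0 by rewrite gt_eqF //; lra.
  have h2 : y + 2 != 0 by rewrite gt_eqF //; lra.
  have -> : 1 - (y + 2)^-1 - (r + 1) / (r + 2) = (y - r) / ((y + 2) * (r + 2)).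
    by field; rewrite h1 h2.
  rewrite normrM normfV ler_pdivrMr ?normr_gt0 ?mulf_neq0 //.
  rewrite distrC in rx; rewrite (le_trans (ltW rx)) // ler_peMr ?(ltW e0) //.
  rewrite ger0_norm ?mulr_ge0 //; nra.
- exists [set y : \bar R | (eps^-1)%:E < y]%E.
    by exists eps^-1; split => //; exact: num_real.
  move=> k1 k2 k10 k20 kC; rewrite /mult_ratio /= => hy; split=> //=.
  have k0 : 0 < k1 + k2 by exact: le_lt_trans kC.
  move: hy; case: eqP => [k2z _|/eqP k2n]; rewrite /gamma_lim.
    by rewrite k2z mulr0 !addr0 divff ?subrr ?normr0 ?ltW // gt_eqF //; move: k0; rewrite k2z addr0.
  have k2p : 0 < k2 by rewrite lt_neqAle eq_sym k2n.
  rewrite lte_fin ratio // => hy.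
  have y0 : 0 <= k1 / k2 by rewrite divr_ge0.
  have -> : 1 - (k1 / k2 + 2)^-1 - 1 = - (k1 / k2 + 2)^-1 by ring.
  rewrite normrN normfV ger0_norm; last by lra.
  rewrite invf_ple ?posrE //; last by lra.
  by rewrite (le_trans (ltW hy)) // lerDl.
Qed.

Lemma mono_lipschitz D (m : multi n D) (x y : 'I_n -> R) (M d : R) : 1 <= M -> 0 <= d ->
  (forall i, `|x i| <= M) -> (forall i, `|y i| <= M) -> (forall i, `|x i - y i| <= d) ->
  `|mono y (fun i => m i : nat)| <= (M ^+ D) ^+ n /\
  `|mono x (fun i => m i : nat) - mono y (fun i => m i : nat)|
     <= n%:R * (M ^+ D) ^+ n * (D%:R * M ^+ D * d).
Proof.
move=> M1 d0 xM yM xy.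
have M0 : 0 <= M by rewrite (le_trans ler01).
have pow (k : 'I_D.+1) (p q : R) : `|p| <= M -> `|q| <= M -> `|p - q| <= d ->
    `|q ^+ k| <= M ^+ D /\ `|p ^+ k - q ^+ k| <= D%:R * M ^+ D * d.
  move=> pM qM pq.
  have := @prod_lipschitz R nat (nseq k 0%N) (fun=> p) (fun=> q) M d M1 d0 (fun=> pM) (fun=> qM) (fun=> pq).
  rewrite !big_nseq !iter_mulr_1 size_nseq => -[h1 h2].
  have kD : (k <= D)%N by rewrite -ltnS.
  have MkD : M ^+ k <= M ^+ D by exact: ler_weXn2l.
  split; first exact: le_trans MkD.
  apply: (le_trans h2); rewrite ler_wpM2r // ler_pM // ?exprn_ge0 // ler_nat //.
have := @prod_lipschitz R 'I_n (enum 'I_n) (fun i => x i ^+ m i) (fun i => y i ^+ m i)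
  (M ^+ D) (D%:R * M ^+ D * d).
rewrite !big_enum /= size_enum_ord; apply.
- exact: exprn_ege1.
- by rewrite !mulr_ge0 // exprn_ge0.
- by move=> i; have [] := pow (m i) (y i) (x i) (yM i) (xM i); rewrite // distrC.
- by move=> i; have [] := pow (m i) (x i) (y i) (xM i) (yM i).
- by move=> i; have [] := pow (m i) (x i) (y i) (xM i) (yM i).
Qed.

Lemma sinh_sqr_le (v : R) : sinh (v / 2) ^+ 2 <= expR `|v|.
Proof.
have := cosh_double v; rewrite /cosh.
have h1 : expR v <= expR `|v| by rewrite ler_expR ler_norm.
have h2 : expR (- v) <= expR `|v| by rewrite ler_expR -normrN ler_norm.
by have h3 := expR_ge0 `|v|; move=> E; lra.
Qed.

(** Two errors are added: the lower coefficients, of order 1 / (k1 + k2), and the shift of the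
    coordinates from g to [gam], controlled by the Lipschitz bound for monomials on a bounded
    set. *)
Lemma bc_locally_uniform (k3 u gam : R) lam (s : multi n (weight lam) -> R) (t0 : 'rV[R]_n) :
  0 <= k3 -> partition_of_length lam -> triangular u s -> jack_equation k3 s ->
  0 <= gam -> gam <= 1 ->
  exists C L : R, [/\ 0 <= C, 0 <= L & forall k1 k2 f t,
    0 <= k1 -> 0 <= k2 -> C < k1 + k2 -> (forall i, `|t 0 i| <= `|t0 0 i| + 1) ->
    real_jacobi [set: 'rV[R]_n] bc_positive_roots (bc_multiplicity k1 k2 k3) (weight_vec lam) u f ->
    `|f t - 4 ^+ weight lam * expansion (bc_coord gam) s t|
      <= L * (`|(k1 + k2) / (k1 + 2 * k2) - gam| + (k1 + k2)^-1)].
Proof.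
move=> k30 plam ts es g0 g1.
have [C C0 HC] := bc_asymptotic k30 plam ts es.
set D := weight lam.
(* The 1 bounds the centre, g or [gam], and the exponentials bound sinh^2(t_i/2) on the
   neighbourhood; summing over all i gives one constant for every coordinate. *)
pose M : R := 1 + \sum_i expR (`|t0 0 i| + 1).
have M1 : 1 <= M by rewrite lerDl sumr_ge0 // => i _; exact: expR_ge0.
have M0 : 0 <= M by rewrite (le_trans ler01).
pose B1 := (M ^+ D) ^+ n.
pose B2 := n%:R * B1 * (D%:R * M ^+ D).
have B10 : 0 <= B1 by rewrite !exprn_ge0.
have B20 : 0 <= B2 by rewrite !mulr_ge0 // exprn_ge0.
pose A1 := \sum_(m : multi n D) `|4 ^+ D * s m| * B2.
pose A2 := \sum_(m : multi n D) C * B1.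
have A10 : 0 <= A1 by rewrite sumr_ge0 // => m _; rewrite mulr_ge0.
have A20 : 0 <= A2 by rewrite sumr_ge0 // => m _; rewrite mulr_ge0.
exists C, (A1 + A2); split=> //; first exact: addr_ge0.
move=> k1 k2 f t k10 k20 kC tU fJ.
have [c cC fE] := HC k1 k2 f k10 k20 kC fJ.
set g := (k1 + k2) / (k1 + 2 * k2) in fE *.
have kp : 0 < k1 + k2 by exact: le_lt_trans kC.
have g'0 : 0 <= g by rewrite divr_ge0 ?addr_ge0 ?mulr_ge0.
have g'1 : g <= 1 by rewrite ler_pdivrMr ?mul1r; lra.
have xM e i : 0 <= e -> e <= 1 -> `|bc_coord e (t 0 i)| <= M.
  move=> e0 e1; rewrite /bc_coord ger0_norm ?addr_ge0 ?sqr_ge0 // lerD //.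
  rewrite (le_trans (sinh_sqr_le _)) // (bigD1 i) //= -[leLHS]addr0 lerD ?ler_expR ?tU //.
  by rewrite sumr_ge0 // => j _; exact: expR_ge0.
have xd i : `|bc_coord g (t 0 i) - bc_coord gam (t 0 i)| <= `|g - gam|.
  by rewrite /bc_coord opprD addrACA subrr addr0.
have lip (m : multi n D) := mono_lipschitz m M1 (normr_ge0 (g - gam)) (fun i => xM g i g'0 g'1)
  (fun i => xM gam i g0 g1) xd.
have bnd (m : multi n D) : `|mono (fun i => bc_coord g (t 0 i)) (fun i => m i : nat)| <= B1.
  have h0 : (0 : R) <= 0 by [].
  have [] // := @mono_lipschitz D m (fun i => bc_coord g (t 0 i)) (fun i => bc_coord g (t 0 i)) M 0 M1 h0.
  - by move=> i; exact: xM.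
  - by move=> i; exact: xM.
  - by move=> i; rewrite subrr normr0.
rewrite fE /expansion mulr_sumr -sumrB (le_trans (ler_norm_sum _ _ _)) //.
apply: (@le_trans _ _ (\sum_(m : multi n D) (`|4 ^+ D * s m| * B2 * `|g - gam| + C * B1 / (k1 + k2)))).
  apply: ler_sum => m _.
  set x := mono _ _; set y := mono _ _.
  have -> : (4 ^+ D * s m + c m) * x - 4 ^+ D * (s m * y) = 4 ^+ D * s m * (x - y) + c m * x by ring.
  rewrite (le_trans (ler_normD _ _)) // lerD // normrM.
    rewrite -mulrA ler_wpM2l //; have [_] := lip m; rewrite /B2 /B1 => h; apply: (le_trans h).
    by rewrite !mulrA.
  by rewrite mulrAC; apply: ler_pM => //; exact: bnd.
rewrite big_split /= -[X in X + _]mulr_suml -[X in _ + X]mulr_suml -/A1 -/A2 mulrDl !mulrDr.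
have ki : 0 <= (k1 + k2)^-1 by rewrite invr_ge0 ltW.
have := mulr_ge0 A10 ki; have := mulr_ge0 A20 (normr_ge0 (g - gam)); lra.
Qed.

Lemma gamma_lim_bounds (a : \bar R) : (0%E <= a)%E -> 0 <= gamma_lim a /\ gamma_lim a <= 1.
Proof.
case: a => [r| |] // r0; rewrite /gamma_lim //; rewrite lee_fin in r0.
by rewrite divr_ge0 ?ler_pdivrMr; lra.
Qed.

End Convergence.

(** * Type A *)

Section TypeA.
Variables (R : realType) (n : nat).
Hypothesis n_gt0 : (0 < n)%N.
Implicit Types (lam : 'I_n -> nat) (v t : 'rV[R]_n).

Lemma pi_projE t i : pi_proj t 0 i = t 0 i - n%:R^-1 * \sum_j t 0 j.
Proof.
rewrite /pi_proj !mxE mulr1; congr (_ - _ * _); apply: eq_bigr => j _.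
by rewrite mxE mulr1.
Qed.

Lemma pi_proj_sum_zero t : sum_zero_space (pi_proj t).
Proof.
rewrite /sum_zero_space /=; under eq_bigr do rewrite pi_projE.
rewrite sumrB sumr_const card_ord -[X in _ - X]mulr_natl mulrA divff ?mul1r ?subrr //.
by rewrite pnatr_eq0 -lt0n.
Qed.

Lemma pi_proj_weight D (m : 'I_n -> nat) i : weight m = D ->
  pi_proj (weight_vec m : 'rV[R]_n) 0 i = (m i)%:R - n%:R^-1 * D%:R.
Proof.
move=> <-; rewrite pi_projE weight_vecE natr_sum; congr (_ - _ * _).
by apply: eq_bigr => j _; rewrite weight_vecE.
Qed.

Lemma pi_proj_weight_inj D : {in [pred m : multi n D | weight (fun i => m i : nat) == D] &,
  injective (fun m : multi n D => pi_proj (weight_vec (fun i => m i : nat)) : 'rV[R]_n)}.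
Proof.
move=> m1 m2; rewrite !inE => /eqP w1 /eqP w2 /rowP E; apply/ffunP => i; apply/val_inj/eqP.
have := E i; rewrite (pi_proj_weight i w1) (pi_proj_weight i w2) => /addIr/eqP.
by rewrite eqr_nat.
Qed.

Lemma a_root_sum_zero v : v \in a_positive_roots -> sum_zero_space v.
Proof.
move=> /a_rootP[i [j [_ ->]]]; rewrite /sum_zero_space /=.
have sb k : \sum_l (basis_vec k : 'rV[R]_n) 0 l = 1.
  under eq_bigr do rewrite basis_vecE.
  by rewrite (bigD1 k) //= eqxx big1 ?addr0 // => l /negPf ->.
by under eq_bigr do rewrite mxE [X in _ + X]mxE; rewrite sumrB !sb subrr.
Qed.

(** The lift of mu to an exponent adds back |lam| / n to each coordinate. It differs from [lam] by a
    sum of roots, hence is integral with total |lam|. Comparing the sums of the first n - 1 entries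
    shows that its last entry is at least that of [lam], so by monotonicity all entries are
    nonnegative. *)
Lemma a_dominant_below lam mu : partition_of_length lam ->
  (dominant_weight (sum_zero_space : set 'rV[R]_n) a_positive_roots
    `&` [set mu | weight_lt a_positive_roots mu (pi_proj (weight_vec lam))]) mu ->
  exists2 m : multi n (weight lam),
    weight (fun i => m i : nat) == weight lam /\ pi_proj (weight_vec (fun i => m i : nat)) = mu &
    partition_of_length (fun i => m i : nat) /\ partial_sums_le (fun i => m i : nat) lam.
Proof.
move=> plam [[mu0 _ mpos] /= mlt].
have [_ [s sR sE]] := mlt.
pose c : R := n%:R^-1 * (weight lam)%:R.
have nz : (n%:R : R) != 0 by rewrite pnatr_eq0 -lt0n.
have lE i : pi_proj (weight_vec lam : 'rV[R]_n) 0 i = (lam i)%:R - c by exact: pi_proj_weight.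
have muE i : mu 0 i + c = (lam i)%:R - \sum_(alpha <- s) alpha 0 i.
  have := congr1 (fun v : 'rV[R]_n => v 0 i) sE; rewrite mxE [X in _ + X]mxE lE summxE => <-.
  ring.
have dec (i j : 'I_n) : (i <= j)%N -> mu 0 j <= mu 0 i.
  rewrite leq_eqVlt => /predU1P[/val_inj -> //|ij].
  have nij : i != j by apply: contraTneq ij => ->; rewrite ltnn.
  by have := mpos _ (a_root_mem R ij); rewrite coroot_diff // subr_ge0.
have below (r : nat) : \sum_(i < n | (i < r)%N) (mu 0 i + c) <= \sum_(i < n | (i < r)%N) (lam i)%:R.
  have := weight_lt_partial_sum r (@a_root_bc_root R n) mlt.
  rewrite (eq_bigr _ (fun i _ => lE i)) sumrB big_split /=.
  by lra.
have total : \sum_i (mu 0 i + c) = \sum_(i < n) (lam i)%:R.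
  rewrite big_split /= [X in X + _]mu0 add0r sumr_const card_ord -[LHS]mulr_natl /c mulrA divff // mul1r.
  by rewrite natr_sum.
have ln : (n.-1 < n)%N by rewrite prednK.
have last_lt (i : 'I_n) : (i != Ordinal ln) = (i < n.-1)%N.
  rewrite -(inj_eq val_inj) /= neq_ltn; case: (ltnP i n.-1) => //= h.
  by apply/negbTE; rewrite -leqNgt -ltnS prednK.
have split_last (F : 'I_n -> R) : \sum_i F i = F (Ordinal ln) + \sum_(i < n | (i < n.-1)%N) F i.
  by rewrite (bigD1 (Ordinal ln)) //=; congr (_ + _); apply: eq_bigl => i; rewrite last_lt.
have last_ge0 : 0 <= mu 0 (Ordinal ln) + c.
  have lam0 : 0 <= (lam (Ordinal ln))%:R :> R by [].
  have := below n.-1; move: total; rewrite !split_last; lra.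
have z_ge0 i : 0 <= mu 0 i + c.
  by rewrite (le_trans last_ge0) // lerD2r dec //= -ltnS prednK.
have root_int (alpha : 'rV[R]_n) i : alpha \in a_positive_roots -> alpha 0 i \is a Num.int.
  move=> /a_rootP[a [b [_ ->]]]; rewrite mxE [X in _ + X]mxE !basis_vecE.
  by rewrite rpredB // ?rpred_nat // intr_nat.
have nat_z i : exists k : nat, mu 0 i + c = k%:R.
  apply/natrP; rewrite natrEint z_ge0 andbT muE rpredB ?rpred_nat //.
  by rewrite big_seq rpred_sum // => alpha /sR /root_int.
have [k kE] := choice nat_z.
have kbelow : partial_sums_le k lam.
  move=> r; rewrite -(ler_nat R) !natr_sum; have := below r.
  by rewrite (eq_bigr _ (fun i _ => kE i)).
have wk : weight k = weight lam.
  apply/eqP; rewrite -(eqr_nat R) /weight !natr_sum -total.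
  by apply/eqP; apply: eq_bigr => i _; rewrite kE.
have kD i : (k i < (weight lam).+1)%N by exact: le_of_weight.
have mE : (fun i => [ffun i => Ordinal (kD i)] i : nat) = k.
  by apply/funext => i; rewrite ffunE.
exists [ffun i => Ordinal (kD i)]; rewrite mE; split=> //.
- by rewrite wk.
- by apply/rowP => i; rewrite (pi_proj_weight i wk) -kE /c; ring.
- by move=> i j ij; rewrite -(ler_nat R) -!kE lerD2r dec.
Qed.

Lemma dot_pi_proj (v t : 'rV[R]_n) : sum_zero_space t -> dot (pi_proj v) t = dot v t.
Proof.
rewrite /sum_zero_space /= => t0; rewrite /pi_proj dotDl dotNl dotZl.
have -> : dot omega t = 0.
  by rewrite -[RHS]t0; apply: eq_bigr => i _; rewrite mxE mul1r.
by rewrite mulr0 subr0.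
Qed.

(** The projection is injective on exponents of fixed weight, so nothing is lost by lifting. Against
    a t of sum zero the projection disappears from the pairing, and the exponential becomes the
    monomial in e^(t_i). *)
Lemma a_expansion lam (u : R) k f : partition_of_length lam ->
  real_jacobi (sum_zero_space : set 'rV[R]_n) a_positive_roots k (pi_proj (weight_vec lam)) u f ->
  exists2 c : multi n (weight lam) -> R, triangular u c &
    forall t, sum_zero_space t -> f t = expansion expR c t.
Proof.
move=> plam fJ; set D := weight lam.
pose P (m : multi n D) := weight (fun i => m i : nat) == D.
have Ptop : P (top_multi lam).
  by apply/eqP; apply: eq_bigr => i _; rewrite top_multiE.
have phitop : pi_proj (weight_vec (fun i => top_multi lam i : nat)) = pi_proj (weight_vec lam) :> 'rV[R]_n.
  by rewrite weight_vec_top.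
have [e [fE esupp etop]] := real_jacobi_sum (@pi_proj_weight_inj D) Ptop phitop plam
  (fun mu => @a_dominant_below lam mu plam) fJ.
pose phi (m : multi n D) : 'rV[R]_n := pi_proj (weight_vec (fun i => m i : nat)).
pose O (m k' : multi n D) := P k' /\ weyl_orbit a_positive_roots (phi m) (phi k').
have wswap a b (m : multi n D) : weight (fun i => swap a b m i : nat) = weight (fun i => m i : nat).
  by apply: (@weight_perm _ _ _ (tperm a b)) => i; rewrite ffunE.
have phi_swap a b (m : multi n D) : P m -> phi (swap a b m) = \row_l phi m 0 (tperm a b l).
  move=> Pm; apply/rowP => l; rewrite mxE /phi.
  rewrite (@pi_proj_weight D) ?wswap; last exact/eqP.
  by rewrite (@pi_proj_weight D) ?ffunE //; exact/eqP.
have Operm (m k' : multi n D) : P m -> O m k' -> exists s : 'S_n, forall i, (k' i : nat) = m (s i).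
  move=> /eqP Pm [/eqP Pk /a_orbit_perm[s sE]]; exists s => i.
  have := sE i; rewrite /phi (pi_proj_weight i Pk) (pi_proj_weight (s i) Pm) => /addIr/eqP.
  by rewrite eqr_nat => /eqP.
have [||||_ tri] := @orbit_triangular R n lam u e O plam _ etop.
- by move=> m /esupp[].
- by move=> m k' /esupp[Pm _ _]; exact: Operm.
- move=> m k' a b _ [Pk Ok]; split; first by rewrite /P wswap.
  by rewrite phi_swap //; exact: weyl_orbit_tperm (@a_root_mem R n) Ok.
- by split=> //; exact: weyl_orbit_refl.
set c := fun k => if _ then _ else _ in tri; exists c => // t t0.
rewrite fE // /expansion /c.
under [RHS]eq_bigr => k' _.
  rewrite (_ : (if _ then _ else _) = \sum_m e m * `[<O m k'>]%:R); last first.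
    case: ifP => // /negP nP; rewrite big1 // => m _.
    by case: asboolP => [[/nP]|_] //; rewrite mulr0.
  rewrite mulr_suml; over.
rewrite exchange_big; apply: eq_bigr => m _ /=.
have [->|em] := eqVneq (e m) 0; first by rewrite mul0r big1 // => i _; rewrite !mul0r.
have [Pm _ _] := esupp _ em.
under [RHS]eq_bigr do rewrite -mulrA.
rewrite -mulr_sumr; congr (_ * _).
rewrite /orbit_sum (@fsum_finType _ _ _ phi P) => [||v Ov]; first last.
- have [s sE] := a_orbit_perm Ov.
  pose k' : multi n D := [ffun i => m (s i)].
  have wk : weight (fun i => k' i : nat) = D.
    apply: etrans (eqP Pm); by apply: (@weight_perm _ _ _ s) => i; rewrite ffunE.
  exists k'; first exact/eqP.
  apply/rowP => i; rewrite sE (pi_proj_weight (s i) (eqP Pm)) /phi (pi_proj_weight i wk).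
  by rewrite ffunE.
- exact: pi_proj_weight_inj.
rewrite big_mkcond; apply: eq_bigr => k' _.
rewrite /O; case: asboolP => Ok; rewrite ?andbT ?andbF; last first.
  by rewrite (_ : `[<_>] = false) ?mul0r //; apply/asboolP => -[].
case: ifP => Pk; last first.
  by rewrite (_ : `[<_>] = false) ?mul0r //; apply/asboolP => -[H _]; exact: (negP (negbT Pk)).
rewrite (_ : `[<_>] = true) ?mul1r; last exact/asboolP.
rewrite /phi dot_pi_proj // /dot /mono expR_sum; apply: eq_bigr => i _.
by rewrite weight_vecE expRM_natl.
Qed.

End TypeA.

(** * The eigenvalue equation in type A *)

Section TypeAEquation.
Variables (R : realType) (n : nat).
Hypothesis n_gt0 : (0 < n)%N.
Implicit Types (lam : 'I_n -> nat) (v t : 'rV[R]_n).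

Lemma pi_proj_norm (D : nat) (m : 'I_n -> nat) : weight m = D ->
  dot (pi_proj (weight_vec m)) (pi_proj (weight_vec m) : 'rV[R]_n)
  = \sum_i (m i)%:R ^+ 2 - n%:R^-1 * D%:R ^+ 2.
Proof.
move=> wm; rewrite dot_pi_proj; last exact: pi_proj_sum_zero.
rewrite /dot; under eq_bigr do rewrite (pi_proj_weight R _ wm) weight_vecE mulrBr -expr2.
rewrite sumrB -mulr_suml -natr_sum -/(weight m) wm; ring.
Qed.

Lemma sum_neq_const (i : 'I_n) (x : R) : \sum_(j < n | j != i) x = n.-1%:R * x.
Proof.
rewrite sumr_const mulr_natl; congr (_ *+ _).
by rewrite -[n in RHS]card_ord -(cardC1 i); apply: eq_card.
Qed.

Lemma a_eigenvalue (kappa : R) lam :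
  dot (pi_proj (weight_vec lam)) (pi_proj (weight_vec lam) + 2 *: rho a_positive_roots (fun=> kappa))
  = jack_eigenvalue kappa lam + (weight lam)%:R - n%:R^-1 * (weight lam)%:R ^+ 2
    - kappa * n.-1%:R * (weight lam)%:R.
Proof.
rewrite dotDr (pi_proj_norm (erefl (weight lam))).
rewrite /rho scalerA divff ?pnatr_eq0 // scale1r dotC dot_suml.
rewrite /a_positive_roots big_map.
rewrite (eq_big_seq (fun ij : 'I_n * 'I_n =>
   kappa * (lam ij.1)%:R * (2 * (ij.1 < ij.2)%N%:R - 1) + kappa * (lam ij.2)%:R * (2 * (ij.2 < ij.1)%N%:R - 1))).
  rewrite (sum_pairs (fun i j => kappa * (lam i)%:R * (2 * (i < j)%N%:R - 1))).
  rewrite /jack_eigenvalue.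
  have -> : \sum_i \sum_(j < n | j != i) kappa * (lam i)%:R * (2 * (i < j)%N%:R - 1)
      = \sum_i (kappa * (lam i)%:R * (2 * (n - i.+1)%N%:R - n.-1%:R)).
    apply: eq_bigr => i _; rewrite -mulr_sumr sumrB sum_neq_const mulr1 -mulr_sumr.
    congr (_ * (_ * _ - _)).
    by rewrite -(sum_ltn_ord i) natr_sum [RHS](bigD1 i) //= ltnn add0r.
  have -> : kappa * n.-1%:R * (weight lam)%:R = \sum_i kappa * n.-1%:R * (lam i)%:R.
    by rewrite /weight natr_sum mulr_sumr.
  have E : (weight lam)%:R = \sum_i (lam i)%:R :> R by rewrite /weight natr_sum.
  have key : \sum_i (lam i)%:R ^+ 2 + \sum_i kappa * (lam i)%:R * (2 * (n - i.+1)%N%:R - n.-1%:R)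
     = \sum_(i < n) (lam i)%:R * ((lam i)%:R - 1 + 2%:R * kappa * (n - i.+1)%:R)
       + \sum_i (lam i)%:R - \sum_i kappa * n.-1%:R * (lam i)%:R :> R.
    by rewrite -!big_split -sumrB; apply: eq_bigr => i _ /=; ring.
  by rewrite addrAC key -E; ring.
move=> [i j]; rewrite mem_enum inE /= => ij.
rewrite ij [(j < i)%N]ltnNge (ltnW ij) /= mulr1n mulr0n dotZl dotDl dotNl !dot_basis.
by rewrite !(pi_proj_weight R _ (erefl (weight lam))); ring.
Qed.

(** This is 2 p / (p - q) - 1: the fraction is the Jack kernel, and the constants -1 sum to the
    scalar - kappa (n-1) |lam|, which also occurs in the eigenvalue. *)
Lemma coth_ln (p q : R) : 0 < p -> 0 < q -> p != q ->
  coth ((ln p - ln q) / 2) = (p + q) / (p - q).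
Proof.
move=> p0 q0 pq; rewrite /coth /cosh /sinh mulrBl opprD opprK !expRD !expRN.
have sq (r : R) : 0 < r -> r = expR (ln r / 2) ^+ 2.
  by move=> r0; rewrite -expRM_natl -{1}(lnK r0); congr expR; field.
have := sq p p0; have := sq q q0.
have := expR_gt0 (ln p / 2); have := expR_gt0 (ln q / 2).
move: (expR (ln p / 2)) (expR (ln q / 2)) => x y y0 x0 qE pE.
have nx : x != 0 by rewrite gt_eqF.
have ny : y != 0 by rewrite gt_eqF.
have xy : x ^+ 2 - y ^+ 2 != 0 by move: pq; rewrite qE pE subr_eq0.
by rewrite qE pE; field; rewrite nx ny xy.
Qed.

(** Points e^t with t of sum zero have product 1, so x is reached only up to the common factor exp(-
    mean). All monomials have degree |lam| and the factors in the symbol are invariant under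
    scaling, so homogeneity extends the equation to x. The terms - |lam|^2 / n due to the projection
    agree on both sides. *)
Lemma a_jack_equation (kappa u : R) lam f (c : multi n (weight lam) -> R) :
  triangular u c ->
  real_jacobi (sum_zero_space : set 'rV[R]_n) a_positive_roots (fun=> kappa) (pi_proj (weight_vec lam)) u f ->
  (forall t, sum_zero_space t -> f t = expansion expR c t) ->
  jack_equation kappa c.
Proof.
move=> ctri [_ [b bo beq]] fE x x1 xinj; set D := weight lam.
have x0 i : 0 < x i by exact: lt_trans (x1 i).
pose t : 'rV[R]_n := pi_proj (\row_i ln (x i)).
have tA : sum_zero_space t by exact: pi_proj_sum_zero.
pose mean : R := n%:R^-1 * \sum_j ln (x j).
have tE i : t 0 i = ln (x i) - mean.
  by rewrite /t pi_projE mxE; congr (_ - _ * _); apply: eq_bigr => j _; rewrite mxE.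
have expt : (fun i => expR (t 0 i)) = (fun i => x i * expR (- mean)).
  by apply/funext => i; rewrite tE expRD lnK ?posrE.
have tdiff i j : t 0 i - t 0 j = ln (x i) - ln (x j) by rewrite !tE; ring.
have reg alpha : alpha \in a_positive_roots -> dot alpha t != 0.
  move=> /a_rootP[i [j [ij ->]]]; rewrite dotDl dotNl !dot_basis tdiff subr_eq0.
  by apply: contraTneq ij => /ln_inj/xinj; rewrite !posrE => -> //; rewrite ltnn.
have d1 (v : R) : is_derive v (1 : R) expR (expR v * 1) by rewrite mulr1; exact: is_derive_expR.
have d2 (v : R) : is_derive v (1 : R) (fun=> 1 : R) 0 by exact: is_derive_cst.
have := beq t tA reg.
rewrite (@real_jacobi_operator_expansion R n _ _ _ _ d1 d2 sum_zero_space b _ _ f c t) //; last first.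
- by move=> v; exact: a_root_sum_zero.
- by case: bo.
- move=> v s tau v0 s0; rewrite /sum_zero_space /=.
  under eq_bigr do rewrite mxE [X in X + _]mxE.
  by rewrite big_split /= -mulr_sumr [X in _ * X]v0 [X in _ + X]s0 mulr0 addr0.
rewrite a_eigenvalue fE // /expansion => /eqP; rewrite -subr_eq0 mulr_sumr -sumrB => /eqP E.
have S0 : expR (- mean) ^+ D != 0 by rewrite expf_neq0 // gt_eqF // expR_gt0.
apply: (mulfI S0); rewrite mulr0 -[RHS]E mulr_sumr; apply: eq_bigr => m _.
have [->|cm] := eqVneq (c m) 0; first by rewrite !(mul0r, mulr0) subrr.
have wm : weight (fun i => m i : nat) = D by case: ctri => + _ _ _; apply.
rewrite expt mono_scale wm.
have DE : D%:R = \sum_i (m i)%:R :> R.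
  by transitivity ((weight (fun i => m i : nat))%:R : R); [rewrite wm | exact: natr_sum].
have lE v : sum_zero_space v -> log_derivative (fun=> 1) (fun i => m i : nat) v t
    = dot (pi_proj (weight_vec (fun i => m i : nat))) v.
  by move=> v0; rewrite dot_pi_proj //; apply: eq_bigr => i _; rewrite weight_vecE mulr1.
have -> : \sum_(v <- b) (log_derivative (fun=> 1) (fun i => m i : nat) v t ^+ 2
     + \sum_i (m i)%:R * (v 0 i ^+ 2 * 0)) = \sum_i (m i)%:R ^+ 2 - n%:R^-1 * D%:R ^+ 2.
  rewrite -(pi_proj_norm wm) -(parseval bo (pi_proj_sum_zero n_gt0 _)).
  have [_ ba _ _] := bo; apply: eq_big_seq => v /ba v0.
  by rewrite lE // big1 ?addr0 // => i _; rewrite !mulr0.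
have -> : \sum_(v <- a_positive_roots) kappa * coth (dot v t / 2)
      * log_derivative (fun=> 1) (fun i => m i : nat) v t
   = \sum_i (2 * kappa * ((m i)%:R * \sum_(j < n | j != i) x i / (x i - x j)))
     - kappa * n.-1%:R * D%:R.
  rewrite /a_positive_roots big_map.
  rewrite (eq_big_seq (fun ij : 'I_n * 'I_n =>
     kappa * (m ij.1)%:R * (2 * (x ij.1 / (x ij.1 - x ij.2)) - 1)
     + kappa * (m ij.2)%:R * (2 * (x ij.2 / (x ij.2 - x ij.1)) - 1))).
    rewrite (sum_pairs (fun i j => kappa * (m i)%:R * (2 * (x i / (x i - x j)) - 1))).
    have -> : kappa * n.-1%:R * D%:R = \sum_i kappa * n.-1%:R * (m i)%:R.
      by rewrite DE mulr_sumr.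
    rewrite -sumrB; apply: eq_bigr => i _.
    by rewrite -mulr_sumr sumrB sum_neq_const -mulr_sumr; ring.
  move=> [i j]; rewrite mem_enum inE /= => ij.
  have xij : x i != x j by apply: contraTneq ij => /xinj ->; rewrite ltnn.
  have xd : x i - x j != 0 by rewrite subr_eq0.
  have xd' : x j - x i != 0 by rewrite subr_eq0 eq_sym.
  rewrite dotDl dotNl !dot_basis tdiff coth_ln // log_derivativeB !log_derivative_basis.
  by field; rewrite xd xd'.
have -> : jack_symbol kappa lam (fun i => m i : nat) x
    = \sum_i (m i)%:R ^+ 2 + \sum_i (2 * kappa * ((m i)%:R * \sum_(j < n | j != i) x i / (x i - x j)))
      - D%:R - jack_eigenvalue kappa lam.
  by rewrite DE -big_split -sumrB; congr (_ - _); apply: eq_bigr => i _; rewrite /jack_factor /=; ring.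
ring.
Qed.

End TypeAEquation.

(** * The limit theorem *)

Local Open Scope complex_scope.

Section RealParts.
Variables (R : realType) (n : nat).
Implicit Types (lam : 'I_n -> nat) (x : 'I_n -> R).

Lemma mono_realC (m : 'I_n -> nat) x : mono (fun i => (x i)%:C) m = (mono x m)%:C.
Proof. by rewrite /mono rmorph_prod; apply: eq_bigr => i _; rewrite rmorphXn. Qed.

Lemma jack_symbol_realC (kappa : R) lam (m : 'I_n -> nat) x :
  jack_symbol kappa%:C lam m (fun i => (x i)%:C) = (jack_symbol kappa lam m x)%:C.
Proof.
rewrite /jack_symbol /jack_eigenvalue rmorphB !rmorph_sum; congr (_ - _); apply: eq_bigr => i _.
  rewrite /jack_factor !(rmorphD, rmorphM, rmorphN, rmorphB, rmorph1, rmorph_nat, rmorph_sum) /=.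
  congr (_ + _ * (_ * _)); apply: eq_bigr => j _.
  by rewrite rmorphM fmorphV rmorphB.
by rewrite !(rmorphD, rmorphM, rmorphN, rmorphB, rmorph1, rmorph_nat).
Qed.

Lemma triangular_parts lam (r : multi n (weight lam) -> R[i]) : triangular 1 r ->
  triangular 1 (fun m => complex.Re (r m)) /\ triangular 0 (fun m => complex.Im (r m)).
Proof.
move=> [rw rs rd rt].
have nRe m : complex.Re (r m) != 0 -> r m != 0 by apply: contra_neq => ->.
have nIm m : complex.Im (r m) != 0 -> r m != 0 by apply: contra_neq => ->.
split; split.
- by move=> m /nRe/rw.
- by move=> a b m; rewrite rs.
- by move=> m /nRe/rd.
- by move=> m /rt ->.
- by move=> m /nIm/rw.
- by move=> a b m; rewrite rs.
- by move=> m /nIm/rd.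
- by move=> m /rt ->.
Qed.

Lemma jack_real_expansion (k3 : R) lam (p : mpoly_over (R[i]) n) :
  partition_of_length lam -> is_jack k3%:C lam p ->
  exists r1 r2 : multi n (weight lam) -> R,
    [/\ triangular 1 r1, triangular 0 r2, jack_equation k3 r1, jack_equation k3 r2
      & forall x, jack_value p x
          = (\sum_(m : multi n (weight lam)) r1 m * mono x (fun i => m i : nat))
            +i* (\sum_(m : multi n (weight lam)) r2 m * mono x (fun i => m i : nat))].
Proof.
move=> plam pj; have [r rtri [rval req]] := jack_expansion plam pj.
have [t1 t2] := triangular_parts rtri.
have req' x : injective x -> \sum_(m : multi n (weight lam)) (mono x (fun i => m i : nat)
     * jack_symbol k3 lam (fun i => m i : nat) x)%:C * r m = 0.
  move=> xinj; have zinj : injective (fun i => (x i)%:C) by move=> i j /complexI/xinj.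
  rewrite -[RHS](req _ zinj); apply: eq_bigr => m _.
  by rewrite mono_realC jack_symbol_realC -rmorphM mulrC.
exists (fun m => complex.Re (r m)), (fun m => complex.Im (r m)); split=> //.
- move=> x _ xinj; have /(congr1 (@complex.Re R)) := req' x xinj.
  rewrite Re_sum => E; rewrite -[RHS]E; apply: eq_bigr => m _.
  by rewrite Re_realM mulrC.
- move=> x _ xinj; have /(congr1 (@complex.Im R)) := req' x xinj.
  rewrite Im_sum => E; rewrite -[RHS]E; apply: eq_bigr => m _.
  by rewrite Im_realM mulrC.
move=> x; rewrite /jack_value rval; apply/eqP; rewrite eq_complex /= Re_sum Im_sum.
apply/andP; split; apply/eqP; apply: eq_bigr => m _; rewrite mono_realC mulrC.
  by rewrite Re_realM mulrC.
by rewrite Im_realM mulrC.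
Qed.

Lemma bc_dominant_finite lam :
  finite_set (dominant_weight [set: 'rV[R]_n] bc_positive_roots
    `&` [set mu | weight_lt bc_positive_roots mu (weight_vec lam)]).
Proof.
apply: (@sub_finite_set _ _ (range (fun m : multi n (weight lam) => weight_vec (fun i => m i : nat) : 'rV[R]_n))).
  by move=> mu /bc_dominant_below[m [_ <-] _]; exists m.
exact/finite_image/finite_finset.
Qed.

Lemma a_dominant_finite lam : (0 < n)%N -> partition_of_length lam ->
  finite_set (dominant_weight (sum_zero_space : set 'rV[R]_n) a_positive_roots
    `&` [set mu | weight_lt a_positive_roots mu (pi_proj (weight_vec lam))]).
Proof.
move=> n0 plam.
apply: (@sub_finite_set _ _ (range (fun m : multi n (weight lam) => pi_proj (weight_vec (fun i => m i : nat)) : 'rV[R]_n))).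
  by move=> mu /(a_dominant_below n0 plam)[m [_ <-] _]; exists m.
exact/finite_image/finite_finset.
Qed.

Lemma real_natX (N k : nat) : (N%:R : R[i]) ^+ k = ((N%:R : R) ^+ k)%:C.
Proof. by rewrite rmorphXn rmorph_nat. Qed.

Lemma bc_locally_uniform_cvg (a : \bar R) (k3 : R) lam (PBC : R * R -> 'rV[R]_n -> R[i])
    (p : mpoly_over (R[i]) n) :
  (0%E <= a)%E -> 0 <= k3 -> partition_of_length lam ->
  (forall k1 k2 : R, 0 <= k1 -> 0 <= k2 -> is_jacobi_BC k1 k2 k3 (weight_vec lam) (PBC (k1, k2))) ->
  is_jack k3%:C lam p ->
  locally_uniform_cvg (mult_limit a) PBC
    (fun t => 4 ^+ weight lam * jack_value p (fun i => gamma_lim a + sinh (t 0 i / 2) ^+ 2)).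
Proof.
move=> a0 k30 plam PJ pj.
have [r1 [r2 [t1 t2 e1 e2 val]]] := jack_real_expansion plam pj.
have [g0 g1] := gamma_lim_bounds a0.
apply: locally_uniform_cvg_parts => t0.
exists [set t : 'rV[R]_n | forall i, `|t 0 i| <= `|t0 0 i| + 1].
  apply/nbhs_ballP; exists 1 => //= t [_ tb] i.
  have := tb 0 i; rewrite /ball /= => h.
  have -> : t 0 i = t0 0 i - (t0 0 i - t 0 i) by ring.
  by rewrite (le_trans (ler_normB _ _)) // lerD2l ltW.
move=> eps eps0.
have [C1 [L1 [C10 L10 H1]]] := bc_locally_uniform t0 k30 plam t1 e1 g0 g1.
have [C2 [L2 [C20 L20 H2]]] := bc_locally_uniform t0 k30 plam t2 e2 g0 g1.
(* The summand 1 makes L positive, so that one may divide by it. Both |g - gamma_a| and 1 / (k1 +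
   k2) will be at most d, and L (d + d) = eps. *)
pose L := L1 + L2 + 1.
have L0 : 0 < L by rewrite /L; lra.
pose d := eps / (2 * L).
have d0 : 0 < d by rewrite divr_gt0 // mulr_gt0.
have C0 : 0 <= C1 + C2 + d^-1 by rewrite !addr_ge0 // invr_ge0 ltW.
apply: filterS (mult_limit_gamma a0 C0 d0) => -[k1 k2] /= [k10 k20 kC gk] t tU.
have di : 0 < d^-1 by rewrite invr_gt0.
have kp : 0 < k1 + k2 by lra.
have kd : (k1 + k2)^-1 <= d.
  by rewrite invf_ple ?posrE // ltW // (le_lt_trans _ kC) // lerDr addr_ge0.
have dE : L * (d + d) = eps.
  by rewrite /d; field; rewrite gt_eqF.
have [J1 J2] := is_jacobi_parts (bc_dominant_finite lam) (PJ k1 k2 k10 k20).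
have kC1 : C1 < k1 + k2 by lra.
have kC2 : C2 < k1 + k2 by lra.
rewrite val real_natX Re_realM Im_realM /=.
have s0 : 0 <= `|(k1 + k2) / (k1 + 2 * k2) - gamma_lim a| + (k1 + k2)^-1.
  by rewrite addr_ge0 // invr_ge0 ltW.
split.
  apply: (le_trans (H1 k1 k2 _ t k10 k20 kC1 tU J1)).
  by rewrite -dE ler_pM // ?lerD // /L; lra.
apply: (le_trans (H2 k1 k2 _ t k10 k20 kC2 tU J2)).
by rewrite -dE ler_pM // ?lerD // /L; lra.
Qed.

(** By uniqueness the type A polynomial has the coefficients r. Evaluating it after the projection
    divides y by its geometric mean exp(mean); homogeneity restores the factor exp(mean)^|lam|,
    which is the power of the product once 4^|lam| is included. *)
Lemma a_value (kappa u : R) lam f (r : multi n (weight lam) -> R) :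
  (0 < n)%N -> 0 <= kappa -> partition_of_length lam -> triangular u r -> jack_equation kappa r ->
  real_jacobi (sum_zero_space : set 'rV[R]_n) a_positive_roots (fun=> kappa) (pi_proj (weight_vec lam)) u f ->
  forall y : 'I_n -> R, (forall i, 0 < y i) ->
    4 ^+ weight lam * (\sum_(m : multi n (weight lam)) r m * mono y (fun i => m i : nat))
    = (\prod_i (4 * y i)) `^ ((weight lam)%:R / n%:R) * f (pi_proj (\row_i ln (y i))).
Proof.
move=> n0 k0 plam tr er fJ y y0; set D := weight lam.
have [c ctri fE] := a_expansion n0 plam fJ.
have ceq := a_jack_equation n0 ctri fJ fE.
have cr : c = r := triangular_unique k0 ctri tr ceq er.
have nz : (n%:R : R) != 0 by rewrite pnatr_eq0 -lt0n.
rewrite fE; last exact: pi_proj_sum_zero.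
pose mean : R := n%:R^-1 * \sum_i ln (y i).
rewrite cr /expansion.
have -> : (fun i => expR (pi_proj (\row_i ln (y i)) 0 i)) = (fun i => y i * expR (- mean)).
  apply/funext => i; rewrite pi_projE mxE expRD lnK ?posrE //; congr (_ * expR (- (_ * _))).
  by apply: eq_bigr => j _; rewrite mxE.
have -> : (\prod_i (4 * y i)) `^ (D%:R / n%:R) = 4 ^+ D * expR mean ^+ D.
  have p0 : 0 < \prod_i (4 * y i) by rewrite prodr_gt0 // => i _; rewrite mulr_gt0.
  rewrite /powR gt_eqF //.
  have -> : ln (\prod_i (4 * y i)) = n%:R * (ln 4 + mean).
    have -> : \prod_i (4 * y i) = expR (\sum_i (ln 4 + ln (y i))).
      by rewrite expR_sum; apply: eq_bigr => i _; rewrite expRD !lnK ?posrE.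
    rewrite expRK big_split /= sumr_const card_ord mulrDr mulr_natl; congr (_ + _).
    by rewrite /mean mulrA divff // mul1r.
  by rewrite mulrA divfK // mulrDr expRD !expRM_natl lnK ?posrE.
rewrite -mulrA; congr (_ * _); rewrite mulr_sumr; apply: eq_bigr => m _.
have [->|rm] := eqVneq (r m) 0; first by rewrite !mul0r mulr0.
rewrite mono_scale.
have -> : weight (fun i => m i : nat) = D by case: tr => + _ _ _; apply.
have := expRxMexpNx_1 mean; move: (expR mean) (expR (- mean)) => p q pq.
have pqD : p ^+ D * q ^+ D = 1 by rewrite -exprMn pq expr1n.
by rewrite mulrCA [mono _ _ * _]mulrC [p ^+ D * _]mulrA pqD mul1r.
Qed.

End RealParts.

Theorem theorem4p2 (R : realType) (n : nat) (n_gt0 : (0 < n)%N)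
    (a : \bar R) (a_ge0 : (0%E <= a)%E) (k3 : R) (k3_ge0 : 0 <= k3)
    (lam : 'I_n -> nat) (lam_partition : partition_of_length lam)
    (PBC : R * R -> 'rV[R]_n -> R[i])
    (PBC_jacobi : forall k1 k2 : R, 0 <= k1 -> 0 <= k2 ->
       is_jacobi_BC k1 k2 k3 (weight_vec lam) (PBC (k1, k2)))
    (j : mpoly_over (R[i]) n) (j_jack : is_jack k3%:C lam j) :
  locally_uniform_cvg (mult_limit a) PBC
    (fun t => 4 ^+ weight lam
              * jack_value j (fun i => gamma_lim a + sinh (t 0 i / 2) ^+ 2))
  /\
  (a = +oo%E ->
     locally_uniform_cvg (mult_limit a) PBC
       (fun t => 4 ^+ weight lam
                 * jack_value j (fun i => cosh (t 0 i / 2) ^+ 2))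
     /\
     forall PA : 'rV[R]_n -> R[i],
       is_jacobi_A k3 (pi_proj (weight_vec lam)) PA ->
     forall t : 'rV[R]_n,
       4 ^+ weight lam * jack_value j (fun i => cosh (t 0 i / 2) ^+ 2)
       = ((\prod_(i < n) (4 * cosh (t 0 i / 2) ^+ 2))
            `^ ((weight lam)%:R / n%:R))%:C
         * PA (pi_proj (\row_i ln (cosh (t 0 i / 2) ^+ 2)))).
Proof.
have main := bc_locally_uniform_cvg a_ge0 k3_ge0 lam_partition PBC_jacobi j_jack.
split; first exact: main.
move=> ainf; split.
  suff <- : (fun t : 'rV[R]_n => 4 ^+ weight lam
        * jack_value j (fun i => gamma_lim a + sinh (t 0 i / 2) ^+ 2))
      = (fun t => 4 ^+ weight lam * jack_value j (fun i => cosh (t 0 i / 2) ^+ 2)) by exact: main.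
  apply/funext => t; congr (_ * jack_value _ _); apply/funext => i.
  by rewrite ainf cosh_sqr.
move=> PA PAJ t.
have [r1 [r2 [t1 t2 e1 e2 ->]]] := jack_real_expansion lam_partition j_jack.
have [J1 J2] := is_jacobi_parts (a_dominant_finite R n_gt0 lam_partition) PAJ.
have y0 i : 0 < cosh (t 0 i / 2) ^+ 2 by rewrite exprn_gt0 // cosh_gt0.
(* The prefactors are real, so the identity splits into one for the real parts, with leading
   coefficient 1, and one for the imaginary parts, with leading coefficient 0. *)
apply/eqP; rewrite eq_complex real_natX !Re_realM !Im_realM /=.
rewrite (a_value n_gt0 k3_ge0 lam_partition t1 e1 J1 y0) eqxx.
by rewrite (a_value n_gt0 k3_ge0 lam_partition t2 e2 J2 y0) eqxx.
Qed.
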